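(* Let $D$ be a simply connected bounded domain in $\mathbb{C}$. Then $D$ is a John disk if and only if there exists a constant $c_2\ge 1$ such that for any two points $z_1,z_2\in D$, $$m_D(z_1,z_2)\le c_2\, j'_D(z_1,z_2).$$
   Context: For a bounded domain $D\subset\mathbb{C}$, $\delta_D(z)=\inf\{|z-\xi|:\xi\in\partial D\}$ and $d(D)=\sup\{|x-y|:x,y\in D\}$. The metric $m_D$ is $$m_D(z_1,z_2)=\inf_\gamma\int_\gamma\frac{d(D)\,|dz|}{\delta_D(z)\,(d(D)-\delta_D(z))},$$ the infimum being over all rectifiable paths $\gamma$ in $D$ joining $z_1$ to $z_2$. The inner distance is $\lambda_D(z_1,z_2)=\inf_\gamma\ell(\gamma)$, the infimum over all rectifiable paths $\gamma$ in $D$ joining $z_1$ to $z_2$, where $\ell$ is Euclidean length, and $$j'_D(z_1,z_2)=\frac12\log\left\{\left(1+\frac{\lambda_D(z_1,z_2)}{\delta_D(z_1)}\right)\left(1+\frac{\lambda_D(z_1,z_2)}{\delta_D(z_2)}\right)\right\}.$$ A bounded simply connected domain $D\subset\mathbb{C}$ is a John disk if there is a constant $c\ge1$ such that each pair of points $z_1,z_2\in D$ can be joined by a rectifiable arc $\gamma$ in $D$ with $\min_{j=1,2}\ell(\gamma(z_j,z))\le c\,\delta_D(z)$ for all $z\in\gamma$, where $\gamma(z_j,z)$ is the subarc of $\gamma$ between $z_j$ and $z$. *)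

(* Defs.v *)
From HB Require Import structures.
From mathcomp Require Import all_boot all_order all_algebra.
From mathcomp Require Import all_classical all_reals all_analysis.
From mathcomp Require Import complex.

Set Implicit Arguments.
Unset Strict Implicit.
Unset Printing Implicit Defensive.

Import Order.TTheory GRing.Theory Num.Theory numFieldNormedType.Exports.

Local Open Scope classical_set_scope.
Local Open Scope ring_scope.

(* The complex plane is R[i]^o: only the regular module carries the topology of
   the norm.  The library norm of R[i] takes its values in R[i]; normc is the
   same modulus with values in R. *)
Notation normc := ComplexField.Normc.normc.

Definition domain (R : realType) (D : set R[i]^o) : Prop :=
  [/\ D !=set0, open D & connected D].

(* H (s, t) is the value at parameter t of the loop at stage s of the
   contraction, with base point fixed. *)
Definition null_homotopic (R : realType) (D : set R[i]^o) (g : R -> R[i]^o) :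
    Prop :=
  exists H : R * R -> R[i]^o,
    [/\ {within `[0, 1] `*` `[0, 1], continuous H},
        H @` (`[0, 1] `*` `[0, 1]) `<=` D,
        {in `[0, 1], forall t, H (0, t) = g t},
        {in `[0, 1], forall t, H (1, t) = g 0} &
        {in `[0, 1], forall s, H (s, 0) = g 0 /\ H (s, 1) = g 0}].

Definition simply_connected (R : realType) (D : set R[i]^o) : Prop :=
  forall g : R -> R[i]^o, {within `[0, 1], continuous g} ->
    g @` `[0, 1] `<=` D -> g 0 = g 1 -> null_homotopic D g.

Definition boundary (R : realType) (D : set R[i]^o) : set R[i]^o :=
  closure D `\` interior D.

Definition delta (R : realType) (D : set R[i]^o) (z : R[i]^o) : R :=
  inf [set normc (z - xi) | xi in boundary D].

Definition diameter (R : realType) (D : set R[i]^o) : R :=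
  sup [set normc (x - y) | x in D & y in D].

(* Complex-valued analogue of [variation]: the partition a < s_1 < ... < s_n = b
   is given by the list of its points after a. *)
Definition polygonal_length (R : realType) (a b : R) (g : R -> R[i]^o)
    (s : seq R) : R :=
  let F := g \o nth b (a :: s) in
  \sum_(0 <= n < size s) normc (F n.+1 - F n).

Definition arc_length (R : realType) (a b : R) (g : R -> R[i]^o) : \bar R :=
  ereal_sup [set (polygonal_length a b g s)%:E | s in itv_partition a b].

(* Paths are parametrized by compact intervals [a, b] with a <= b; the case
   a = b is the path (and arc) reduced to a point. *)
Definition rectifiable_path (R : realType) (D : set R[i]^o) (z1 z2 : R[i]^o)
    (a b : R) (g : R -> R[i]^o) : Prop :=
  [/\ a <= b, {within `[a, b], continuous g}, g @` `[a, b] `<=` D,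
      g a = z1 /\ g b = z2 & (arc_length a b g < +oo)%E].

Definition rectifiable_arc (R : realType) (D : set R[i]^o) (z1 z2 : R[i]^o)
    (a b : R) (g : R -> R[i]^o) : Prop :=
  rectifiable_path D z1 z2 a b g /\ {in `[a, b] &, injective g}.

(* The point at arc length s from g a along g; it does not depend on the chosen
   parameter t, as g is constant where its arc length does not increase. *)
Definition arc_length_param (R : realType) (a b : R) (g : R -> R[i]^o) (s : R) :
    R[i]^o :=
  g (get [set t | t \in `[a, b] /\ arc_length a t g = s%:E]).

(* Integral of rho |dz| along a rectifiable path. *)
Definition path_integral (R : realType) (rho : R[i]^o -> R) (a b : R)
    (g : R -> R[i]^o) : \bar R :=
  (\int[lebesgue_measure]_(s in `[0%R, fine (arc_length a b g)])
     (rho (arc_length_param a b g s))%:E)%E.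

Definition m_dist (R : realType) (D : set R[i]^o) (z1 z2 : R[i]^o) : \bar R :=
  let rho z := diameter D / (delta D z * (diameter D - delta D z)) in
  ereal_inf [set v | exists a b g,
    rectifiable_path D z1 z2 a b g /\ v = path_integral rho a b g].

Definition inner_dist (R : realType) (D : set R[i]^o) (z1 z2 : R[i]^o) :
    \bar R :=
  ereal_inf [set v | exists a b g,
    rectifiable_path D z1 z2 a b g /\ v = arc_length a b g].

(* inner_dist is finite on a domain, so that fine loses nothing. *)
Definition j'_dist (R : realType) (D : set R[i]^o) (z1 z2 : R[i]^o) : R :=
  let l := fine (inner_dist D z1 z2) in
  2^-1 * ln ((1 + l / delta D z1) * (1 + l / delta D z2)).

Definition john_disk (R : realType) (D : set R[i]^o) : Prop :=
  [/\ domain D, bounded_set D, simply_connected D &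
    exists2 c : R, 1 <= c & forall z1 z2, D z1 -> D z2 ->
      exists a b g, rectifiable_arc D z1 z2 a b g /\
        {in `[a, b], forall t,
          (Order.min (arc_length a t g) (arc_length t b g)
             <= (c * delta D (g t))%:E)%E}].

(* Main.v *)
Require Import Defs.
From mathcomp Require Import all_boot all_order all_algebra.
From mathcomp Require Import all_classical all_reals all_analysis.
From mathcomp Require Import complex.
From mathcomp Require Import measurable_realfun ring lra zify.

Import Order.TTheory GRing.Theory Num.Theory numFieldNormedType.Exports.

Local Open Scope classical_set_scope.
Local Open Scope ring_scope.

Set Implicit Arguments.
Unset Strict Implicit.
Unset Printing Implicit Defensive.

(** Write delta for the distance to the boundary of D and d for the diameter
of D.  As 2 delta <= d on D, the density of m_D lies between 1 / delta and
2 / delta, so m_D is comparable to the quasihyperbolic distance.  The latter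
is replaced by its discrete form: a chain is a list of points of D whose
consecutive members x, y satisfy |x - y| <= min (delta x, delta y) / 4, and
its cost is the sum of the |x - y| / min (delta x, delta y).  Sampling a
curve at equal arc length steps turns its m-length into the cost of a chain
([path_chain]), and the polygon through a chain, run at unit speed, gives
back a path of comparable m-length ([qle_m_dist]).

From the inequality m <= c2 j' to the John condition, no topology is needed.
Take a chain x_0, ..., x_n from z1 to z2 of nearly minimal cost.  Each
subchain is then nearly minimal too, so its cost is at most
2 c2 log (1 + l / min (delta x_i, delta x_j)) + 3, where l is its length.
If delta <= 2 min (delta x_i, delta x_j) along the subchain, its cost is also
at least l / (2 min (delta x_i, delta x_j)), hence
l <= C1 min (delta x_i, delta x_j), and delta is bounded below along it
([chain_comparison] in the proof).  Applied between successive points where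
delta doubles, this bounds the length of the chain up to x_k by C delta x_k
as long as k precedes a maximum of delta, and symmetrically after the maximum
([cigar_discrete]).  A loop erasure of the polygon through the chain, one
segment at a time ([chain_arc]), gives an injective arc and only shortens the
lengths, hence an arc as in the definition of a John disk
([john_arc_of_metric_bound]).

From the John condition to m <= c2 j', let lam = lambda_D (z1, z2).  If lam
is at most a fifth of delta z1 or of delta z2, one chain step joins z1 to z2.
Otherwise follow a John arc from each end up to length lam (or half its length
if it is shorter than 2 lam): a chain with geometrically growing steps shows
that this costs O (log (1 + lam / delta z_i)) ([carrot_chain]), and the two
points w1, w2 reached satisfy delta >= lam / c.  It remains to join w1 to w2
at bounded cost, although the middle of the John arc may be arbitrarily long.
Here simple connectedness enters, through [loop_bottleneck].  Close the middle
of the John arc by a path of length at most 4 lam from w2 to w1, put a square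
grid of side s = lam / (20 c) on the plane and take a box of bounded size
around w1.  Let V be the component of the cell of w1 among the cells of the
box on which delta is at least of order s.  The boundary of V inside the box
is a chain of grid edges mod 2.  The middle of the John arc never crosses it,
since delta is large there, so if w2 were not in V the closing path would
cross it an odd number of times.  But the number of crossings is, mod 2, the
sum of the winding numbers of the loop around the end points of that chain
([closed_grid_path_parity]).  These end points lie on the rim of the box, far
from the loop, and each of them is close to a point outside D, around which
the winding number vanishes because the loop is null-homotopic
([null_homotopic_parity]).  So w2 lies in V, and a path of cells in the box
is a chain of bounded cost.

Winding numbers are only needed mod 2, as the parity of the number of
crossings of a half-line by a finely sampled loop. *)

(** * The modulus of complex numbers, and continuity in epsilon-delta form *)

Section Modulus.
Variable R : realType.
Implicit Types x y z w : R[i]^o.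

Lemma normc_ge0 x : 0 <= normc x.
Proof. by case: x => a b; exact: sqrtr_ge0. Qed.

Lemma normcC x y : normc (x - y) = normc (y - x).
Proof. by rewrite -normcN opprB. Qed.

Lemma normc_triangle y x z : normc (x - z) <= normc (x - y) + normc (y - z).
Proof.
by apply: le_trans (le_normcD _ _); rewrite addrA subrK.
Qed.

Lemma normcxx x : normc (x - x) = 0.
Proof. by rewrite subrr; exact: ComplexField.Normc.normc0. Qed.

Lemma normc_eq0 x y : normc (x - y) = 0 -> x = y.
Proof. by move=> /ComplexField.Normc.eq0_normc /eqP; rewrite subr_eq0 => /eqP. Qed.

Lemma normc_real (t : R) x : normc (t%:C%C * x) = `|t| * normc x.
Proof. by rewrite ComplexField.Normc.normcM /= expr0n addr0 sqrtr_sqr. Qed.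

Lemma Re_le_normc x : `|complex.Re x| <= normc x.
Proof.
case: x => a b /=; rewrite -sqrtr_sqr ler_wsqrtr// lerDl; exact: sqr_ge0.
Qed.

Lemma Im_le_normc x : `|complex.Im x| <= normc x.
Proof.
case: x => a b /=; rewrite -sqrtr_sqr ler_wsqrtr// lerDr; exact: sqr_ge0.
Qed.

Lemma normc_le_ReIm x : normc x <= `|complex.Re x| + `|complex.Im x|.
Proof.
case: x => a b /=; have h : 0 <= `|a| + `|b| by rewrite addr_ge0.
rewrite -[leRHS]ger0_norm// -sqrtr_sqr ler_wsqrtr// sqrrD !real_normK ?num_real//.
by rewrite lerD2r lerDl mulrn_wge0// mulr_ge0.
Qed.

Lemma ReB x y : complex.Re (x - y) = complex.Re x - complex.Re y.
Proof. by case: x; case: y. Qed.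

Lemma ImB x y : complex.Im (x - y) = complex.Im x - complex.Im y.
Proof. by case: x; case: y. Qed.

Lemma ball_normc x (e : R) y : ball x (e%:C%C : R[i]) y <-> normc (x - y) < e.
Proof.
rewrite -ball_normE /= /ball_ /=.
have -> : `|x - y| = (normc (x - y))%:C%C by [].
by rewrite ltcR.
Qed.

Lemma nbhs_normcP x (A : set R[i]^o) :
  nbhs x A <-> exists2 e : R, 0 < e & forall y, normc (x - y) < e -> A y.
Proof.
split.
  move=> /nbhs_ballP[e e0 eA].
  have e0' : 0 < e by [].
  exists (complex.Re e).
    by move: e0'; rewrite ltcE => /andP[].
  move=> y xy; apply: eA.
  have -> : e = (complex.Re e)%:C%C.
    case: e e0' {e0 xy} => a b; rewrite ltcE /= => /andP[/eqP ->] _ //.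
  exact/ball_normc.
move=> [e e0 eA]; apply/nbhs_ballP; exists (e%:C%C); first by rewrite /= ltcR.
by move=> y /ball_normc; exact: eA.
Qed.

(** The point at parameter t of the segment from x to y. *)
Definition seg x y (t : R) : R[i]^o := x + t%:C%C * (y - x).

Lemma seg0 x y : seg x y 0 = x.
Proof. by rewrite /seg (_ : (0:R)%:C%C = 0 :> R[i])// mul0r addr0. Qed.
Lemma seg1 x y : seg x y 1 = y.
Proof. by rewrite /seg (_ : (1:R)%:C%C = 1 :> R[i])// mul1r addrC subrK. Qed.

Lemma seg_dist x y s t : normc (seg x y s - seg x y t) = `|s - t| * normc (x - y).
Proof.
rewrite (normcC x) -normc_real; congr ComplexField.Normc.normc; rewrite /seg.
by rewrite rmorphB /= mulrBl opprD addrACA subrr add0r.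
Qed.

Lemma seg_distl x y t : normc (seg x y t - x) = `|t| * normc (x - y).
Proof. by rewrite -{2}(seg0 x y) seg_dist subr0. Qed.

Lemma seg_distr x y t : normc (seg x y t - y) = `|1 - t| * normc (x - y).
Proof. by rewrite -{2}(seg1 x y) seg_dist distrC. Qed.

Lemma within_contP (A : set R) (g : R -> R[i]^o) :
  {within A, continuous g} <->
  (forall t, A t -> forall e : R, 0 < e -> exists2 d : R, 0 < d &
     forall u, A u -> `|t - u| < d -> normc (g t - g u) < e).
Proof.
split.
  move=> /subspace_continuousP cg x Ax e e0.
  have /(cg x Ax) : nbhs (g x) [set w | normc (g x - w) < e].
    by apply/nbhs_normcP; exists e.
  move=> /nbhs_ballP[d /= d0 dA]; exists d => // y Ay xy.
  by apply: dA.
move=> H; apply/subspace_continuousP => x Ax B /nbhs_normcP[e e0 eB].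
have [d d0 dH] := H _ Ax e e0.
by apply/nbhs_ballP; exists d => //= y xy Ay; apply: eB; exact: dH.
Qed.

Lemma within_cont2P (A : set (R * R)) (g : R * R -> R[i]^o) :
  {within A, continuous g} ->
  (forall t, A t -> forall e : R, 0 < e -> exists2 d : R, 0 < d &
     forall u, A u -> `|t.1 - u.1| < d -> `|t.2 - u.2| < d ->
        normc (g t - g u) < e).
Proof.
move=> /subspace_continuousP cg x Ax e e0.
have /(cg x Ax) : nbhs (g x) [set w | normc (g x - w) < e].
  by apply/nbhs_normcP; exists e.
move=> /nbhs_ballP[d /= d0 dA]; exists d => // y Ay xy1 xy2.
by apply: dA.
Qed.

End Modulus.

(** * Distance to the boundary and the density of the metric m *)

Section Delta.
Variables (R : realType) (D : set R[i]^o).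
Hypotheses (D0 : D !=set0) (oD : open D) (bD : bounded_set D).
Implicit Types x y z w : R[i]^o.

Lemma bounded_normc : exists2 M : R, 0 <= M & forall x, D x -> normc x <= M.
Proof.
case: bD => M [Mreal HM].
have Mr : M = (complex.Re M)%:C%C by rewrite RRe_real.
exists (`|complex.Re M| + 1); first by rewrite addr_ge0.
move=> x Dx; rewrite -lecR; apply: (HM ((`|complex.Re M| + 1)%:C%C) _ x Dx).
rewrite Mr ltcR; have := ler_norm (complex.Re M); lra.
Qed.

Lemma open_normc x : D x ->
  exists2 e : R, 0 < e & forall y, normc (x - y) < e -> D y.
Proof. by move=> Dx; apply/nbhs_normcP; exact: open_nbhs_nbhs. Qed.

(** A segment that leaves D meets the boundary of D. *)
Lemma seg_boundary x y : D x -> ~ D y ->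
  exists t, [/\ 0 <= t, t <= 1 & boundary D (seg x y t)].
Proof.
move=> Dx nDy.
pose A := [set t : R | [/\ 0 <= t, t <= 1 & D (seg x y t)]].
have A0 : A 0 by split => //; rewrite seg0.
have hA : has_sup A.
  by split; [exists 0 | exists 1 => t []].
have s0 : 0 <= sup A by apply: ub_le_sup => //; case: hA.
have s1 : sup A <= 1 by apply: ge_sup => [|t []//]; exists 0.
exists (sup A); split => //; split.
  move=> B /nbhs_normcP[e e0 eB].
  (* the 1 only prevents a division by 0 *)
  have k0 : 0 < e / (normc (x - y) + 1).
    by rewrite divr_gt0// ltr_wpDl ?normc_ge0.
  have [t [t0 t1 Dt] tlt] := sup_adherent k0 hA.
  exists (seg x y t); split => //; apply: eB; rewrite seg_dist.
  have tA : t <= sup A by apply: ub_le_sup => //; case: hA.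
  rewrite ger0_norm ?subr_ge0//.
  apply: (@le_lt_trans _ _ ((e / (normc (x - y) + 1)) * normc (x - y))).
    by rewrite ler_wpM2r ?normc_ge0//; lra.
  rewrite mulrAC ltr_pdivrMr ?ltr_wpDl ?normc_ge0// mulrDr mulr1.
  by rewrite ltrDl.
move=> /interior_subset Ds.
have [e e0 eD] := open_normc Ds.
have slt1 : sup A < 1.
  rewrite lt_neqAle s1 andbT; apply/eqP => s1'; apply: nDy.
  by rewrite -(seg1 x y) -s1'.
pose k := e / (2 * (normc (x - y) + 1)).
have n0 := normc_ge0 (x - y).
have k0 : 0 < k by rewrite /k divr_gt0// mulr_gt0// ltr_wpDl.
pose t := Num.min 1 (sup A + k).
have tA : A t.
  split; rewrite /t.
  - by rewrite le_min ler01 addr_ge0// ltW.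
  - by rewrite ge_min lexx.
  apply: eD; rewrite seg_dist distrC.
  have : Num.min 1 (sup A + k) - sup A <= k.
    by rewrite lerBlDl ge_min lexx orbT.
  have : 0 <= Num.min 1 (sup A + k) - sup A.
    by rewrite subr_ge0 le_min s1 lerDl ltW.
  move=> h1 h2; rewrite ger0_norm//.
  apply: (@le_lt_trans _ _ (k * normc (x - y))).
    by rewrite ler_wpM2r.
  rewrite /k mulrAC ltr_pdivrMr ?mulr_gt0// ?ltr_wpDl//.
  rewrite ltr_pM2l//; lra.
have : t <= sup A by apply: ub_le_sup => //; case: hA.
rewrite /t ge_min => /orP[]; first by rewrite leNgt slt1.
lra.
Qed.

Lemma outside_point : exists y, ~ D y.
Proof.
have [M M0 HM] := bounded_normc.
exists ((M + 1)%:C%C) => /HM /=.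
rewrite expr0n addr0 sqrtr_sqr ger0_norm; lra.
Qed.

Lemma boundary_nonempty : boundary D !=set0.
Proof.
case: D0 => x Dx; have [y nDy] := outside_point.
by have [t [_ _ Ht]] := seg_boundary Dx nDy; exists (seg x y t).
Qed.

Lemma boundary_notin z : boundary D z -> ~ D z.
Proof. by case=> _ nz Dz; apply: nz; exact: open_nbhs_nbhs. Qed.

Lemma has_inf_delta z : has_inf [set normc (z - xi) | xi in boundary D].
Proof.
split; first by case: boundary_nonempty => xi hxi; exists (normc (z - xi)), xi.
by exists 0 => _ [xi _ <-]; exact: normc_ge0.
Qed.

Lemma delta_le z xi : boundary D xi -> delta D z <= normc (z - xi).
Proof.
move=> hxi; apply: ge_inf; first by case: (has_inf_delta z).
by exists xi.
Qed.

Lemma delta_ge z (e : R) :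
  (forall xi, boundary D xi -> e <= normc (z - xi)) -> e <= delta D z.
Proof.
move=> H; apply: lb_le_inf; first by case: (has_inf_delta z).
by move=> _ [xi hxi <-]; exact: H.
Qed.

Lemma delta_gt0 z : D z -> 0 < delta D z.
Proof.
move=> Dz; have [e e0 eD] := open_normc Dz.
apply: (lt_le_trans e0); apply: delta_ge => xi hxi.
by rewrite leNgt; apply/negP => /eD; exact: boundary_notin.
Qed.

Lemma delta_ball z w : D z -> normc (z - w) < delta D z -> D w.
Proof.
move=> Dz zw; apply: contrapT => nDw.
have [t [t0 t1 ht]] := seg_boundary Dz nDw.
have := delta_le z ht; rewrite normcC seg_distl ger0_norm// leNgt.
apply/negP/negPn; apply: le_lt_trans zw.
by rewrite ler_piMl ?normc_ge0.
Qed.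

Lemma delta_lip z w : delta D z <= delta D w + normc (z - w).
Proof.
rewrite -lerBlDr; apply: delta_ge => xi hxi; rewrite lerBlDr.
rewrite addrC; exact: le_trans (delta_le z hxi) (normc_triangle _ _ _).
Qed.

Lemma delta_near_out z (e : R) : delta D z < e ->
  exists2 q, ~ D q & normc (z - q) < e.
Proof.
move=> ze.
have e0 : 0 < e - delta D z by rewrite subr_gt0.
have [_ [xi hxi <-] H] := inf_adherent e0 (has_inf_delta z).
exists xi; first exact: boundary_notin.
by move: H; rewrite -/(delta D z); lra.
Qed.

Lemma delta_le_out z q : D z -> ~ D q -> delta D z <= normc (z - q).
Proof. by move=> Dz nDq; rewrite leNgt; apply/negP => /(delta_ball Dz). Qed.

Lemma diameter_ge x y : D x -> D y -> normc (x - y) <= diameter D.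
Proof.
move=> Dx Dy; apply: ub_le_sup; last by exists x => //; exists y.
have [M M0 HM] := bounded_normc.
exists (M + M) => _ [a Da [b Db <-]].
apply: le_trans (le_normcD _ _) _.
by rewrite normcN lerD ?HM.
Qed.

Lemma delta_diameter z : D z -> 2 * delta D z <= diameter D.
Proof.
move=> Dz; rewrite leNgt; apply/negP => dd.
have d0 := delta_gt0 Dz.
pose r := Num.max 0 ((diameter D / 2 + delta D z) / 2).
have r0 : 0 <= r by rewrite /r le_max lexx.
have rd : r < delta D z by rewrite /r gt_max d0 /=; lra.
have dr : diameter D < 2 * r.
  have : (diameter D / 2 + delta D z) / 2 <= r by rewrite /r le_max lexx orbT.
  lra.
have rr (s : R) : normc (z - (z + s%:C%C)) = `|s|.
  by rewrite opprD addNKr normcN /= expr0n addr0 sqrtr_sqr.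
have D1 : D (z + r%:C%C) by apply: (delta_ball Dz); rewrite rr ger0_norm.
have D2 : D (z + (-r)%:C%C).
  by apply: (delta_ball Dz); rewrite rr normrN ger0_norm.
have := diameter_ge D1 D2; rewrite opprD addrACA subrr add0r -rmorphB /=.
rewrite opprK expr0n addr0 sqrtr_sqr ger0_norm; lra.
Qed.

(** The density that m_D integrates. *)
Definition mdens z : R := diameter D / (delta D z * (diameter D - delta D z)).

Lemma mdens_ge z : D z -> (delta D z)^-1 <= mdens z.
Proof.
move=> Dz; have d0 := delta_gt0 Dz; have dd := delta_diameter Dz.
rewrite /mdens invfM mulrCA ler_peMr ?invr_ge0 ?(ltW d0)//.
rewrite ler_pdivlMr; lra.
Qed.

Lemma mdens_le z : D z -> mdens z <= 2 / delta D z.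
Proof.
move=> Dz; have d0 := delta_gt0 Dz; have dd := delta_diameter Dz.
rewrite /mdens invfM mulrCA mulrC ler_wpM2r ?invr_ge0 ?(ltW d0)//.
rewrite ler_pdivrMr; lra.
Qed.

Lemma mdens_ge0 z : D z -> 0 <= mdens z.
Proof.
move=> Dz; apply: le_trans (mdens_ge Dz); rewrite invr_ge0 ltW//; exact: delta_gt0.
Qed.

End Delta.

(** * Arc length *)

Section ArcLength.
Variable R : realType.
Implicit Types (a b c t : R) (g : R -> R[i]^o) (s : seq R).

Lemma polygonal_length_nil a b g : polygonal_length a b g [::] = 0.
Proof. by rewrite /polygonal_length big_nil. Qed.

Lemma polygonal_length_cons a b g x s :
  polygonal_length a b g (x :: s) =
  normc (g x - g a) + polygonal_length x b g s.
Proof.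
rewrite /polygonal_length /= big_nat_recl//=.
Qed.

Lemma polygonal_length_ge0 a b g s : 0 <= polygonal_length a b g s.
Proof. by apply: sumr_ge0 => i _; exact: normc_ge0. Qed.

Lemma polygonal_length_cat a b c g s1 s2 : last a s1 = c ->
  polygonal_length a b g (s1 ++ s2) =
  polygonal_length a c g s1 + polygonal_length c b g s2.
Proof.
elim: s1 a => [|x s1 IH] a /=.
  by move=> ->; rewrite polygonal_length_nil add0r.
by move=> h; rewrite !polygonal_length_cons (IH _ h) addrA.
Qed.

Lemma arc_length_polygonal a b g s : itv_partition a b s ->
  ((polygonal_length a b g s)%:E <= arc_length a b g)%E.
Proof. by move=> abs; apply: ereal_sup_ubound; exists s. Qed.

Lemma arc_length_ge a b g : a <= b ->
  ((normc (g b - g a))%:E <= arc_length a b g)%E.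
Proof.
rewrite le_eqVlt => /predU1P[->|ab].
  have := @arc_length_polygonal b b g [::].
  by rewrite polygonal_length_nil normcxx; apply; split.
have := @arc_length_polygonal a b g [:: b].
rewrite polygonal_length_cons polygonal_length_nil addr0; apply.
exact: itv_partition1.
Qed.

Lemma arc_length_ge0 a b g : a <= b -> (0 <= arc_length a b g)%E.
Proof.
by move=> ab; apply: le_trans (arc_length_ge g ab); rewrite lee_fin normc_ge0.
Qed.

Lemma arc_length_le a b g (M : \bar R) :
  (forall s, itv_partition a b s -> ((polygonal_length a b g s)%:E <= M)%E) ->
  (arc_length a b g <= M)%E.
Proof. by move=> H; apply: ge_ereal_sup => _ [s abs <-]; exact: H. Qed.

Lemma arc_lengthxx a g : arc_length a a g = 0%E.
Proof.
apply/eqP; rewrite eq_le arc_length_ge0// andbT; apply: arc_length_le => s.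
by move=> /itv_partitionxx ->; rewrite polygonal_length_nil.
Qed.

Lemma arc_length_superadd a b c g : a <= c -> c <= b ->
  (arc_length a b g < +oo)%E ->
  (arc_length a c g + arc_length c b g <= arc_length a b g)%E.
Proof.
move=> ac cb abfin.
have H s : itv_partition a c s ->
    ((polygonal_length a c g s)%:E + arc_length c b g <= arc_length a b g)%E.
  move=> acs; rewrite addeC -leeBrDr//; apply: arc_length_le => s' cbs'.
  rewrite leeBrDr// -EFinD addrC.
  case: (acs) => _ /eqP lc.
  rewrite -(polygonal_length_cat _ _ _ lc).
  exact/arc_length_polygonal/(itv_partition_cat acs cbs').
have cbfin : arc_length c b g \is a fin_num.
  rewrite ge0_fin_numE ?arc_length_ge0//.
  have [s acs] : exists s, itv_partition a c s.
    move: ac; rewrite le_eqVlt => /predU1P[->|ac]; first by exists [::].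
    by exists [:: c]; exact: itv_partition1.
  apply: le_lt_trans (le_lt_trans (H _ acs) abfin).
  by apply: leeDr; rewrite lee_fin polygonal_length_ge0.
rewrite -leeBrDr//; apply: arc_length_le => s acs.
rewrite leeBrDr//; exact: H.
Qed.

Lemma arc_length_subadd a b c g : a <= c -> c <= b ->
  (arc_length a b g <= arc_length a c g + arc_length c b g)%E.
Proof.
move=> ac cb; apply: arc_length_le => s abs.
suff [s1 [s2 [acs1 cbs2 H]]] : exists s1 s2, [/\ itv_partition a c s1,
    itv_partition c b s2 & polygonal_length a b g s <=
      polygonal_length a c g s1 + polygonal_length c b g s2].
  rewrite (le_trans (_ : _ <= (polygonal_length a c g s1 +
     polygonal_length c b g s2)%:E)%E) ?lee_fin//.
  by rewrite EFinD leeD// arc_length_polygonal.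
elim: s a ac abs => [|x s IH] a ac abs.
  have ab := itv_partition_nil abs; subst b.
  have ca : c = a by apply/eqP; rewrite eq_le ac cb.
  subst c; exists [::], [::]; split => //.
  by rewrite !polygonal_length_nil addr0.
move: ac; rewrite le_eqVlt => /predU1P[<-|ac].
  by exists [::], (x :: s); split => //; rewrite polygonal_length_nil add0r.
have [xc|cx] := leP x c.
  have xbs := itv_partition_cons abs.
  have [s1 [s2 [h1 h2 h3]]] := IH _ xc xbs.
  case: abs => /= /andP[ax _] _.
  exists (x :: s1), s2; split => //.
    by case: h1 => h1 h1'; split => //=; rewrite ax.
  by rewrite !polygonal_length_cons -addrA lerD2l.
have xbs := itv_partition_cons abs.
exists [:: c], (x :: s); split => //.
- exact: itv_partition1.
- by case: xbs => h1 h2; split => //=; rewrite cx.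
- rewrite !polygonal_length_cons polygonal_length_nil addr0 addrA lerD2r.
  by rewrite addrC normc_triangle.
Qed.

Lemma arc_lengthD a b c g : a <= c -> c <= b -> (arc_length a b g < +oo)%E ->
  (arc_length a b g = arc_length a c g + arc_length c b g)%E.
Proof.
move=> ac cb abfin; apply/eqP; rewrite eq_le arc_length_subadd//.
by rewrite arc_length_superadd.
Qed.

Lemma arc_length_fin a b c d g : a <= c -> c <= d -> d <= b ->
  (arc_length a b g < +oo)%E -> arc_length c d g \is a fin_num.
Proof.
move=> ac cd db abfin; rewrite ge0_fin_numE ?arc_length_ge0//.
have cb := le_trans cd db.
have : (arc_length c b g < +oo)%E.
  apply: le_lt_trans (abfin); rewrite [leRHS](arc_lengthD ac cb)// leeDr//.
  exact: arc_length_ge0.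
move=> cbfin; apply: le_lt_trans (cbfin); rewrite (arc_lengthD cd db)// leeDl//.
exact: arc_length_ge0.
Qed.

Lemma eq_arc_length a b g g' : a <= b -> (forall t, a <= t <= b -> g t = g' t) ->
  arc_length a b g = arc_length a b g'.
Proof.
move=> ab H; rewrite /arc_length; congr ereal_sup; apply: eq_imagel => s abs /=.
congr EFin; case: abs => abs /eqP; move: ab H abs.
elim: s a => [|x s IH] a ab H /=; first by rewrite !polygonal_length_nil.
move=> /andP[ax xs] lb; rewrite !polygonal_length_cons.
have xb : x <= b.
  by rewrite -lb; apply: itv_partition_le (_ : itv_partition x _ s); split.
rewrite (IH x)// ?H ?lexx ?ab ?(ltW ax)//= => t /andP[xt tb].
by rewrite H// tb (le_trans _ xt)// ltW.
Qed.

Lemma arc_length_lip a b g (K : R) : a <= b ->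
  (forall t u, a <= t -> t <= u -> u <= b -> normc (g u - g t) <= K * (u - t)) ->
  (arc_length a b g <= (K * (b - a))%:E)%E.
Proof.
move=> ab H; apply: arc_length_le => s [abs /eqP lb].
rewrite lee_fin; move: ab H abs lb.
elim: s a => [|x s IH] a ab H /=.
  by move=> _ ->; rewrite polygonal_length_nil subrr mulr0.
move=> /andP[ax xs] lb; rewrite polygonal_length_cons.
have xb : x <= b.
  by rewrite -lb; apply: itv_partition_le (_ : itv_partition x _ s); split.
have h1 : normc (g x - g a) <= K * (x - a) by apply: H => //; exact: ltW.
have h2 : polygonal_length x b g s <= K * (b - x).
  by apply: IH => // t u xt tu ub; apply: H => //; rewrite (le_trans _ xt)// ltW.
have -> : K * (b - a) = K * (x - a) + K * (b - x) by ring.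
exact: lerD.
Qed.

End ArcLength.

(** * Parametrization by arc length *)

Section Reparametrization.
Variable R : realType.
Implicit Types (a b c t : R) (g : R -> R[i]^o).

(** The analogue of [within_contP] for real-valued functions. *)
Lemma within_realP (A : set R) (f : R -> R) :
  {within A, continuous f} <->
  (forall t, A t -> forall e : R, 0 < e -> exists2 d : R, 0 < d &
     forall u, A u -> `|t - u| < d -> `|f t - f u| < e).
Proof.
split.
  move=> /subspace_continuousP cf x Ax e e0.
  have /(cf x Ax) : nbhs (f x) [set w | `|f x - w| < e].
    by apply/nbhs_ballP; exists e.
  move=> /nbhs_ballP[d /= d0 dA]; exists d => // y Ay xy.
  by apply: dA.
move=> H; apply/subspace_continuousP => x Ax B /nbhs_ballP[e /= e0 eB].
have [d d0 dH] := H _ Ax e e0.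
by apply/nbhs_ballP; exists d => //= y xy Ay; apply: eB; exact: dH.
Qed.

Lemma variation_Re_le a b g s :
  variation a b (fun t => complex.Re (g t)) s <= polygonal_length a b g s.
Proof.
apply: ler_sum => i _ /=; rewrite -ReB; exact: Re_le_normc.
Qed.

Lemma variation_Im_le a b g s :
  variation a b (fun t => complex.Im (g t)) s <= polygonal_length a b g s.
Proof.
apply: ler_sum => i _ /=; rewrite -ImB; exact: Im_le_normc.
Qed.

Lemma polygonal_length_variation a b g s :
  polygonal_length a b g s <= variation a b (fun t => complex.Re (g t)) s
     + variation a b (fun t => complex.Im (g t)) s.
Proof.
rewrite -big_split /=; apply: ler_sum => i _ /=; rewrite -ReB -ImB.
exact: normc_le_ReIm.
Qed.

(** Together with [variation_Re_le] and [variation_Im_le], this reduces the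
continuity of arc length to that of the total variation of real functions. *)
Lemma arc_length_total_variation a b g : 
  (arc_length a b g <= total_variation a b (fun t => complex.Re (g t))
     + total_variation a b (fun t => complex.Im (g t)))%E.
Proof.
apply: arc_length_le => s abs.
apply: (@le_trans _ _ ((variation a b (fun t => complex.Re (g t)) s)%:E
     + (variation a b (fun t => complex.Im (g t)) s)%:E)%E).
  by rewrite -EFinD lee_fin polygonal_length_variation.
by apply: leeD; apply: ereal_sup_ubound => /=; eexists => //;
  exact: variations_variation.
Qed.

Lemma bounded_variation_ReIm a b g : a <= b -> (arc_length a b g < +oo)%E ->
  bounded_variation a b (fun t => complex.Re (g t)) /\
  bounded_variation a b (fun t => complex.Im (g t)).
Proof.
move=> ab fin; have fn : arc_length a b g \is a fin_num.
  by rewrite ge0_fin_numE// arc_length_ge0.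
split; exists (fine (arc_length a b g)) => _ [s abs <-].
  apply: (le_trans (variation_Re_le _ _ _ _)).
  by rewrite -lee_fin fineK// arc_length_polygonal.
apply: (le_trans (variation_Im_le _ _ _ _)).
by rewrite -lee_fin fineK// arc_length_polygonal.
Qed.

Lemma total_variation_increment (f : R -> R) a b t u : a <= t -> t <= u ->
  u <= b -> bounded_variation a b f ->
  total_variation t u f = (fine (total_variation a u f)
                           - fine (total_variation a t f))%:E.
Proof.
move=> at_ tu ub bv.
have au := le_trans at_ tu.
have bvu : bounded_variation a u f := bounded_variationl au ub bv.
have bvt : bounded_variation a t f := bounded_variationl at_ tu bvu.
have bvtu : bounded_variation t u f := bounded_variationr at_ tu bvu.
move/(bounded_variationP _ at_) : bvt => ft.
move/(bounded_variationP _ tu) : bvtu => ftu.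
rewrite (total_variationD f at_ tu) fineD// addrAC subrr add0r fineK//.
Qed.

Lemma arc_length_continuous a b g : a < b -> {within `[a, b], continuous g} ->
  (arc_length a b g < +oo)%E ->
  {within `[a, b], continuous (fun t => fine (arc_length a t g))}.
Proof.
move=> ab /within_contP cg fin.
have [bvR bvI] := bounded_variation_ReIm (ltW ab) fin.
have cR : {within `[a, b], continuous (fun t => complex.Re (g t))}.
  apply/within_realP => t /(cg t) H e /H[d d0 dH]; exists d => // u uab tu.
  by apply: le_lt_trans (dH u uab tu); rewrite -ReB Re_le_normc.
have cI : {within `[a, b], continuous (fun t => complex.Im (g t))}.
  apply/within_realP => t /(cg t) H e /H[d d0 dH]; exists d => // u uab tu.
  by apply: le_lt_trans (dH u uab tu); rewrite -ImB Im_le_normc.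
have /within_realP HR := total_variation_continuous ab cR bvR.
have /within_realP HI := total_variation_continuous ab cI bvI.
have key t u : a <= t -> t <= u -> u <= b ->
   `|fine (arc_length a t g) - fine (arc_length a u g)| <=
   `|fine (total_variation a t (fun t => complex.Re (g t))) -
     fine (total_variation a u (fun t => complex.Re (g t)))| +
   `|fine (total_variation a t (fun t => complex.Im (g t))) -
     fine (total_variation a u (fun t => complex.Im (g t)))|.
  move=> at_ tu ub; have au := le_trans at_ tu.
  have fau : (arc_length a u g < +oo)%E.
    by rewrite -ge0_fin_numE ?arc_length_ge0//; exact: (arc_length_fin _ _ ub).
  have fat : arc_length a t g \is a fin_num.
    exact: (arc_length_fin _ at_ tu).
  have ftu : arc_length t u g \is a fin_num.
    exact: (arc_length_fin at_ tu (lexx _) fau).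
  rewrite (arc_lengthD at_ tu)// fineD// opprD addrA subrr add0r normrN.
  have h0 : 0 <= fine (arc_length t u g) by apply/fine_ge0/arc_length_ge0.
  rewrite (ger0_norm h0).
  rewrite -lee_fin fineK//.
  apply: (le_trans (arc_length_total_variation _ _ _)).
  rewrite (total_variation_increment at_ tu ub bvR).
  rewrite (total_variation_increment at_ tu ub bvI).
  rewrite -EFinD lee_fin lerD// distrC ler_norm//.
apply/within_realP => t tab e e0.
have e20 : 0 < e / 2 by lra.
have [d1 d10 H1] := HR t tab _ e20.
have [d2 d20 H2] := HI t tab _ e20.
exists (Num.min d1 d2); first by rewrite lt_min d10.
move=> u uab; rewrite lt_min => /andP[tu1 tu2].
have := H1 u uab tu1; have := H2 u uab tu2 => /=.
move: tab uab; rewrite /= !in_itv /= => /andP[at_ tb] /andP[au ub].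
have [tu|/ltW ut] := leP t u.
  have := key _ _ at_ tu ub; lra.
have := key _ _ au ut tb.
set x := fine _; set y := fine _; rewrite (distrC x y).
set x1 := fine _; set y1 := fine _; rewrite (distrC x1 y1).
set x2 := fine _; set y2 := fine _; rewrite (distrC x2 y2).
lra.
Qed.

Section Path.
Variables (D : set R[i]^o) (z1 z2 : R[i]^o) (a b : R) (g : R -> R[i]^o).
Hypothesis pg : rectifiable_path D z1 z2 a b g.
Let L := fine (arc_length a b g).
Let G := arc_length_param a b g.

Lemma path_length_ge0 : 0 <= L.
Proof. by case: pg => ab _ _ _ _; rewrite fine_ge0// arc_length_ge0. Qed.

Lemma path_lengthE : arc_length a b g = L%:E.
Proof.
by case: pg => ab _ _ _ fin; rewrite fineK// ge0_fin_numE// arc_length_ge0.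
Qed.

(** Every length up to the total one is attained, by continuity of arc length. *)
Lemma path_at_length s : 0 <= s <= L ->
  exists t, t \in `[a, b] /\ arc_length a t g = s%:E.
Proof.
case: pg => ab cg _ _ fin sL.
move: ab; rewrite le_eqVlt => /predU1P[ab|ab].
  have L0 : L = 0 by rewrite /L -ab arc_lengthxx.
  exists a; rewrite arc_lengthxx -ab in_itv /= lexx; split => //.
  by congr EFin; move: sL; rewrite L0; lra.
have [|t tab tE] := @IVT _ (fun t => fine (arc_length a t g)) a b s (ltW ab)
   (arc_length_continuous ab cg fin).
  rewrite arc_lengthxx -/L.
  by case/andP: sL => s0 sL; rewrite ge_min s0 le_max sL orbT.
exists t; split => //; rewrite -tE fineK//.
move: tab; rewrite in_itv /= => /andP[at_ tb].
exact: (arc_length_fin _ at_ tb).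
Qed.

Lemma path_paramE s : 0 <= s <= L ->
  exists t, [/\ a <= t <= b, arc_length a t g = s%:E & G s = g t].
Proof.
move=> sL; have /getPex[] : exists t, [set t | t \in `[a, b] /\ arc_length a t g = s%:E] t.
  exact: path_at_length.
by set t := get _; move=> tab tE; exists t; split => //; move: tab; rewrite in_itv.
Qed.

Lemma path_param_lip s u : 0 <= s <= L -> 0 <= u <= L ->
  normc (G s - G u) <= `|s - u|.
Proof.
case: pg => _ _ _ _ fin.
wlog su : s u / s <= u.
  move=> H sL uL; have [su|/ltW us] := leP s u; first exact: H.
  by rewrite normcC distrC; exact: H.
move=> /path_paramE[t [tab tE ->]] /path_paramE[t' [tab' tE' ->]].
have [tt'|/ltW t't] := leP t t'.
  case/andP: tab => at_ tb; case/andP: tab' => at' tb'.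
  have fat' : (arc_length a t' g < +oo)%E by rewrite tE' ltry.
  have := arc_length_ge g tt'.
  have := arc_lengthD at_ tt' fat'; rewrite tE tE'.
  have := arc_length_fin at_ tt' (lexx _) fat' => /fineK <-.
  move=> [] ->; rewrite lee_fin normcC opprD addrA subrr add0r normrN.
  by move=> h; apply: le_trans h _; exact: ler_norm.
case/andP: tab => at_ tb; case/andP: tab' => at' tb'.
have fat : (arc_length a t g < +oo)%E by rewrite tE ltry.
have h1 := arc_length_ge g t't.
have := arc_lengthD at' t't fat; rewrite tE tE'.
move: h1.
have := arc_length_fin at' t't (lexx _) fat => /fineK <-.
rewrite lee_fin => h1 [] h2; apply: le_trans h1 _.
have := normr_ge0 (s - u); lra.
Qed.

Lemma path_param0 : G 0 = z1.
Proof.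
have [|t [/andP[at_ tb] tE ->]] := @path_paramE 0.
  by rewrite lexx path_length_ge0.
case: pg => _ _ _ [<- _] _.
apply: normc_eq0; apply/eqP; rewrite eq_le normc_ge0 andbT.
by rewrite -lee_fin -tE arc_length_ge.
Qed.

Lemma path_paramL : G L = z2.
Proof.
have [|t [/andP[at_ tb] tE ->]] := @path_paramE L.
  by rewrite lexx path_length_ge0.
case: pg => _ _ _ [_ <-] fin.
have := arc_lengthD at_ tb fin; rewrite tE path_lengthE.
have := arc_length_ge g tb.
have := arc_length_fin at_ tb (lexx _) fin => /fineK <-.
rewrite lee_fin => h1 [] h2.
by rewrite [RHS](@normc_eq0 _ _ (g t))//; apply/eqP; rewrite eq_le normc_ge0 andbT; lra.
Qed.

Lemma path_param_in s : 0 <= s <= L -> D (G s).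
Proof.
move=> /path_paramE[t [tab _ ->]]; case: pg => _ _ gD _ _.
by apply: gD; exists t => //=; rewrite in_itv.
Qed.

End Path.
End Reparametrization.

(** * Integrals of continuous functions over subintervals *)

Section IntegralIncrement.
Variables (R : realType) (L : R) (f : R -> R).
Hypotheses (cf : {within `[0, L], continuous f})
  (f0 : forall t, 0 <= t <= L -> 0 <= f t).
Let I (u : R) := (\int[lebesgue_measure]_(t in `[0%R, u]) (f t)%:E)%E.

Lemma measurable_sub_segment (A : set R) : A `<=` `[0, L] -> measurable A ->
  measurable_fun A (EFin \o f).
Proof.
move=> AL mA; apply/measurable_EFinP.
apply: (@measurable_funS _ _ _ _ `[0, L]%classic) => //.
exact: measurable_realfun.subspace_continuous_measurable_fun.
Qed.

Lemma integral_segment0 : I 0 = 0%E.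
Proof.
rewrite /I set_itv1 integral_set1//.
Qed.

Lemma integral_segmentD (s u : R) : 0 <= s -> s <= u -> u <= L ->
  I u = (I s + \int[lebesgue_measure]_(t in `]s, u]) (f t)%:E)%E.
Proof.
move=> s0 su uL.
have E : (`[0, u] = `[0, s] `|` `]s, u])%classic.
  by apply: itv_bndbnd_setU; rewrite bnd_simp.
have sub : (`[0, u] `<=` `[0, L])%classic.
  by apply: subset_itvl; rewrite bnd_simp.
have mE : measurable_fun `[0, u]%classic (EFin \o f).
  exact: measurable_sub_segment.
rewrite E in mE sub.
rewrite /I E ge0_integral_setU//=.
- move=> t /sub /=; rewrite in_itv /= => tL.
  by rewrite lee_fin f0.
- rewrite disj_set2E; apply/eqP/seteqP; split => // t [] /=.
  by rewrite !in_itv /= => /andP[_ ts] /andP[st _]; move: (lt_le_trans st ts); rewrite ltxx.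
Qed.

Lemma integral_increment_ge (s u m : R) : 0 <= s -> s <= u -> u <= L ->
  0 <= m -> (forall t, s <= t <= u -> m <= f t) ->
  (I s + (m * (u - s))%:E <= I u)%E.
Proof.
move=> s0 su uL m0 mf; rewrite (integral_segmentD s0 su uL) leeD2l//.
have sub : (`]s, u] `<=` `[0, L])%classic.
  move=> t /=; rewrite !in_itv /= => /andP[st tu].
  by rewrite (le_trans s0 (ltW st)) (le_trans tu uL).
apply: (@le_trans _ _ (\int[lebesgue_measure]_(t in `]s, u]) (cst m%:E t))%E).
  rewrite integral_cst//= lebesgue_measure_itv /= lte_fin.
  by case: ltP => [_|us]; rewrite -EFinM lee_fin// ler_wpM2l//; lra.
apply: ge0_le_integral => //.
- exact: measurable_sub_segment.
- move=> t /=; rewrite in_itv /= => /andP[st tu]; rewrite lee_fin mf//.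
  by rewrite (ltW st).
Qed.

Lemma integral_increment_le (s u m : R) : 0 <= s -> s <= u -> u <= L ->
  0 <= m -> (forall t, s <= t <= u -> f t <= m) ->
  (I u <= I s + (m * (u - s))%:E)%E.
Proof.
move=> s0 su uL m0 mf; rewrite (integral_segmentD s0 su uL) leeD2l//.
have sub : (`]s, u] `<=` `[0, L])%classic.
  move=> t /=; rewrite !in_itv /= => /andP[st tu].
  by rewrite (le_trans s0 (ltW st)) (le_trans tu uL).
apply: (@le_trans _ _ (\int[lebesgue_measure]_(t in `]s, u]) (cst m%:E t))%E).
  apply: ge0_le_integral => //.
  - move=> t /sub /=; rewrite in_itv /= => tL; rewrite lee_fin; exact: f0.
  - exact: measurable_sub_segment.
  - move=> t /=; rewrite in_itv /= => /andP[st tu]; rewrite lee_fin mf//.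
    by rewrite (ltW st).
rewrite integral_cst//= lebesgue_measure_itv /= lte_fin.
case: ltP => [_|us]; first by rewrite -EFinM lee_fin.
by rewrite mule0 lee_fin mulr_ge0//; lra.
Qed.

End IntegralIncrement.

(** * Chains and their cost *)

Section Chain.
Variables (R : realType) (D : set R[i]^o).
Hypotheses (D0 : D !=set0) (oD : open D) (bD : bounded_set D).
Implicit Types (x y z : R[i]^o) (s : seq R[i]^o) (C : R).

(** The cost of the chain step from x to y. *)
Definition qweight x y : R :=
  normc (x - y) / Num.min (delta D x) (delta D y).

(** x :: s is a chain: all its points lie in D and each step costs at most 1 / 4. *)
Fixpoint qchain x s : Prop :=
  if s is y :: s' then [/\ D x, qweight x y <= 1 / 4 & qchain y s'] else D x.

(** The cost of the chain x :: s. *)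
Fixpoint qcost x s : R := if s is y :: s' then qweight x y + qcost y s' else 0.

(** The Euclidean length of the polygon x :: s. *)
Fixpoint qlen x s : R := if s is y :: s' then normc (x - y) + qlen y s' else 0.

(** x and y are joined by a chain of cost at most C. *)
Definition qle x y C := exists s, [/\ qchain x s, last x s = y & qcost x s <= C].

Lemma qweightC x y : qweight x y = qweight y x.
Proof. by rewrite /qweight normcC minC. Qed.

Lemma qchain_start x s : qchain x s -> D x.
Proof. by case: s => //= y s []. Qed.

Lemma qchain_cat x s1 s2 :
  qchain x (s1 ++ s2) <-> qchain x s1 /\ qchain (last x s1) s2.
Proof.
elim: s1 x => [|y s1 IH] x /=; first by split=> [h|[]//]; split => //; exact: qchain_start h.
split; first by move=> [Dx w /IH[]].
by move=> [[Dx w h1] h2]; split => //; apply/IH.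
Qed.

Lemma qcost_cat x s1 s2 :
  qcost x (s1 ++ s2) = qcost x s1 + qcost (last x s1) s2.
Proof. by elim: s1 x => [|y s1 IH] x /=; rewrite ?add0r// IH addrA. Qed.

Lemma qlen_cat x s1 s2 : qlen x (s1 ++ s2) = qlen x s1 + qlen (last x s1) s2.
Proof. by elim: s1 x => [|y s1 IH] x /=; rewrite ?add0r// IH addrA. Qed.

Lemma qlen_ge0 x s : 0 <= qlen x s.
Proof. by elim: s x => //= y s IH x; rewrite addr_ge0// normc_ge0. Qed.

Lemma qmin_gt0 x y : D x -> D y -> 0 < Num.min (delta D x) (delta D y).
Proof. by move=> Dx Dy; rewrite lt_min (delta_gt0 D0 oD bD Dx) (delta_gt0 D0 oD bD Dy). Qed.

Lemma qweight_ge0 x y : D x -> D y -> 0 <= qweight x y.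
Proof. by move=> Dx Dy; rewrite divr_ge0 ?normc_ge0// ltW// qmin_gt0. Qed.

Lemma qcost_ge0 x s : qchain x s -> 0 <= qcost x s.
Proof.
elim: s x => //= y s IH x [Dx _ h]; rewrite addr_ge0 ?IH// qweight_ge0//.
exact: qchain_start h.
Qed.

Lemma qle_refl x : D x -> qle x x 0.
Proof. by move=> Dx; exists [::]. Qed.

Lemma qle_trans y x z C1 C2 : qle x y C1 -> qle y z C2 -> qle x z (C1 + C2).
Proof.
move=> [s1 [h1 l1 c1]] [s2 [h2 l2 c2]]; exists (s1 ++ s2); split.
- by apply/qchain_cat; rewrite l1.
- by rewrite last_cat l1.
- by rewrite qcost_cat l1 lerD.
Qed.

Lemma qle_mono C1 C2 x y : C1 <= C2 -> qle x y C1 -> qle x y C2.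
Proof. by move=> c12 [s [h l c]]; exists s; split => //; exact: le_trans c12. Qed.

Lemma qle_weight x y : D x -> D y -> qweight x y <= 1 / 4 ->
  qle x y (qweight x y).
Proof. by move=> Dx Dy w; exists [:: y]; split => //=; rewrite addr0. Qed.

Lemma qle_sym x y C : qle x y C -> qle y x C.
Proof.
move=> [s [h <- c]]; apply: qle_mono c _.
elim: s x h => [|y' s IH] x /=; first exact: qle_refl.
move=> [Dx w h]; rewrite addrC; apply: qle_trans (IH _ h) _.
rewrite qweightC; apply: qle_weight => //; last by rewrite qweightC.
exact: qchain_start h.
Qed.

Lemma qweight_near x y : D x -> normc (x - y) <= delta D x / 5 ->
  D y /\ qweight x y <= 5 / 4 * (normc (x - y) / delta D x).
Proof.
move=> Dx xy; have d0 := delta_gt0 D0 oD bD Dx.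
have Dy : D y by apply: (delta_ball D0 oD bD Dx); lra.
split => //; have h := delta_lip D0 oD bD x y.
have mge : 4 / 5 * delta D x <= Num.min (delta D x) (delta D y).
  by rewrite le_min; apply/andP; split; lra.
have m0 := qmin_gt0 Dx Dy.
have -> : 5 / 4 * (normc (x - y) / delta D x) = normc (x - y) / (4 / 5 * delta D x).
  by field; rewrite gt_eqF.
rewrite /qweight ler_wpM2l ?normc_ge0// lef_pV2// posrE mulr_gt0//; lra.
Qed.

Lemma qle_near x y : D x -> normc (x - y) <= delta D x / 5 ->
  qle x y (5 / 4 * (normc (x - y) / delta D x)).
Proof.
move=> Dx xy; have [Dy w] := qweight_near Dx xy.
have d0 := delta_gt0 D0 oD bD Dx.
apply: (qle_mono w); apply: qle_weight => //; apply: (le_trans w).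
rewrite -ler_pdivlMl// ler_pdivrMr//; lra.
Qed.

End Chain.

(** * From curves to chains *)

Section LipCurve.
Variables (R : realType) (D : set R[i]^o).
Implicit Types (f g : R -> R[i]^o) (L : R).

(** f maps [0, L] to D and is 1-Lipschitz there. *)
Definition lip_curve L f : Prop :=
  [/\ 0 <= L, forall t, 0 <= t <= L -> D (f t) &
    forall s u, 0 <= s <= L -> 0 <= u <= L -> normc (f s - f u) <= `|s - u|].

Lemma path_param_curve z1 z2 a b g : rectifiable_path D z1 z2 a b g ->
  lip_curve (fine (arc_length a b g)) (arc_length_param a b g).
Proof.
move=> pg; split; first exact: path_length_ge0 pg.
- by move=> t; exact: (path_param_in pg).
- by move=> s u; exact: (path_param_lip pg).
Qed.

Lemma lip_curve_continuous L f : lip_curve L f -> {within `[0, L], continuous f}.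
Proof.
move=> [L0 _ fl]; apply/within_contP => t; rewrite /= in_itv /= => tL e e0.
exists e => // u; rewrite /= in_itv /= => uL tu; apply: le_lt_trans tu; exact: fl.
Qed.

Lemma lip_curve_length L f : lip_curve L f ->
  forall a b, 0 <= a -> a <= b -> b <= L -> (arc_length a b f <= (b - a)%:E)%E.
Proof.
move=> [L0 _ fl] a b a0 ab bL; rewrite -[b - a]mul1r; apply: arc_length_lip => //.
move=> t u at_ tu ub; rewrite mul1r -[leRHS]ger0_norm ?subr_ge0//.
apply: fl; apply/andP; split; lra.
Qed.

Lemma lip_curve_path L f : lip_curve L f -> rectifiable_path D (f 0) (f L) 0 L f.
Proof.
move=> cf; have [L0 fD fl] := cf; split => //.
- exact: lip_curve_continuous.
- by move=> _ [t /= tL <-]; apply: fD; rewrite in_itv in tL.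
- by apply: le_lt_trans (lip_curve_length cf (lexx 0) L0 (lexx L)) (ltry _).
Qed.

Section Density.
Hypotheses (D0 : D !=set0) (oD : open D) (bD : bounded_set D).

Lemma lip_curve_delta_continuous L f : lip_curve L f ->
  {within `[0, L], continuous (fun t => delta D (f t))}.
Proof.
move=> [L0 _ fl]; apply/within_realP => t; rewrite /= in_itv /= => tL e e0.
exists e => // u; rewrite /= in_itv /= => uL tu; apply: le_lt_trans tu.
apply: le_trans (fl t u tL uL).
have := delta_lip D0 oD bD (f t) (f u); have := delta_lip D0 oD bD (f u) (f t).
by rewrite (normcC (f u)) ler_norml; lra.
Qed.

Lemma lip_curve_delta_min L f : lip_curve L f ->
  exists2 d, 0 < d & forall t, 0 <= t <= L -> d <= delta D (f t).
Proof.
move=> cf; have [L0 fD _] := cf.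
have [c cL H] := EVT_min L0 (lip_curve_delta_continuous cf).
exists (delta D (f c)); first by apply: delta_gt0 => //; exact: fD.
by move=> t tL; apply: H; rewrite in_itv.
Qed.

Lemma lip_curve_mdens_continuous L f : lip_curve L f ->
  {within `[0, L], continuous (fun t => mdens D (f t))}.
Proof.
move=> cf; have [L0 fD _] := cf.
have /subspace_continuousP cd := lip_curve_delta_continuous cf.
apply/subspace_continuousP => t tL.
have Dft : D (f t) by apply: fD; move: tL; rewrite /= in_itv.
have d0 := delta_gt0 D0 oD bD Dft; have dd := delta_diameter D0 oD bD Dft.
apply: cvgM; first exact: cvg_cst.
apply: cvgV; first by rewrite mulf_neq0// ?gt_eqF//; lra.
apply: cvgM; first exact: cd.
apply: cvgB; first exact: cvg_cst.
exact: cd.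
Qed.

Lemma lip_curve_mdens_ge0 L f : lip_curve L f ->
  forall t, 0 <= t <= L -> 0 <= mdens D (f t).
Proof. by move=> [_ fD _] t tL; apply: mdens_ge0 => //; exact: fD. Qed.

(** The chain is obtained by sampling the curve at equal steps. *)
Lemma curve_chain L f (I : R) : lip_curve L f ->
  (\int[lebesgue_measure]_(t in `[0%R, L]) (mdens D (f t))%:E <= I%:E)%E ->
  qle D (f 0) (f L) (2 * I).
Proof.
move=> cf IL; have [L0 fD fl] := cf.
have [d d0 dmin] := lip_curve_delta_min cf.
(* the mesh L / n is at most d / 5, so that consecutive samples are chain steps *)
pose n := (Num.truncn (5 * L / d)).+1.
pose h := L / n%:R.
have n0 : 0 < n%:R :> R by rewrite ltr0n.
have h0 : 0 <= h by rewrite /h divr_ge0// ltW.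
have hd : h <= d / 5.
  rewrite /h ler_pdivrMr//.
  have := truncnS_gt (5 * L / d); rewrite -/n => /ltW.
  rewrite ler_pdivrMr//; lra.
have hn : n%:R * h = L by rewrite /h mulrC divfK// gt_eqF.
have key i : (i <= n)%N -> exists C, qle D (f 0) (f (i%:R * h)) C /\
   ((C / 2)%:E <= \int[lebesgue_measure]_(t in `[0%R, (i%:R * h)%R]) (mdens D (f t))%:E)%E.
  elim: i => [|i IH] iN.
    exists 0; rewrite mul0r; split.
      by apply: qle_refl; apply: fD; rewrite lexx.
    by rewrite integral_segment0 mul0r.
  have [C [qC CI]] := IH (ltnW iN).
  set s := i%:R * h in qC CI *.
  have su : i.+1%:R * h = s + h by rewrite -natr1 mulrDl mul1r.
  rewrite su; set u := s + h.
  have s0 : 0 <= s by rewrite mulr_ge0.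
  have uL : u <= L by rewrite /u -su -hn ler_wpM2r// ler_nat.
  have sL : 0 <= s <= L by rewrite s0 /=; apply: le_trans uL; rewrite lerDl.
  have uL' : 0 <= u <= L by rewrite uL addr_ge0.
  have ds := dmin _ sL.
  have dsg := delta_gt0 D0 oD bD (fD _ sL).
  have fsu : normc (f s - f u) <= h.
    by apply: le_trans (fl _ _ sL uL') _; rewrite /u opprD addNKr normrN ger0_norm.
  have near5 : normc (f s - f u) <= delta D (f s) / 5 by lra.
  exists (C + 5 / 4 * (h / delta D (f s))); split.
    apply: (qle_trans qC); apply: qle_mono (qle_near D0 oD bD (fD _ sL) near5).
    by rewrite ler_wpM2l ?divr_ge0// ler_wpM2r// invr_ge0 ltW.
  have su' : s <= u by rewrite lerDl.
  (* on [s, u] delta is at most 6 / 5 of its value at s, and 5 / 8 <= 5 / 6 *)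
  have m0 : 0 <= 5 / (8 * delta D (f s)) by rewrite divr_ge0// mulr_ge0// ltW.
  apply: le_trans (integral_increment_ge (lip_curve_mdens_continuous cf)
    (lip_curve_mdens_ge0 cf) s0 su' uL m0 _).
    have -> : (C + 5 / 4 * (h / delta D (f s))) / 2 =
              C / 2 + 5 / (8 * delta D (f s)) * (u - s).
      by rewrite /u; field; rewrite gt_eqF.
    by rewrite EFinD leeD2r.
  move=> t /andP[st tu].
  have tL : 0 <= t <= L by apply/andP; split; lra.
  apply: le_trans (mdens_ge D0 oD bD (fD _ tL)).
  rewrite -[leRHS]div1r -[5]mulr1 -mulf_div.
  have dt := delta_gt0 D0 oD bD (fD _ tL).
  have := delta_lip D0 oD bD (f t) (f s).
  have := fl t s tL sL; rewrite ger0_norm ?subr_ge0//.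
  move=> h1 h2.
  rewrite mulf_div mulr1 ler_pdivrMr; last by lra.
  rewrite mulrAC mul1r ler_pdivlMr// ; rewrite /u in tu; lra.
have [C [qC CI]] := key n (leqnn n).
rewrite hn in qC CI; apply: qle_mono qC.
have := le_trans CI IL; rewrite lee_fin; lra.
Qed.

Lemma path_chain z1 z2 a b g (I : R) : rectifiable_path D z1 z2 a b g ->
  (path_integral (mdens D) a b g <= I%:E)%E -> qle D z1 z2 (2 * I).
Proof.
move=> pg pI.
rewrite -(path_param0 pg) -(path_paramL pg); apply: curve_chain => //.
exact: path_param_curve pg.
Qed.

End Density.
End LipCurve.

(** * From chains to unit speed polygons *)

Section UnitSpeed.
Variables (R : realType) (D : set R[i]^o).
Implicit Types (f g : R -> R[i]^o) (L : R).

(** A curve in D whose parameter is its arc length. *)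
Definition unit_speed L f : Prop :=
  lip_curve D L f /\ forall t, 0 <= t <= L -> arc_length 0 t f = t%:E.

Lemma unit_speed_point x : D x -> unit_speed 0 (fun=> x).
Proof.
move=> Dx; split; first by split => // s u _ _; rewrite normcxx.
move=> t t0; have -> : t = 0 by lra.
exact: arc_lengthxx.
Qed.

(** The curve f on [0, L], followed at unit speed by the segment from f L to y. *)
Definition add_segment L f (y : R[i]^o) : R -> R[i]^o := fun t =>
  if t <= L then f t else seg (f L) y ((t - L) / normc (f L - y)).

Lemma add_segmentE L f y t : t <= L -> add_segment L f y t = f t.
Proof. by rewrite /add_segment => ->. Qed.

Lemma add_segment_end L f y : 
  add_segment L f y (L + normc (f L - y)) = y.
Proof.
rewrite /add_segment gerDl; case: leP => [h|h].
  have e0 : normc (f L - y) = 0 by apply/eqP; rewrite eq_le h normc_ge0.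
  by rewrite e0 addr0; exact: normc_eq0.
by rewrite addrAC subrr add0r divff ?gt_eqF// seg1.
Qed.

Lemma add_segment_dist L f y t : L <= t <= L + normc (f L - y) ->
  normc (add_segment L f y t - f L) = t - L.
Proof.
move=> /andP[Lt tL]; rewrite /add_segment; case: leP => [tL'|h].
  have -> : t = L by lra.
  by rewrite normcxx subrr.
rewrite seg_distl ger0_norm ?divr_ge0 ?normc_ge0 ?subr_ge0//.
by rewrite divfK// gt_eqF//; lra.
Qed.

Lemma add_segment_lip L f y : lip_curve D L f ->
  (forall t, L <= t <= L + normc (f L - y) -> D (add_segment L f y t)) ->
  lip_curve D (L + normc (f L - y)) (add_segment L f y).
Proof.
move=> [L0 fD fl] yD; have n0 := normc_ge0 (f L - y).
split; first by rewrite addr_ge0.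
  move=> t /andP[t0 tL]; have [tL'|/ltW tL'] := leP t L.
    by rewrite add_segmentE//; apply: fD; rewrite t0.
  by apply: yD; rewrite tL'.
move=> s u; wlog su : s u / s <= u.
  move=> H sL uL; have [su|/ltW us] := leP s u; first exact: H.
  by rewrite normcC distrC; exact: H.
move=> /andP[s0 sL] /andP[u0 uL].
have [uL'|Lu] := leP u L.
  have sL' := le_trans su uL'.
  by rewrite !add_segmentE//; apply: fl; rewrite ?s0 ?u0.
have n00 : 0 < normc (f L - y) by lra.
have [sL'|Ls] := leP s L.
  apply: le_trans (normc_triangle (f L) _ _) _.
  have du : normc (add_segment L f y u - f L) = u - L.
    by apply: add_segment_dist; rewrite uL (ltW Lu).
  rewrite (normcC (f L)) du.
  rewrite add_segmentE// ler0_norm; last by lra.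
  have := fl s L; rewrite s0 sL' L0 lexx ler0_norm; last by lra.
  by move=> /(_ isT isT); lra.
rewrite /add_segment (leNgt s) (leNgt u) Ls Lu /= seg_dist -mulrBl normrM.
rewrite [`|(normc _)^-1|]ger0_norm ?invr_ge0// divfK ?gt_eqF//.
have -> : s - L - (u - L) = s - u by ring.
exact: lexx.
Qed.

Lemma unit_speed_add_segment L f y : unit_speed L f ->
  (forall t, L <= t <= L + normc (f L - y) -> D (add_segment L f y t)) ->
  unit_speed (L + normc (f L - y)) (add_segment L f y).
Proof.
move=> [cf fu] yD; have cg := add_segment_lip cf yD; split => //.
have [L0 fD fl] := cf.
move=> t /andP[t0 tL]; have [tL'|/ltW Lt] := leP t L.
  rewrite (@eq_arc_length _ 0 t _ f)//; first by rewrite fu// t0.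
  by move=> u /andP[_ ut]; rewrite add_segmentE//; exact: le_trans tL'.
apply/eqP; rewrite eq_le; apply/andP; split.
  by rewrite -[X in (_ <= X%:E)%E]subr0; apply: (lip_curve_length cg).
have h1 : (arc_length 0 t (add_segment L f y) < +oo)%E.
  by apply: le_lt_trans (lip_curve_length cg (lexx 0) t0 tL) (ltry _).
rewrite (arc_lengthD L0 Lt h1).
rewrite (@eq_arc_length _ 0 L _ f)//; last first.
  by move=> u /andP[_ ut]; rewrite add_segmentE.
rewrite fu ?L0 ?lexx//.
have E : t%:E = (L%:E + (t - L)%:E)%E by rewrite -EFinD addrC subrK.
rewrite [leLHS]E leeD2l//.
apply: le_trans (arc_length_ge _ Lt).
by rewrite lee_fin (@add_segmentE L f y L)// add_segment_dist// Lt.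
Qed.

Lemma unit_speed_param L f s : unit_speed L f -> 0 <= s <= L ->
  arc_length_param 0 L f s = f s.
Proof.
move=> [cf fu] sL; rewrite /arc_length_param; congr f.
have /getPex[] : exists t, [set t | t \in `[0, L] /\ arc_length 0 t f = s%:E] t.
  by exists s; split; [rewrite in_itv|exact: fu].
by set t := get _ => tL; rewrite fu//; case.
Qed.

Lemma unit_speed_path_integral (rho : R[i]^o -> R) L f : unit_speed L f ->
  path_integral rho 0 L f =
  (\int[lebesgue_measure]_(t in `[0%R, L]) (rho (f t))%:E)%E.
Proof.
move=> uf; have [[L0 _ _] fu] := uf.
rewrite /path_integral fu ?L0 ?lexx//=; apply: eq_integral => t.
by rewrite inE /= in_itv /= => tL; rewrite (unit_speed_param uf).
Qed.

Section Chains.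
Hypotheses (D0 : D !=set0) (oD : open D) (bD : bounded_set D).

(** When the added segment is a chain step, it stays in D and the density is
controlled along it. *)
Lemma qweight_seg L f y : lip_curve D L f -> D y -> qweight D (f L) y <= 1 / 4 ->
  forall t, L <= t <= L + normc (f L - y) -> D (add_segment L f y t) /\
    mdens D (add_segment L f y t) <= 4 / Num.min (delta D (f L)) (delta D y).
Proof.
move=> [L0 fD _] Dy w t tL.
have DL : D (f L) by apply: fD; rewrite L0 lexx.
have m0 := qmin_gt0 D0 oD bD DL Dy.
move: w; rewrite /qweight ler_pdivrMr// => w.
have md : Num.min (delta D (f L)) (delta D y) <= delta D (f L) by rewrite ge_min lexx.
set m := Num.min _ _ in m0 w md *.
have dist := add_segment_dist tL.
case/andP: tL => Lt tL.
have Dt : D (add_segment L f y t).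
  by apply: (delta_ball D0 oD bD DL); rewrite normcC dist; lra.
split => //; apply: le_trans (mdens_le D0 oD bD Dt) _.
have := delta_lip D0 oD bD (f L) (add_segment L f y t).
rewrite normcC dist => h.
have dt := delta_gt0 D0 oD bD Dt.
rewrite ler_pdivrMr// mulrAC ler_pdivlMr//; lra.
Qed.

Lemma chain_curve x s : qchain D x s -> exists f,
  [/\ unit_speed (qlen x s) f, f 0 = x, f (qlen x s) = last x s &
   (\int[lebesgue_measure]_(t in `[0%R, qlen x s]) (mdens D (f t))%:E
      <= (4 * qcost D x s)%:E)%E].
Proof.
elim/last_ind: s => [|s y IH].
  move=> Dx; exists (fun=> x); split => //; first exact: unit_speed_point.
  by rewrite /= integral_segment0 mulr0.
rewrite -cats1 => /qchain_cat[/IH[f [uf f0 fL fI]]] /= [Dz w Dy].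
rewrite qlen_cat qcost_cat last_cat /= !addr0.
have cf := uf.1; have [L0 fD _] := cf.
rewrite -fL in w *; have H := qweight_seg cf Dy w.
have H1 t h := (H t h).1.
have ug := unit_speed_add_segment uf H1.
exists (add_segment (qlen x s) f y); split => //.
- by rewrite add_segmentE.
- exact: add_segment_end.
have cg := ug.1; have n0 := normc_ge0 (f (qlen x s) - y).
have DL : D (f (qlen x s)) by apply: fD; rewrite L0 lexx.
have m0 := qmin_gt0 D0 oD bD DL Dy.
apply: le_trans (integral_increment_le (lip_curve_mdens_continuous D0 oD bD cg)
  (lip_curve_mdens_ge0 D0 oD bD cg) L0 _ (lexx _) _ (fun t h => (H t h).2)) _.
- by rewrite lerDl.
- by rewrite divr_ge0// ltW.
rewrite [in leRHS]mulrDr [in leRHS]EFinD leeD//; last first.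
  by rewrite lee_fin /qweight addrAC subrr add0r mulrAC mulrA.
apply: le_trans fI; rewrite le_eqVlt; apply/orP; left; apply/eqP.
apply: eq_integral => t; rewrite inE /= in_itv /= => /andP[_ tL].
by rewrite add_segmentE.
Qed.

Lemma qle_m_dist x y C : qle D x y C -> (m_dist D x y <= (4 * C)%:E)%E.
Proof.
move=> [s [h <- c]]; have [f [uf f0 fL fI]] := chain_curve h.
apply: (@le_trans _ _ (path_integral (mdens D) 0 (qlen x s) f)).
  apply: ereal_inf_lbound; exists 0, (qlen x s), f; split => //.
  by rewrite -fL -{1}f0; exact: (lip_curve_path uf.1).
rewrite (unit_speed_path_integral _ uf); apply: le_trans fI _.
by rewrite lee_fin ler_wpM2l.
Qed.

Lemma chain_inner_dist x s : qchain D x s ->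
  (inner_dist D x (last x s) <= (qlen x s)%:E)%E.
Proof.
move=> h; have [f [[cf fu] f0 fL _]] := chain_curve h.
have [L0 _ _] := cf.
rewrite -(fu (qlen x s)) ?L0 ?lexx//.
apply: ereal_inf_lbound; exists 0, (qlen x s), f; split => //.
by rewrite -fL -{1}f0; exact: lip_curve_path cf.
Qed.

End Chains.
End UnitSpeed.

(** * The cigar condition for sequences *)

Section DiscreteCigar.
Variable R : realType.

(** d and e stand for the boundary distances and the step lengths of a chain.
The hypothesis on subsequences bounds the length of those along which d is at
most twice its value at the ends.  The conclusion is a length bound for the
indices before one at which d attains its maximum so far. *)
Lemma cigar_to_max (d e : nat -> R) (n : nat) (C1 C2 : R) :
  0 <= C1 -> (forall k, 0 < d k) -> (forall k, 0 <= e k) ->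
  (forall k, (k < n)%N -> d k.+1 <= 3 / 2 * d k) ->
  (forall i j, (i <= j <= n)%N ->
     (forall k, (i <= k <= j)%N -> d k <= 2 * Num.min (d i) (d j)) ->
     \sum_(i <= k < j) e k <= C1 * Num.min (d i) (d j) /\
     forall k, (i <= k <= j)%N -> Num.min (d i) (d j) <= C2 * d k) ->
  forall M k, (k <= M <= n)%N -> (forall i, (i <= M)%N -> d i <= d M) ->
    \sum_(0 <= i < k) e i <= 5 * C1 * C2 * d k.
Proof.
move=> C10 d0 e0 dr H.
have record m : (m <= n)%N -> (forall i, (i <= m)%N -> d i <= d m) ->
    \sum_(0 <= i < m) e i <= 4 * C1 * d m.
  elim/ltn_ind: m => m IH mn rec.
  (* m is a record; the first index at which d reaches half of d m is a record too *)
  have hm : exists i, d m <= 2 * d i by exists m; have := d0 m; lra.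
  case: (ex_minnP hm) => i di imin.
  have im : (i <= m)%N by apply: imin; have := d0 m; lra.
  have min_im : Num.min (d i) (d m) = d i by apply/min_idPl/rec.
  have [h1 _] : \sum_(i <= k < m) e k <= C1 * Num.min (d i) (d m) /\
     forall k, (i <= k <= m)%N -> Num.min (d i) (d m) <= C2 * d k.
    apply: H; first by rewrite im.
    by move=> k /andP[_ km]; rewrite min_im; apply: le_trans (rec k km) di.
  rewrite min_im in h1.
  have dim : C1 * d i <= C1 * d m by apply: ler_wpM2l => //; exact: rec.
  have C1d : 0 <= C1 * d m by rewrite mulr_ge0// ltW.
  case: i di imin im min_im h1 dim => [|i] di imin im min_im h1 dim; first by lra.
  have di' : 2 * d i < d m.
    by rewrite ltNge; apply/negP => /imin; rewrite ltnn.
  have dS : d i.+1 <= 3 / 4 * d m by have := dr i (leq_trans im mn); lra.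
  have im' : (i.+1 < m)%N.
    rewrite ltn_neqAle im andbT; apply/eqP => E; move: dS; rewrite E.
    by have := d0 m; lra.
  have := IH _ im' (leq_trans im mn) _ => hI.
  have h2 : \sum_(0 <= i0 < i.+1) e i0 <= 4 * C1 * d i.+1.
    apply: hI => j ji; have [->//|ji'] := eqVneq j i.+1.
    have : ~~ (d m <= 2 * d j).
      by apply/negP => /imin; rewrite leqNgt ltn_neqAle ji' ji.
    by rewrite -ltNge; lra.
  rewrite (big_cat_nat (n := i.+1))//=.
  have : C1 * d i.+1 <= C1 * (3 / 4 * d m) by apply: ler_wpM2l.
  lra.
move=> M k /andP[kM Mn] dM.
(* m is the record before k, j the first index from k on that reaches d m again *)
have [m mk mmax] : exists2 m, (m <= k)%N & forall i, (i <= k)%N -> d i <= d m.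
  elim: k {kM} => [|k [m mk mmax]]; first by exists 0%N => // i; rewrite leqn0 => /eqP ->.
  have [h|h] := leP (d k.+1) (d m).
    by exists m; rewrite ?leqW// => i; rewrite leq_eqVlt => /predU1P[->//|/mmax].
  exists k.+1 => // i; rewrite leq_eqVlt => /predU1P[->//|/mmax h']; lra.
have hj : exists j, (k <= j)%N && (d m <= d j).
  by exists M; rewrite kM /=; apply: dM; exact: leq_trans kM.
case: (ex_minnP hj) => j /andP[kj dj] jmin.
have jM : (j <= M)%N by apply: jmin; rewrite kM /= dM// (leq_trans mk).
have before i : (i < j)%N -> d i <= d m.
  move=> ij; have [ik|ki] := leqP i k; first exact: mmax.
  rewrite leNgt; apply/negP => /ltW h.
  have : (j <= i)%N by apply: jmin; rewrite (ltnW ki).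
  by rewrite leqNgt ij.
have djm : d j <= 2 * d m.
  move: kj before; rewrite leq_eqVlt => /predU1P[<- _|].
    by have := mmax k (leqnn k); have := d0 m; lra.
  case: j {hj jmin dj} jM => // j jM _ before.
  by have := dr j (leq_trans jM Mn); have := before j (ltnSn j); have := d0 m; lra.
have min_mj : Num.min (d m) (d j) = d m by apply/min_idPl.
have mj := leq_trans mk kj.
have [h1 h2] : \sum_(m <= k < j) e k <= C1 * Num.min (d m) (d j) /\
    forall k, (m <= k <= j)%N -> Num.min (d m) (d j) <= C2 * d k.
  apply: H; first by rewrite mj (leq_trans jM).
  move=> i /andP[mi]; rewrite min_mj leq_eqVlt => /predU1P[->//|/before h].
  by have := d0 m; lra.
rewrite min_mj in h1 h2.
have h3 : \sum_(0 <= i < m) e i <= 4 * C1 * d m.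
  apply: record; first exact: leq_trans mj (leq_trans jM Mn).
  by move=> i im; apply: mmax; exact: leq_trans mk.
have h4 : \sum_(m <= i < k) e i <= \sum_(m <= i < j) e i.
  by rewrite (big_cat_nat (n := k) (p := j))//= lerDl sumr_ge0.
have h5 : d m <= C2 * d k by apply: h2; rewrite mk.
have h6 : C1 * d m <= C1 * (C2 * d k) by apply: ler_wpM2l.
rewrite (big_cat_nat (n := m))//=; lra.
Qed.

(** Reversal of the order of summation. *)
Lemma big_nat_reflect (e : nat -> R) (n i j : nat) : (i <= j)%N -> (j <= n)%N ->
  \sum_(n - j <= k < n - i) e k = \sum_(i <= k < j) e (n - k.+1)%N.
Proof.
elim: j => [|j IH] ij jn.
  by move: ij; rewrite leqn0 => /eqP ->; rewrite !big_geq.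
move: ij; rewrite leq_eqVlt => /predU1P[->|ij]; first by rewrite !big_geq.
have ltn : (n - j.+1 < n - i)%N by lia.
rewrite [LHS](big_ltn ltn) (_ : (n - j.+1).+1 = n - j)%N; last by lia.
rewrite (IH ij (ltnW jn)) addrC.
by rewrite [RHS](@big_nat_recr _ _ _ j i).
Qed.

(** The two-sided version, by symmetry around an index that maximizes d. *)
Lemma cigar_discrete (d e : nat -> R) (n : nat) (C1 C2 : R) :
  0 <= C1 -> (forall k, 0 < d k) -> (forall k, 0 <= e k) ->
  (forall k, (k < n)%N -> d k.+1 <= 3 / 2 * d k /\ d k <= 3 / 2 * d k.+1) ->
  (forall i j, (i <= j <= n)%N ->
     (forall k, (i <= k <= j)%N -> d k <= 2 * Num.min (d i) (d j)) ->
     \sum_(i <= k < j) e k <= C1 * Num.min (d i) (d j) /\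
     forall k, (i <= k <= j)%N -> Num.min (d i) (d j) <= C2 * d k) ->
  forall k, (k <= n)%N ->
    \sum_(0 <= i < k) e i <= 5 * C1 * C2 * d k \/
    \sum_(k <= i < n) e i <= 5 * C1 * C2 * d k.
Proof.
move=> C10 d0 e0 dr H.
have [M Mn Mmax] : exists2 m, (m <= n)%N & forall i, (i <= n)%N -> d i <= d m.
  elim: n {dr H} => [|k [m mk mmax]]; first by exists 0%N => // i; rewrite leqn0 => /eqP ->.
  have [h|h] := leP (d k.+1) (d m).
    by exists m; rewrite ?leqW// => i; rewrite leq_eqVlt => /predU1P[->//|/mmax].
  exists k.+1 => // i; rewrite leq_eqVlt => /predU1P[->//|/mmax h']; lra.
move=> k kn; have [kM|/ltnW Mk] := leqP k M.
  left; apply: (@cigar_to_max d e n C1 C2 _ _ _ _ _ M) => //.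
  - by move=> i /dr[].
  - by rewrite kM.
  - by move=> i iM; apply: Mmax; exact: leq_trans Mn.
right.
pose d' i := d (n - i)%N; pose e' i := e (n - i.+1)%N.
have dr' i : (i < n)%N -> d' i.+1 <= 3 / 2 * d' i.
  move=> i_n; have lt : (n - i.+1 < n)%N by lia.
  have [_] := dr _ lt; have -> : (n - i.+1).+1 = (n - i)%N by lia.
  by [].
have H' i j : (i <= j <= n)%N ->
     (forall k, (i <= k <= j)%N -> d' k <= 2 * Num.min (d' i) (d' j)) ->
     \sum_(i <= k < j) e' k <= C1 * Num.min (d' i) (d' j) /\
     forall k, (i <= k <= j)%N -> Num.min (d' i) (d' j) <= C2 * d' k.
  move=> /andP[ij jn] h; rewrite -big_nat_reflect// minC.
  have ijn : (n - j <= n - i <= n)%N by lia.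
  have [|h1 h2] := H _ _ ijn.
    move=> i0 i0b; have i0b' : (i <= n - i0 <= j)%N by lia.
    have := h _ i0b'; rewrite /d' subKn; last by lia.
    by rewrite minC.
  by split => // i0 i0b; apply: h2; lia.
have M1 : (n - k <= n - M <= n)%N by lia.
have M2 i : (i <= n - M)%N -> d' i <= d' (n - M)%N.
  by move=> _; rewrite /d' subKn//; apply: Mmax; exact: leq_subr.
have := cigar_to_max C10 (fun i => d0 (n - i)%N) (fun i => e0 (n - i.+1)%N)
  dr' H' M1 M2.
rewrite /e' -big_nat_reflect ?leq_subr// subn0 /d' subKn//.
Qed.

End DiscreteCigar.

(** * Simple arcs along a chain *)

Section SimpleArc.
Variables (R : realType) (D : set R[i]^o).
Hypotheses (D0 : D !=set0) (oD : open D) (bD : bounded_set D).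
Implicit Types (x y z : R[i]^o) (s : seq R[i]^o).

(** The equality case of the triangle inequality characterizes the points of the
segment from z to y, so t0 is the first time at which g meets this segment. *)
Lemma first_hit z y (l : R) (g : R -> R[i]^o) : lip_curve D l g -> g l = z ->
  exists t0, [/\ 0 <= t0 <= l,
     normc (z - g t0) + normc (g t0 - y) <= normc (z - y) &
     forall t, 0 <= t < t0 ->
        normc (z - y) < normc (z - g t) + normc (g t - y)].
Proof.
move=> [l0 gD gl] gz.
pose h t := normc (z - g t) + normc (g t - y).
pose A := [set t : R | 0 <= t <= l /\ h t <= normc (z - y)].
have Al : A l by split; [rewrite l0 lexx|rewrite /h gz normcxx add0r].
have hA : has_inf A by split; [exists l|exists 0 => t [/andP[]]].
have t00 : 0 <= inf A by apply: lb_le_inf; [exists l|move=> t [/andP[]]].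
have t0l : inf A <= l by apply: ge_inf => //; case: hA.
exists (inf A); split; first by rewrite t00.
  apply/ler_addgt0Pr => e e0; have e20 : 0 < e / 2 by lra.
  have [t [tl ht] tlt] := inf_adherent e20 hA.
  have tA : inf A <= t by apply: ge_inf => //; case: hA.
  have := gl t (inf A) tl; rewrite t00 t0l ger0_norm ?subr_ge0// => /(_ isT).
  have := normc_triangle (g t) z (g (inf A)).
  have := normc_triangle (g t) (g (inf A)) y.
  move: ht; rewrite /h (normcC (g (inf A)) (g t)); lra.
move=> t /andP[t0 tlt]; rewrite ltNge; apply/negP => ht.
have : inf A <= t.
  apply: ge_inf; first by case: hA.
  by split => //; rewrite t0 (le_trans (ltW tlt)).
by rewrite leNgt tlt.
Qed.

(** g is an injective arc of length at most l along the chain x :: s.  Each of its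
points is close to a vertex of the chain, and is reached from either end of the
arc after a length controlled by that of the polygon up to this vertex. *)
Definition chain_arc_spec x s (l : R) (g : R -> R[i]^o) : Prop :=
  [/\ lip_curve D l g, g 0 = x /\ g l = last x s, {in `[0, l] &, injective g},
    l <= qlen x s &
    forall t, 0 <= t <= l -> exists s1 s2, [/\ s = s1 ++ s2,
       normc (last x s1 - g t) <= delta D (last x s1) / 4,
       t <= qlen x s1 + delta D (last x s1) / 4 &
       l - t <= qlen (last x s1) s2]].

(** Segments are added one at a time; the part of the arc after its first hit of
the new segment is erased. *)
Lemma chain_arc x s : qchain D x s -> exists l g, chain_arc_spec x s l g.
Proof.
elim/last_ind: s => [|s y IH].
  move=> Dx; exists 0, (fun=> x); split => //.
  - exact: (unit_speed_point Dx).1.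
  - by move=> t u; rewrite !in_itv /= => t0 u0 _; lra.
  - move=> t t0; exists [::], [::]; have d0 := delta_gt0 D0 oD bD Dx.
    by split => //=; rewrite ?normcxx; lra.
rewrite -cats1 => /qchain_cat[/IH[l [g [cg [g0 gl] ginj lq gP]]]] /= [Dz w Dy].
have dz := delta_gt0 D0 oD bD Dz.
set z := last x s in Dz w gl dz *.
have zy : normc (z - y) <= delta D z / 4.
  have m0 := qmin_gt0 D0 oD bD Dz Dy.
  have : Num.min (delta D z) (delta D y) <= delta D z by rewrite ge_min lexx.
  by move: w; rewrite /qweight ler_pdivrMr//; lra.
have [t0 [/andP[t00 t0l] hit first]] := first_hit y cg gl.
have [l0 gD gL] := cg.
have cg0 : lip_curve D t0 g.
  split => // [t /andP[h1 h2]|t u /andP[h1 h2] /andP[h3 h4]].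
    by apply: gD; rewrite h1 (le_trans h2).
  by apply: gL; rewrite ?h1 ?h3 (le_trans _ t0l).
have n0 := normc_ge0 (g t0 - y); have n1 := normc_ge0 (z - g t0).
(* the arc is cut at t0 and continued by the segment from g t0 to y *)
pose g' := add_segment t0 g y; pose l' := t0 + normc (g t0 - y).
have g'z t : t0 <= t <= l' -> normc (z - g' t) + normc (g' t - y) <= normc (z - y).
  move=> tl; have d1 := add_segment_dist tl; rewrite -/g' in d1.
  have : normc (g' t - y) = l' - t.
    case/andP: tl => t0t tl'; rewrite /g' /add_segment; case: leP => h.
      have -> : t = t0 by lra.
      by rewrite /l' addrAC subrr add0r.
    have e0 : 0 < normc (g t0 - y) by rewrite /l' in tl'; lra.
    rewrite seg_distr ger0_norm; last first.
      by rewrite subr_ge0 ler_pdivrMr// mul1r; rewrite /l' in tl'; lra.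
    by rewrite mulrBl mul1r divfK ?gt_eqF// /l'; ring.
  have := normc_triangle (g t0) z (g' t).
  by rewrite (normcC (g t0) (g' t)) /l'; lra.
(* the new part of the arc stays in the segment from z to y, hence near z *)
have inD t : t0 <= t <= t0 + normc (g t0 - y) -> D (add_segment t0 g y t).
  move=> /g'z h; apply: (delta_ball D0 oD bD Dz).
  have := normc_ge0 (g' t - y); rewrite -/g'; lra.
have cg' := add_segment_lip cg0 inD.
exists l', g'; split => //.
- split; first by rewrite /g' add_segmentE.
  by rewrite last_cat /= /l' /g' add_segment_end.
- suff H (p u : R) : p \in `[0, l'] -> u \in `[0, l'] -> p <= u -> g' p = g' u -> p = u.
    move=> p u hs hu E; have [su|/ltW us] := leP p u; first exact: H.
    by apply/esym; apply: H.
  rewrite !in_itv /= => /andP[s0 sl] /andP[u0 ul] su.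
  have [ut|tu] := leP u t0.
    have st := le_trans su ut.
    rewrite /g' !add_segmentE// => E; apply: ginj => //; rewrite in_itv /=.
      by rewrite s0 (le_trans st).
    by rewrite u0 (le_trans ut).
  have hu := g'z u; rewrite ul (ltW tu) in hu.
  have d1 : normc (g' u - g t0) = u - t0.
    by apply: add_segment_dist; rewrite -/l' ul (ltW tu).
  have [st|ts] := ltP p t0.
    have := first p; rewrite s0 st => /(_ isT).
    rewrite {1 2}/g' add_segmentE ?(ltW st)// => h1 E.
    by move: h1; rewrite E => h1; have := hu isT; lra.
  move: d1; have := add_segment_dist (t := p) (L := t0) (f := g) (y := y).
  rewrite -/g' -/l' ts sl => /(_ isT) d2 d1 E; move: d2; rewrite E; lra.
- rewrite qlen_cat /= addr0 -/z /l'; lra.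
move=> t /andP[t1 tl].
have [tt0|/ltW t0t] := leP t t0.
  have [|s1 [s2 [E h1 h2 h3]]] := gP t; first by rewrite t1 (le_trans tt0).
  exists s1, (s2 ++ [:: y]); split => //; first by rewrite E catA.
    by rewrite /g' add_segmentE.
  rewrite qlen_cat -last_cat -E -/z /= addr0 /l'; lra.
exists s, [:: y]; rewrite -/z.
have hu := g'z t; rewrite t0t tl in hu; have {}hu := hu isT.
have n2 := normc_ge0 (g' t - y); have n3 := normc_ge0 (z - g' t).
by split => //=; rewrite /l' in tl *; lra.
Qed.

End SimpleArc.

(** * The metric inequality implies the John condition *)

Section JohnFromMetricBound.
Variables (R : realType) (D : set R[i]^o).
Hypotheses (D0 : D !=set0) (oD : open D) (bD : bounded_set D).
Implicit Types (x y z : R[i]^o) (s : seq R[i]^o).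

(** A quantity bounded by a multiple of its own logarithm is bounded. *)
Lemma log_growth (K x c : R) : 1 <= K -> 0 <= x ->
  x / 2 <= K * ln (1 + x) + c -> x <= 4 * (K * ln (4 * K) + c) + 1.
Proof.
move=> K1 x0 H.
have p1 : 0 < (1 + x) / (4 * K) by rewrite divr_gt0//; lra.
have h : ln (1 + x) = ln ((1 + x) / (4 * K)) + ln (4 * K).
  by rewrite -lnM ?posrE//; [rewrite divfK// gt_eqF//; lra | lra].
have := @le_ln1Dx _ ((1 + x) / (4 * K) - 1).
rewrite addrCA subrr addr0 => h2.
have {}h2 : ln ((1 + x) / (4 * K)) <= (1 + x) / (4 * K) - 1 by apply: h2; lra.
have : K * ln (1 + x) <= K * ((1 + x) / (4 * K) - 1 + ln (4 * K)).
  by rewrite ler_wpM2l; lra.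
have -> : K * ((1 + x) / (4 * K) - 1 + ln (4 * K)) = (1 + x) / 4 - K + K * ln (4 * K).
  by field; rewrite gt_eqF//; lra.
lra.
Qed.

Lemma inner_dist_ge0 x y : (0 <= inner_dist D x y)%E.
Proof.
apply: le_ereal_inf_tmp => _ [a [b [g [[ab _ _ _ _] ->]]]].
exact: arc_length_ge0.
Qed.

Lemma j'_dist_le x y (l : R) : D x -> D y -> (inner_dist D x y <= l%:E)%E ->
  j'_dist D x y <= ln (1 + l / Num.min (delta D x) (delta D y)).
Proof.
move=> Dx Dy xyl; have dx := delta_gt0 D0 oD bD Dx; have dy := delta_gt0 D0 oD bD Dy.
have m0 := qmin_gt0 D0 oD bD Dx Dy.
have i0 := inner_dist_ge0 x y.
have fi0 : 0 <= fine (inner_dist D x y) by apply: fine_ge0.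
have il : fine (inner_dist D x y) <= l.
  rewrite -lee_fin fineK// ge0_fin_numE//; exact: le_lt_trans xyl (ltry _).
have l0 := le_trans fi0 il.
set m := Num.min _ _ in m0 *.
have key z : 0 < delta D z -> m <= delta D z ->
    0 < 1 + fine (inner_dist D x y) / delta D z /\
    1 + fine (inner_dist D x y) / delta D z <= 1 + l / m.
  move=> dz mz; split; first by rewrite ltr_pwDl// divr_ge0// ltW.
  rewrite lerD2l ler_pdivrMr// mulrAC ler_pdivlMr//.
  apply: le_trans (_ : fine (inner_dist D x y) * delta D z <= _).
    by rewrite ler_wpM2l.
  by rewrite ler_wpM2r// ltW.
have [k1 k2] := key x dx (ltac:(by rewrite /m ge_min lexx)).
have [k3 k4] := key y dy (ltac:(by rewrite /m ge_min lexx orbT)).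
have lm : 0 < 1 + l / m by lra.
rewrite /j'_dist lnM ?posrE//.
have h1 : ln (1 + fine (inner_dist D x y) / delta D x) <= ln (1 + l / m).
  by rewrite ler_ln ?posrE.
have h2 : ln (1 + fine (inner_dist D x y) / delta D y) <= ln (1 + l / m).
  by rewrite ler_ln ?posrE.
lra.
Qed.

(** The bound C1 on the relative length of a subchain, as given by [log_growth]. *)
Definition length_cst (K : R) : R := 4 * (K * ln (4 * K) + 3) + 1.

(** The bound C2 on the variation of delta along such a subchain. *)
Definition ratio_cst (K : R) : R := expR (K * ln (1 + length_cst K) + 3).

Lemma length_cst_ge0 (K : R) : 1 <= K -> 0 <= length_cst K.
Proof.
move=> K1; have : 0 <= K * ln (4 * K) by apply: mulr_ge0; [|apply: ln_ge0]; lra.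
by rewrite /length_cst; lra.
Qed.

Variable c2 : R.
Hypotheses (c21 : 1 <= c2) (Hm : forall z1 z2, D z1 -> D z2 ->
    (m_dist D z1 z2 <= (c2 * j'_dist D z1 z2)%:E)%E).

Lemma qle_of_m_dist x y : D x -> D y -> qle D x y (2 * (c2 * j'_dist D x y + 1)).
Proof.
move=> Dx Dy.
have lt : (m_dist D x y < (c2 * j'_dist D x y + 1)%:E)%E.
  by apply: le_lt_trans (Hm Dx Dy) _; rewrite lte_fin; lra.
have [_ [a [b [g [pg ->]]]] lt2] := ereal_inf_lt lt.
apply: (path_chain D0 oD bD pg); exact: ltW.
Qed.

(** A chain whose cost exceeds the infimum by at most 1. *)
Lemma near_minimal_chain x y : D x -> D y -> exists s,
  [/\ qchain D x s, last x s = y & forall C, qle D x y C -> qcost D x s <= C + 1].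
Proof.
move=> Dx Dy; pose A := [set C | qle D x y C].
have lA : lbound A 0.
  by move=> C [s [h _ c]]; apply: le_trans c; exact: qcost_ge0 h.
have hA : has_inf A.
  by split; [exists (2 * (c2 * j'_dist D x y + 1)); exact: qle_of_m_dist|exists 0].
have [C [s [h l c]] Clt] := inf_adherent (@ltr01 R) hA.
exists s; split => // C' hC'; apply: (le_trans c); apply: (le_trans (ltW Clt)).
by rewrite lerD2r; apply: ge_inf => //; exists 0.
Qed.

Section FixedChain.
Variables (x y : R[i]^o) (s : seq R[i]^o).
Hypotheses (xs : qchain D x s) (lxs : last x s = y)
  (smin : forall C, qle D x y C -> qcost D x s <= C + 1).
Let X k := last x (take k s).
Let W k := qcost D x (take k s).
Let L k := qlen x (take k s).
Let d k := delta D (X k).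

Let chain_take k : qchain D x (take k s).
Proof. by move: xs; rewrite -{1}(cat_take_drop k s) => /qchain_cat[]. Qed.

Let DX k : D (X k).
Proof.
have : qchain D x (take k s ++ [::]) by rewrite cats0.
by move=> /qchain_cat[].
Qed.

Let d0 k : 0 < d k. Proof. exact: delta_gt0. Qed.

Let take_split i j : (i <= j)%N -> take j s = take i s ++ drop i (take j s).
Proof. by move=> ij; rewrite -{1}(cat_take_drop i (take j s)) take_takel. Qed.

Let Xlast i j : (i <= j)%N -> last (X i) (drop i (take j s)) = X j.
Proof. by move=> ij; rewrite /X {2}(take_split ij) last_cat. Qed.

Let subchain i j : (i <= j)%N -> qchain D (X i) (drop i (take j s)).
Proof. by move=> ij; have := chain_take j; rewrite {1}(take_split ij) => /qchain_cat[]. Qed.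

Let WB i j : (i <= j)%N -> W j - W i = qcost D (X i) (drop i (take j s)).
Proof. by move=> ij; rewrite /W {1}(take_split ij) qcost_cat addrC addKr. Qed.

Let LB i j : (i <= j)%N -> L j - L i = qlen (X i) (drop i (take j s)).
Proof. by move=> ij; rewrite /L {1}(take_split ij) qlen_cat addrC addKr. Qed.

Let step k : (k < size s)%N ->
  [/\ L k.+1 - L k = normc (X k - X k.+1), W k.+1 - W k = qweight D (X k) (X k.+1)
    & qweight D (X k) (X k.+1) <= 1 / 4].
Proof.
move=> ks.
have E : drop k (take k.+1 s) = [:: nth x s k].
  by rewrite (take_nth x ks) -cats1 drop_size_cat// size_takel// ltnW.
have := subchain (leqnSn k); have := Xlast (leqnSn k).
rewrite WB// LB// E /= => -> [_ w _].
by rewrite !addr0.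
Qed.

Let Lmono k : 0 <= L k.+1 - L k.
Proof. by rewrite LB// qlen_ge0. Qed.

Let Wmono i j : (i <= j)%N -> W i <= W j.
Proof. by move=> ij; rewrite -subr_ge0 WB//; apply: (qcost_ge0 D0 oD bD); exact: subchain. Qed.

(** Subchains of a nearly minimal chain are nearly minimal. *)
Let sub_minimal i j C : (i <= j)%N -> qle D (X i) (X j) C -> W j - W i <= C + 1.
Proof.
move=> ij h.
(* replacing the part from i to j by another chain cannot save more than 1 *)
have h1 : qle D x (X i) (W i) by exists (take i s).
have h2 : qle D (X j) y (qcost D x s - W j).
  exists (drop j s); split.
  - by move: xs; rewrite -{1}(cat_take_drop j s) => /qchain_cat[].
  - by rewrite /X -last_cat cat_take_drop.
  - by rewrite -{2}(cat_take_drop j s) qcost_cat /W addrC addKr.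
have := smin (qle_trans (qle_trans h1 h) h2); lra.
Qed.

Let d_step k : (k < size s)%N ->
  d k.+1 <= d k * (1 + (W k.+1 - W k)) /\ d k <= d k.+1 * (1 + (W k.+1 - W k)).
Proof.
move=> ks; have [Lk Wk w] := step ks.
have m0 := qmin_gt0 D0 oD bD (DX k) (DX k.+1).
have E : normc (X k - X k.+1) = (W k.+1 - W k) * Num.min (d k) (d k.+1).
  by rewrite Wk /qweight divfK// gt_eqF.
have h1 := delta_lip D0 oD bD (X k) (X k.+1).
have h2 := delta_lip D0 oD bD (X k.+1) (X k).
rewrite (normcC (X k.+1)) in h2.
have W0 : 0 <= W k.+1 - W k by rewrite subr_ge0 Wmono.
have := @ler_wpM2l _ _ W0 (Num.min (d k) (d k.+1)) (d k).
have := @ler_wpM2l _ _ W0 (Num.min (d k) (d k.+1)) (d k.+1).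
rewrite !ge_min !lexx orbT /= => /(_ isT) h3 /(_ isT) h4.
rewrite -/(d k) -/(d k.+1) in h1 h2.
by split; lra.
Qed.

Let d_ratio k : (k < size s)%N -> d k.+1 <= 3 / 2 * d k /\ d k <= 3 / 2 * d k.+1.
Proof.
move=> ks; have [Lk Wk w] := step ks; have [h1 h2] := d_step ks.
rewrite -Wk in w.
have := ler_wpM2l (ltW (d0 k)) w; have := ler_wpM2l (ltW (d0 k.+1)) w.
by have := d0 k; have := d0 k.+1; lra.
Qed.

Let d_exp i k : (i <= k <= size s)%N -> d i <= d k * expR (W k - W i).
Proof.
elim: k => [|k IH] /andP[ik ks].
  by move: ik; rewrite leqn0 => /eqP ->; rewrite subrr expR0 mulr1.
move: ik; rewrite leq_eqVlt => /predU1P[->|ik]; first by rewrite subrr expR0 mulr1.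
apply: le_trans (IH _) _; first by rewrite -ltnS ik ltnW.
have -> : W k.+1 - W i = (W k.+1 - W k) + (W k - W i) by ring.
rewrite (expRD (W k.+1 - W k)) mulrA ler_wpM2r ?expR_ge0//.
have [_ h] := d_step ks; apply: (le_trans h); rewrite ler_wpM2l ?(ltW (d0 _))//.
exact: expR_ge1Dx.
Qed.

Let W_le_len i j : (i <= j)%N ->
  W j - W i <= 2 * c2 * ln (1 + (L j - L i) / Num.min (d i) (d j)) + 3.
Proof.
move=> ij; have := sub_minimal ij (qle_of_m_dist (DX i) (DX j)).
have h : (inner_dist D (X i) (X j) <= (L j - L i)%:E)%E.
  by rewrite (LB ij) -(Xlast ij); apply: chain_inner_dist => //; exact: subchain.
have := j'_dist_le (DX i) (DX j) h; rewrite -/(d i) -/(d j) => h1.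
have c20 : 0 <= c2 by apply: le_trans c21.
have := ler_wpM2l c20 h1; lra.
Qed.

(** Along a subchain where delta is at most twice its values at the ends, the cost
is bounded below by a multiple of the relative length, and above by its
logarithm. *)
Let chain_comparison i j : (i <= j <= size s)%N ->
  (forall k, (i <= k <= j)%N -> d k <= 2 * Num.min (d i) (d j)) ->
  \sum_(i <= k < j) (L k.+1 - L k) <= length_cst (2 * c2) * Num.min (d i) (d j) /\
  forall k, (i <= k <= j)%N -> Num.min (d i) (d j) <= ratio_cst (2 * c2) * d k.
Proof.
move=> /andP[ij js] H.
have m0 := qmin_gt0 D0 oD bD (DX i) (DX j).
rewrite -/(d i) -/(d j) in m0; set m := Num.min _ _ in m0 H *.
have LW : (L j - L i) / m / 2 <= W j - W i.
  rewrite -!telescope_sumr// !mulr_suml; apply: ler_sum_nat => k /andP[ik kj].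
  have [Lk Wk w] := step (leq_trans kj js).
  rewrite Lk Wk /qweight -mulrA ler_wpM2l ?normc_ge0//.
  rewrite -invfM lef_pV2 ?posrE ?mulr_gt0//; last exact: qmin_gt0.
  rewrite mulrC; apply: le_trans (H k _); last by rewrite ik ltnW.
  by rewrite ge_min lexx.
have L0 : 0 <= (L j - L i) / m.
  by rewrite divr_ge0 ?(ltW m0)// LB// qlen_ge0.
have h1 := W_le_len ij; rewrite -/m in h1.
have K1 : 1 <= 2 * c2 by have := c21; lra.
have len_le : (L j - L i) / m <= length_cst (2 * c2) by apply: log_growth => //; exact: le_trans h1.
split; first by rewrite telescope_sumr// -ler_pdivrMr.
move=> k /andP[ik kj].
have h2 : d i <= d k * expR (W k - W i) by apply: d_exp; rewrite ik (leq_trans kj).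
apply: le_trans (_ : d i <= _); first by rewrite ge_min lexx.
apply: (le_trans h2); rewrite mulrC ler_wpM2r ?(ltW (d0 _))// ler_expR.
have h3 := Wmono kj.
have : ln (1 + (L j - L i) / m) <= ln (1 + length_cst (2 * c2)).
  by rewrite ler_ln ?posrE; lra.
have K0 : 0 <= 2 * c2 by lra.
move=> /(ler_wpM2l K0); lra.
Qed.

Lemma chain_cigar s1 s2 : s = s1 ++ s2 ->
  qlen x s1 <= 5 * length_cst (2 * c2) * ratio_cst (2 * c2) * delta D (last x s1) \/
  qlen (last x s1) s2 <= 5 * length_cst (2 * c2) * ratio_cst (2 * c2) * delta D (last x s1).
Proof.
move=> E.
have kn : (size s1 <= size s)%N by rewrite E size_cat leq_addr.
have K1 : 1 <= 2 * c2 by have := c21; lra.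
have := cigar_discrete (length_cst_ge0 K1) d0 Lmono d_ratio chain_comparison kn.
rewrite !telescope_sumr//.
have Ls1 : L (size s1) = qlen x s1 by rewrite /L E take_size_cat.
have L0 : L 0 = 0 by rewrite /L take0.
have Xs1 : X (size s1) = last x s1 by rewrite /X E take_size_cat.
have -> : L (size s) - L (size s1) = qlen (last x s1) s2.
  by rewrite LB// take_size Xs1 E drop_size_cat.
by rewrite Ls1 L0 subr0 /d Xs1.
Qed.

End FixedChain.

Lemma john_arc_of_metric_bound : exists2 c : R, 1 <= c &
  forall z1 z2, D z1 -> D z2 -> exists a b g, rectifiable_arc D z1 z2 a b g /\
    {in `[a, b], forall t, (Order.min (arc_length a t g) (arc_length t b g)
             <= (c * delta D (g t))%:E)%E}.
Proof.
have K1 : 1 <= 2 * c2 by have := c21; lra.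
pose C := 5 * length_cst (2 * c2) * ratio_cst (2 * c2).
exists (Num.max 1 (4 / 3 * (C + 1 / 4))); first by rewrite le_max lexx.
move=> z1 z2 Dz1 Dz2.
have [s [h l smin]] := near_minimal_chain Dz1 Dz2.
have [lg [g [cg [g0 gl] ginj _ gP]]] := chain_arc D0 oD bD h.
have [l0 gD _] := cg.
exists 0, lg, g; split.
  by split => //; rewrite -l -gl -{1}g0; exact: lip_curve_path.
move=> t; rewrite in_itv /= => tl; have /andP[t0 tl'] := tl.
have [s1 [s2 [E h1 h2 h3]]] := gP t tl.
have dv := delta_lip D0 oD bD (last z1 s1) (g t).
have dg := delta_gt0 D0 oD bD (gD t tl).
have A1 := lip_curve_length cg (lexx 0) t0 tl'.
have A2 := lip_curve_length cg t0 tl' (lexx _).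
have cc : 4 / 3 * (C + 1 / 4) * delta D (g t) <=
    Num.max 1 (4 / 3 * (C + 1 / 4)) * delta D (g t).
  by rewrite ler_wpM2r ?(ltW dg)// le_max lexx orbT.
have C0 : 0 <= C.
  by rewrite /C mulr_ge0 ?expR_ge0// mulr_ge0 ?length_cst_ge0.
have dd : delta D (last z1 s1) <= 4 / 3 * delta D (g t) by lra.
have cd := ler_wpM2l C0 dd.
have [hc|hc] := chain_cigar h l smin E; rewrite ge_min; apply/orP; [left|right].
  by apply: (le_trans A1); rewrite lee_fin; rewrite -/C in hc; lra.
by apply: (le_trans A2); rewrite lee_fin; rewrite -/C in hc; lra.
Qed.

End JohnFromMetricBound.

(** * Parity of grid paths *)

Section GridParity.
Variables (f inQ : nat -> nat -> bool).
Hypothesis inQ0 : forall x, inQ x 0%N = false.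
Implicit Types x y j : nat.

(** Whether f changes between the cells (x, y) and (x', y), both in the box inQ:
a mod 2 cochain on the horizontal moves between cells. *)
Definition jumpH x x' y := [&& inQ x y, inQ x' y & f x y (+) f x' y].
(** The same for vertical moves, from (x, y) to (x, y'). *)
Definition jumpV x y y' := [&& inQ x y, inQ x y' & f x y (+) f x y'].
(** The coboundary of the jumps at the common corner of the four cells (x, j),
(x + 1, j), (x, j + 1) and (x + 1, j + 1).  It can be nonzero only where some
of these cells are in inQ and some are not. *)
Definition jump_curl x j :=
  jumpV x j j.+1 (+) jumpV x.+1 j j.+1 (+) jumpH x x.+1 j (+) jumpH x x.+1 j.+1.

Let F x y := \big[addb/false]_(0 <= j < y) jumpV x j j.+1.

Lemma jumpVC x y y' : jumpV x y y' = jumpV x y' y.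
Proof. by rewrite /jumpV addbC andbCA. Qed.

Lemma jumpHC x x' y : jumpH x x' y = jumpH x' x y.
Proof. by rewrite /jumpH addbC andbCA. Qed.

Lemma jumpVxx x y : jumpV x y y = false.
Proof. by rewrite /jumpV addbb !andbF. Qed.

Lemma jumpHxx x y : jumpH x x y = false.
Proof. by rewrite /jumpH addbb !andbF. Qed.

Let F_V x y y' : (y <= y'.+1)%N -> (y' <= y.+1)%N ->
  jumpV x y y' = F x y (+) F x y'.
Proof.
wlog yy' : y y' / (y <= y')%N.
  move=> H h1 h2; have [h|/ltnW h] := leqP y y'; first exact: H.
  by rewrite jumpVC addbC; exact: H.
move=> _ h; have [->|ne] := eqVneq y y'; first by rewrite jumpVxx addbb.
have -> : y' = y.+1 by apply/eqP; rewrite eqn_leq h ltn_neqAle ne.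
by rewrite /F big_nat_recr//= addKb.
Qed.

Let F_H x y : jumpH x x.+1 y =
  F x y (+) F x.+1 y (+) \big[addb/false]_(0 <= j < y) jump_curl x j.
Proof.
elim: y => [|y IH]; first by rewrite /F !big_geq// /jumpH inQ0.
rewrite /F !big_nat_recr//= -/(F x y) -/(F x.+1 y).
rewrite [X in _ (+) (_ (+) X)]/jump_curl IH.
move: (F x y) (F x.+1 y) (jumpH x x.+1 y.+1) (jumpV x y y.+1) (jumpV x.+1 y y.+1)
  (\big[addb/false]_(0 <= j < y) jump_curl x j).
by do 6 case.
Qed.

Let F_H2 B x x' y : (x <= x'.+1)%N -> (x' <= x.+1)%N -> (x < B)%N -> (x' < B)%N ->
  (y <= B)%N ->
  jumpH x x' y = F x y (+) F x' y (+)
   \big[addb/false]_(0 <= x0 < B) \big[addb/false]_(0 <= j < B)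
      [&& ((x <= x0)%N (+) (x' <= x0)%N), (j < y)%N & jump_curl x0 j].
Proof.
wlog xx' : x x' / (x <= x')%N.
  move=> H h1 h2 h3 h4 h5; have [h|/ltnW h] := leqP x x'; first exact: H.
  rewrite jumpHC (H x' x)// [F x' y (+) F x y]addbC; congr (_ (+) _).
  by apply: eq_bigr => x0 _; apply: eq_bigr => j _; rewrite addbC.
move=> _ h xB x'B yB; have [->|ne] := eqVneq x x'.
  rewrite jumpHxx addbb addFb big1// => x0 _; rewrite big1// => j _.
  by rewrite addbb.
have E : x' = x.+1 by apply/eqP; rewrite eqn_leq h ltn_neqAle ne.
rewrite E in x'B *; rewrite F_H; congr (_ (+) _).
rewrite [RHS](bigD1_seq x) ?mem_index_iota ?iota_uniq//=.
rewrite [X in _ (+) X]big1_seq ?addbF; last first.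
  move=> x0 /andP[ne0 _]; rewrite big1// => j _.
  by rewrite ltn_neqAle eq_sym ne0 /= addbb.
rewrite leqnn ltnn /= [RHS](big_cat_nat (n := y))//= [X in _ (+) X]big1_seq ?addbF.
  by rewrite big_nat_cond [RHS]big_nat_cond; apply: eq_bigr => j /andP[/andP[_ ->]].
by move=> j /andP[_]; rewrite mem_index_iota => /andP[yj _]; rewrite ltnNge yj.
Qed.

(** A mod 2 Stokes formula: along a closed path of cells the jumps add up to the
sum of the curls, each counted with the parity of the number of crossings of
the vertical half-line above it.  So the jumps cancel as soon as this parity
vanishes at each curl. *)
Lemma closed_grid_path_parity (xs ys : nat -> nat) (n : nat) :
  xs 0%N = xs n -> ys 0%N = ys n ->
  (forall i, (i < n)%N -> [/\ (xs i <= (xs i.+1).+1)%N, (xs i.+1 <= (xs i).+1)%N,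
     (ys i <= (ys i.+1).+1)%N & (ys i.+1 <= (ys i).+1)%N]) ->
  (forall x j, jump_curl x j ->
     \big[addb/false]_(0 <= i < n)
        (((xs i <= x)%N (+) (xs i.+1 <= x)%N) && (j < ys i)%N) = false) ->
  \big[addb/false]_(0 <= i < n) (jumpH (xs i) (xs i.+1) (ys i) (+)
      jumpV (xs i.+1) (ys i) (ys i.+1)) = false.
Proof.
move=> x0n y0n st H.
have [B [Bx By]] : exists B, (forall i, (i <= n)%N -> (xs i < B)%N) /\
    (forall i, (i <= n)%N -> (ys i < B)%N).
  elim: n {x0n y0n st H} => [|n [B [B1 B2]]].
    exists (maxn (xs 0%N) (ys 0%N)).+1.
    by split => i; rewrite leqn0 => /eqP ->; rewrite ltnS leq_max leqnn ?orbT.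
  exists (maxn B (maxn (xs n.+1) (ys n.+1)).+1).
  split => i; rewrite leq_eqVlt => /predU1P[->|]; rewrite leq_max.
  - by rewrite ltnS leq_max leqnn orbT.
  - by move=> /B1 ->.
  - by rewrite ltnS leq_max leqnn !orbT.
  - by move=> /B2 ->.
transitivity (\big[addb/false]_(0 <= i < n) ((F (xs i) (ys i) (+) F (xs i.+1) (ys i.+1)) (+)
   \big[addb/false]_(0 <= x0 < B) \big[addb/false]_(0 <= j < B)
      [&& ((xs i <= x0)%N (+) (xs i.+1 <= x0)%N), (j < ys i)%N & jump_curl x0 j])).
  rewrite big_nat_cond [RHS]big_nat_cond; apply: eq_bigr => i /andP[/andP[_ i_n] _].
  have [s1 s2 s3 s4] := st i i_n.
  rewrite (F_H2 s1 s2 (Bx _ (ltnW i_n)) (Bx _ i_n) (ltnW (By _ (ltnW i_n)))).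
  rewrite (F_V _ s3 s4).
  move: (F (xs i) (ys i)) (F (xs i.+1) (ys i)) (F (xs i.+1) (ys i.+1))
    (\big[addb/false]_(0 <= x0 < B) _).
  by do 4 case.
rewrite big_split /= [X in X (+) _ = _](_ : _ = false) ?addFb.
  rewrite exchange_big big1//= => x0 _; rewrite exchange_big big1//= => j _.
  have [c|/negbTE c] := boolP (jump_curl x0 j).
    by rewrite -[RHS](H _ _ c); apply: eq_bigr => i _; rewrite andbT.
  by rewrite big1// => i _; rewrite !andbF.
have tel m : \big[addb/false]_(0 <= i < m) (F (xs i) (ys i) (+) F (xs i.+1) (ys i.+1))
   = F (xs 0%N) (ys 0%N) (+) F (xs m) (ys m).
  elim: m => [|m IH]; first by rewrite big_geq// addbb.
  rewrite big_nat_recr//= IH; 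
  move: (F (xs 0%N) (ys 0%N)) (F (xs m) (ys m)) (F (xs m.+1) (ys m.+1)).
  by do 3 case.
by rewrite tel -x0n -y0n addbb.
Qed.

End GridParity.

(** * Winding parity of null-homotopic loops *)

Section Crossing.
Variable R : realType.
Implicit Types u v q : R[i]^o.

(** Whether the segment from u to v, supposed short and away from 0, crosses the
closed upper half of the imaginary axis. *)
Definition crossing u v : bool :=
  ((complex.Re u < 0) (+) (complex.Re v < 0)) && (0 <= complex.Im u).

(** u is at distance at least r from 0 in the maximum norm. *)
Definition far (r : R) u : bool := (r <= `|complex.Re u|) || (r <= `|complex.Im u|).

(** u and v are at distance less than r in the maximum norm. *)
Definition close (r : R) u v : bool :=
  (`|complex.Re u - complex.Re v| < r) && (`|complex.Im u - complex.Im v| < r).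

(** A set of diameter less than r, at distance at least r from 0, lies on one side
of the imaginary axis or on one side of the real axis. *)
Lemma close_far_dichotomy (S : set R[i]^o) (r : R) :
  (forall u, S u -> far r u) -> (forall u v, S u -> S v -> close r u v) ->
  (forall u v, S u -> S v -> (complex.Re u < 0) = (complex.Re v < 0)) \/
  (forall u v, S u -> S v -> (0 <= complex.Im u) = (0 <= complex.Im v)).
Proof.
move=> Sf Sc.
have [H|H] := pselect (forall u v, S u -> S v -> (complex.Re u < 0) = (complex.Re v < 0)).
  by left.
right.
(* points p and q on both sides of the imaginary axis force every point of S close
   to this axis, hence far from the real one *)
have [p [q [Sp Sq p0 q0]]] : exists p q, [/\ S p, S q, complex.Re p < 0 & 0 <= complex.Re q].
  apply: contrapT => N; apply: H => u v Su Sv.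
  have [u0|u0] := ltP (complex.Re u) 0; have [v0|v0] := ltP (complex.Re v) 0 => //.
    by exfalso; apply: N; exists u, v.
  by exfalso; apply: N; exists v, u.
have im u : S u -> r <= `|complex.Im u|.
  move=> Su; case/orP: (Sf _ Su) => // h.
  have /andP[h1 _] := Sc _ _ Su Sp; have /andP[h2 _] := Sc _ _ Su Sq.
  exfalso; move: h h1 h2; case: (lerP 0 (complex.Re u)) => [u0|u0].
    by rewrite ger0_norm// => h h1 _; have := ler_norm (complex.Re u - complex.Re p); lra.
  by rewrite ltr0_norm// !ltr_norml => h _ /andP[h3 h4]; lra.
move=> u v Su Sv; have iu := im _ Su; have iv := im _ Sv.
have /andP[_] := Sc _ _ Su Sv; rewrite ltr_norml => /andP[h1 h2].
have [u0|u0] := lerP 0 (complex.Im u); have [v0|v0] := lerP 0 (complex.Im v) => //.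
  by move: iu iv; rewrite ger0_norm// ltr0_norm//; lra.
by move: iu iv; rewrite ltr0_norm// ger0_norm//; lra.
Qed.

(** A small quadrilateral away from 0 has winding parity 0. *)
Lemma crossing_cell (r : R) a b c d :
  (forall u, [set a; b; c; d] u -> far r u) ->
  (forall u v, [set a; b; c; d] u -> [set a; b; c; d] v -> close r u v) ->
  crossing a b (+) crossing d c = crossing a d (+) crossing b c.
Proof.
move=> Sf Sc.
have Sa : [set a; b; c; d] a by left; left; left.
have Sb : [set a; b; c; d] b by left; left; right.
have Sc' : [set a; b; c; d] c by left; right.
have Sd : [set a; b; c; d] d by right.
rewrite /crossing; case: (close_far_dichotomy Sf Sc) => H.
  by rewrite (H b a)// (H c a)// (H d a)//; case: (_ < 0).
rewrite (H b a)// (H d a)//.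
by case: (_ < 0); case: (_ < 0); case: (_ < 0); case: (_ < 0); case: (0 <= _).
Qed.

Lemma crossingxx a : crossing a a = false.
Proof. by rewrite /crossing addbb. Qed.

(** Two sequences that follow each other closely, away from 0, have the same
crossing parity up to the contribution of the end points. *)
Lemma crossing_row (r : R) (a b : nat -> R[i]^o) (n : nat) :
  (forall i u, (i < n)%N -> [set a i; a i.+1; b i.+1; b i] u -> far r u) ->
  (forall i u v, (i < n)%N -> [set a i; a i.+1; b i.+1; b i] u ->
      [set a i; a i.+1; b i.+1; b i] v -> close r u v) ->
  \big[addb/false]_(0 <= i < n) crossing (a i) (a i.+1) (+)
  \big[addb/false]_(0 <= i < n) crossing (b i) (b i.+1) =
  crossing (a 0%N) (b 0%N) (+) crossing (a n) (b n).
Proof.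
elim: n => [|n IH] Sf Sc; first by rewrite !big_geq// !addbb.
rewrite !big_nat_recr//=.
have := IH (fun i u i_n => Sf i u (ltnW i_n)) (fun i u v i_n => Sc i u v (ltnW i_n)).
have := crossing_cell (Sf n ^~ (ltnSn n)) (fun u v => Sc n u v (ltnSn n)).
move: (crossing (a n) (a n.+1)) (crossing (b n) (b n.+1)) (crossing (a n) (b n))
  (crossing (a n.+1) (b n.+1)) (crossing (a 0%N) (b 0%N)).
move: (\big[addb/false]_(_ <= _ < _) _) (\big[addb/false]_(_ <= _ < _) _).
by do 7 case.
Qed.

Lemma normc_far (r : R) u : 2 * r <= normc u -> far r u.
Proof.
move=> h; have := normc_le_ReIm u; rewrite /far.
by case: leP => //= h1; case: leP => //= h2; lra.
Qed.

Lemma normc_close (r : R) u v : normc (u - v) < r -> close r u v.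
Proof.
move=> h; rewrite /close -ReB -ImB.
by rewrite (le_lt_trans (Re_le_normc _) h) (le_lt_trans (Im_le_normc _) h).
Qed.

(** A local bound that holds for small i around each point of a compact set holds
for small i uniformly. *)
Lemma compact_uniform (K : set (R * R)) (P : R -> R * R -> Prop) : compact K ->
  (forall x, K x -> exists2 d, 0 < d & forall y i, K y -> `|x.1 - y.1| < d ->
     `|x.2 - y.2| < d -> 0 < i < d -> P i y) ->
  exists2 i0, 0 < i0 & forall i y, 0 < i < i0 -> K y -> P i y.
Proof.
move=> /compact_near_coveringP/near_covering_withinP cK H.
have nK : \forall i \near (0:R)^'+, K `<=` P i.
  apply: cK => x Kx; have [d d0 Hd] := H x Kx.
  exists ([set y | `|x.1 - y.1| < d /\ `|x.2 - y.2| < d], [set i | 0 < i < d]).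
    split => /=.
      by apply/nbhs_ballP; exists d => // y [].
    near=> i; apply/andP; split; near: i; first exact: nbhs_right_gt.
    exact: nbhs_right_lt.
  by move=> [y i] [[/= h1 h2] h3] Ky; apply: Hd.
move: nK => /nbhs_ballP[e /= e0 He]; exists e => // i y /andP[i0 ie] Ky.
by apply: (He i) => //; rewrite /ball /= sub0r normrN gtr0_norm.
Unshelve. all: by end_near. Qed.

Section Homotopy.
Variables (D : set R[i]^o).
Hypothesis oD : open D.

(** A null-homotopic loop in D, finely sampled, has winding parity 0 around every
point outside D.  The mesh can be chosen uniformly in this point. *)
Lemma null_homotopic_parity (g : R -> R[i]^o) : null_homotopic D g ->
  exists N, forall n q, (N <= n)%N -> (0 < n)%N -> ~ D q ->
    \big[addb/false]_(0 <= i < n)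
       crossing (g (i%:R / n%:R) - q) (g (i.+1%:R / n%:R) - q) = false.
Proof.
move=> [H [cH HD H0 H1 Hs]].
pose K : set (R * R) := `[0, 1] `*` `[0, 1].
have cK : compact K by apply: compact_setX; exact: segment_compact.
have HH := within_cont2P cH.
have [e e0 He] : exists2 i0, 0 < i0 & forall i y, 0 < i < i0 -> K y ->
    forall q, ~ D q -> i <= normc (H y - q).
  apply: (compact_uniform (P := fun i y => forall q, ~ D q -> i <= normc (H y - q)))
    => // x Kx.
  have [h h0 hD] : exists2 h, 0 < h & forall y, normc (H x - y) < h -> D y.
    by apply: open_normc => //; apply: HD; exists x.
  have h20 : 0 < h / 2 by lra.
  have [d d0 Hd] := HH x Kx _ h20.
  exists (Num.min d (h / 2)); first by rewrite lt_min d0.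
  move=> y i Ky; rewrite !lt_min => /andP[h1 _] /andP[h2 _] /andP[i0 /andP[_ i1]] q nDq.
  have hq : h <= normc (H x - q) by rewrite leNgt; apply/negP => /hD.
  by have := Hd y Ky h1 h2; have := normc_triangle (H y) (H x) q; lra.
(* e bounds from below the distance of the homotopy to the complement of D *)
pose r := e / 4; have r0 : 0 < r by rewrite /r; lra.
have [d d0 Hd] : exists2 i0, 0 < i0 & forall i y, 0 < i < i0 -> K y ->
    forall y', K y' -> `|y.1 - y'.1| < i -> `|y.2 - y'.2| < i -> normc (H y - H y') < r.
  apply: (compact_uniform (P := fun i y => forall y', K y' -> `|y.1 - y'.1| < i ->
     `|y.2 - y'.2| < i -> normc (H y - H y') < r)) => // x Kx.
  have h0 : 0 < r / 2 by lra.
  have [d d0 Hd] := HH x Kx _ h0.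
  exists (d / 2); first by lra.
  move=> y i Ky h1 h2 /andP[i0 id] y' Ky' h3 h4.
  have A1 : normc (H x - H y) < r / 2 by apply: Hd => //; lra.
  have A2 : normc (H x - H y') < r / 2.
    apply: Hd => //.
      by have := ler_distD y.1 x.1 y'.1; lra.
    by have := ler_distD y.2 x.2 y'.2; lra.
  by have := normc_triangle (H x) (H y) (H y'); rewrite (normcC (H y) (H x)); lra.
exists (Num.truncn (2 / d)).+1 => n q Nn n0 nDq.
have n0' : 0 < n%:R :> R by rewrite ltr0n.
(* on a mesh finer than d the homotopy moves by less than r *)
have nd : n%:R^-1 < d / 2.
  rewrite -[d / 2]invrK ltf_pV2 ?posrE ?invr_gt0 ?divr_gt0// invf_div.
  apply: (lt_le_trans (truncnS_gt _)); by rewrite ler_nat.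
pose a j i := H (j%:R / n%:R, i%:R / n%:R) - q.
have inK j i : (j <= n)%N -> (i <= n)%N -> K (j%:R / n%:R, i%:R / n%:R).
  move=> jn i_n; split; rewrite /= in_itv /= divr_ge0//= ler_pdivrMr// mul1r ler_nat//.
have a_far j i : (j <= n)%N -> (i <= n)%N -> far r (a j i).
  move=> jn i_n; apply: normc_far; apply: He => //; last exact: inK.
  by rewrite /r; apply/andP; split; lra.
have a_close j i j' i' : (j <= n)%N -> (i <= n)%N -> (j' <= n)%N -> (i' <= n)%N ->
    (j <= j'.+1)%N -> (j' <= j.+1)%N -> (i <= i'.+1)%N -> (i' <= i.+1)%N ->
    close r (a j i) (a j' i').
  move=> jn i_n jn' in' h1 h2 h3 h4; apply: normc_close.
  rewrite /a opprB addrA subrK.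
  have near1 k k' : (k <= k'.+1)%N -> (k' <= k.+1)%N ->
      `|k%:R / n%:R - k'%:R / n%:R| < d / 2.
    move=> k1 k2; rewrite -mulrBl normrM (ger0_norm (x := n%:R^-1)) ?invr_ge0 ?ler0n//.
    apply: le_lt_trans nd; rewrite ler_piMl ?invr_ge0 ?ler0n//.
    rewrite ler_norml; move: k1 k2; rewrite -!(ler_nat R) -!natr1 => k1 k2; lra.
  apply: (Hd (d / 2)); [apply/andP; split; lra|exact: inK|exact: inK|exact: near1|exact: near1].
have row j : (j < n)%N -> 
    \big[addb/false]_(0 <= i < n) crossing (a j i) (a j i.+1) =
    \big[addb/false]_(0 <= i < n) crossing (a j.+1 i) (a j.+1 i.+1).
  move=> jn.
  have := @crossing_row r (a j) (a j.+1) n.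
  have -> : a j 0%N = a j.+1 0%N.
    have [A1 _] := Hs (j%:R / n%:R) (ltac:(by case: (inK j 0%N (ltnW jn) (leq0n _)))).
    have [A2 _] := Hs (j.+1%:R / n%:R) (ltac:(by case: (inK j.+1 0%N jn (leq0n _)))).
    by rewrite /a mul0r A1 A2.
  have -> : a j n = a j.+1 n.
    have [_ A1] := Hs (j%:R / n%:R) (ltac:(by case: (inK j 0%N (ltnW jn) (leq0n _)))).
    have [_ A2] := Hs (j.+1%:R / n%:R) (ltac:(by case: (inK j.+1 0%N jn (leq0n _)))).
    by rewrite /a divff ?gt_eqF// A1 A2.
  rewrite !crossingxx => E.
  have {}E : \big[addb/false]_(0 <= i < n) crossing (a j i) (a j i.+1) (+)
      \big[addb/false]_(0 <= i < n) crossing (a j.+1 i) (a j.+1 i.+1) = false.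
    apply: E.
      move=> i u i_n [[[]|]|] ->; apply: a_far => //; exact: ltnW.
    have jn' := ltnW jn.
    by move=> i u v i_n; have i_n' := ltnW i_n;
      move=> [[[]|]|] -> [[[]|]|] ->; apply: a_close => //; lia.
  by move: E; case: (\big[addb/false]_(0 <= i < n) _);
    case: (\big[addb/false]_(0 <= i < n) _).
have all_rows j : (j <= n)%N ->
    \big[addb/false]_(0 <= i < n) crossing (a 0%N i) (a 0%N i.+1) =
    \big[addb/false]_(0 <= i < n) crossing (a j i) (a j i.+1).
  by elim: j => [//|j IH] jn; exact: etrans (IH (ltnW jn)) (row j jn).
have in01 i : (i <= n)%N -> (i%:R / n%:R : R) \in `[0, 1].
  by move=> i_n; case: (inK 0%N i (leq0n _) i_n).
transitivity (\big[addb/false]_(0 <= i < n) crossing (a 0%N i) (a 0%N i.+1)).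
  rewrite big_nat_cond [RHS]big_nat_cond; apply: eq_bigr => i /andP[/andP[_ i_n] _].
  by rewrite /a mul0r !H0 ?in01// ltnW.
apply: (etrans (all_rows n (leqnn n))); rewrite big_nat_cond big1// => i /andP[/andP[_ i_n] _].
by rewrite /a divff ?gt_eqF// !H1 ?in01// ?crossingxx// ltnW.
Qed.
End Homotopy.
End Crossing.

(** * A square grid in the plane *)

Section Grid.
Variables (R : realType) (w : R[i]^o) (s : R) (Z : nat).
Hypothesis s0 : 0 < s.
Implicit Types u v : R[i]^o.

(** Coordinates in the grid of side s in which w has both coordinates equal to Z;
Z is taken large enough for all points in use to have nonnegative coordinates. *)
Definition gridx u : R := (complex.Re u - complex.Re w) / s + Z%:R.
Definition gridy u : R := (complex.Im u - complex.Im w) / s + Z%:R.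
(** The column, and below the row, of the cell containing u, as long as its grid
coordinates are nonnegative. *)
Definition cellx u : nat := Num.truncn (gridx u).
Definition celly u : nat := Num.truncn (gridy u).
(** The upper right corner of the cell (x, y). *)
Definition corner (x y : nat) : R[i]^o :=
  Complex (complex.Re w + (x%:R + 1 - Z%:R) * s) (complex.Im w + (y%:R + 1 - Z%:R) * s).
(** The center of the cell (x, y). *)
Definition center (x y : nat) : R[i]^o :=
  Complex (complex.Re w + (x%:R + 1 / 2 - Z%:R) * s)
    (complex.Im w + (y%:R + 1 / 2 - Z%:R) * s).

Lemma gridxE u : complex.Re u = complex.Re w + (gridx u - Z%:R) * s.
Proof. by rewrite /gridx addrK divfK ?gt_eqF// addrC subrK. Qed.

Lemma gridyE u : complex.Im u = complex.Im w + (gridy u - Z%:R) * s.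
Proof. by rewrite /gridy addrK divfK ?gt_eqF// addrC subrK. Qed.

Lemma cellx_itv u : 0 <= gridx u -> (cellx u)%:R <= gridx u < (cellx u)%:R + 1.
Proof. by move=> h; have := truncn_itv h; rewrite -natr1. Qed.

Lemma celly_itv u : 0 <= gridy u -> (celly u)%:R <= gridy u < (celly u)%:R + 1.
Proof. by move=> h; have := truncn_itv h; rewrite -natr1. Qed.

Lemma normc_ReIm_le u v (a b : R) : `|complex.Re u - complex.Re v| <= a ->
  `|complex.Im u - complex.Im v| <= b -> normc (u - v) <= a + b.
Proof.
by move=> h1 h2; apply: le_trans (normc_le_ReIm _) _; rewrite ReB ImB lerD.
Qed.

Lemma norm_scale (a c : R) : `|a| <= c -> `|a * s| <= c * s.
Proof. by move=> h; rewrite normrM (gtr0_norm s0) ler_pM2r. Qed.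

Lemma center_near u : 0 <= gridx u -> 0 <= gridy u ->
  normc (u - center (cellx u) (celly u)) <= s.
Proof.
move=> /cellx_itv/andP[x1 x2] /celly_itv/andP[y1 y2].
have -> : s = 1 / 2 * s + 1 / 2 * s by field.
apply: normc_ReIm_le => /=.
  rewrite gridxE opprD addrACA subrr add0r -mulrBl norm_scale// ler_norml; apply/andP; split; lra.
rewrite gridyE opprD addrACA subrr add0r -mulrBl norm_scale// ler_norml; apply/andP; split; lra.
Qed.

Lemma center_corner x y x' y' : (x <= x' <= x.+1)%N -> (y <= y' <= y.+1)%N ->
  normc (center x' y' - corner x y) <= s.
Proof.
rewrite -!(ler_nat R) -!natr1 => /andP[x1 x2] /andP[y1 y2].
have -> : s = 1 / 2 * s + 1 / 2 * s by field.
apply: normc_ReIm_le => /=.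
  rewrite opprD addrACA subrr add0r -mulrBl norm_scale// ler_norml; apply/andP; split; lra.
rewrite opprD addrACA subrr add0r -mulrBl norm_scale// ler_norml; apply/andP; split; lra.
Qed.

Lemma center_stepx x y : normc (center x y - center x.+1 y) = s.
Proof.
rewrite /center -[x.+1%:R]natr1; set a := complex.Re w; set b := complex.Im w.
have -> : Complex (a + (x%:R + 1 / 2 - Z%:R) * s) (b + (y%:R + 1 / 2 - Z%:R) * s) -
   Complex (a + (x%:R + 1 + 1 / 2 - Z%:R) * s) (b + (y%:R + 1 / 2 - Z%:R) * s) =
   Complex (- s) 0 :> R[i]^o.
  by apply/eqP; rewrite eq_complex /=; apply/andP; split; apply/eqP; ring.
by rewrite /= expr0n addr0 sqrrN sqrtr_sqr gtr0_norm.
Qed.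

Lemma center_stepy x y : normc (center x y - center x y.+1) = s.
Proof.
rewrite /center -[y.+1%:R]natr1; set a := complex.Re w; set b := complex.Im w.
have -> : Complex (a + (x%:R + 1 / 2 - Z%:R) * s) (b + (y%:R + 1 / 2 - Z%:R) * s) -
   Complex (a + (x%:R + 1 / 2 - Z%:R) * s) (b + (y%:R + 1 + 1 / 2 - Z%:R) * s) =
   Complex 0 (- s) :> R[i]^o.
  by apply/eqP; rewrite eq_complex /=; apply/andP; split; apply/eqP; ring.
by rewrite /= expr0n add0r sqrrN sqrtr_sqr gtr0_norm.
Qed.

Lemma grid_lt u v : normc (u - v) < s ->
  gridx u < gridx v + 1 /\ gridy u < gridy v + 1.
Proof.
move=> h; have h1 := le_lt_trans (Re_le_normc _) h.
have h2 := le_lt_trans (Im_le_normc _) h.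
rewrite ReB ltr_norml in h1; rewrite ImB ltr_norml in h2.
rewrite (gridxE u) (gridxE v) in h1; rewrite (gridyE u) (gridyE v) in h2.
move: h1 h2 => /andP[_ h1] /andP[_ h2]; split; rewrite -(ltr_pM2r s0); lra.
Qed.

Lemma cell_step u v : normc (u - v) < s -> 0 <= gridx u -> 0 <= gridy u ->
  0 <= gridx v -> 0 <= gridy v ->
  (cellx u <= (cellx v).+1)%N /\ (celly u <= (celly v).+1)%N.
Proof.
move=> /grid_lt[h1 h2] /cellx_itv/andP[a1 a2] /celly_itv/andP[b1 b2]
  /cellx_itv/andP[c1 c2] /celly_itv/andP[d1 d2].
split; rewrite -ltnS -(ltr_nat R) -!natr1; lra.
Qed.

Lemma cellx_corner u x y : 0 <= gridx u ->
  (cellx u <= x)%N = (complex.Re (u - corner x y) < 0).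
Proof.
move=> /cellx_itv/andP[a1 a2]; rewrite ReB /= gridxE opprD addrACA subrr add0r -mulrBl.
rewrite pmulr_llt0//; apply/idP/idP => h.
  by move: h; rewrite -(ler_nat R); lra.
by rewrite -ltnS -(ltr_nat R) -natr1; lra.
Qed.

Lemma celly_corner u x y : 0 <= gridy u ->
  (y < celly u)%N = (0 <= complex.Im (u - corner x y)).
Proof.
move=> /celly_itv/andP[a1 a2]; rewrite ImB /= gridyE opprD addrACA subrr add0r -mulrBl.
rewrite pmulr_lge0//; apply/idP/idP => h.
  by move: h; rewrite -(ler_nat R) -natr1; lra.
by rewrite -ltnS -(ltr_nat R) -!natr1; lra.
Qed.

Lemma corner_far (B x y : nat) : (B <= Z)%N ->
  [|| (x < Z - B)%N, (Z + B <= x.+1)%N, (y < Z - B)%N | (Z + B <= y.+1)%N] ->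
  B%:R * s <= normc (corner x y - w).
Proof.
move=> BZ.
have key (a : nat) : (a < Z - B)%N || (Z + B <= a.+1)%N -> 
    B%:R * s <= `|(a%:R + 1 - Z%:R) * s|.
  move=> h; rewrite normrM (gtr0_norm s0) ler_pM2r//.
  case/orP: h => h.
    have : (a.+1 + B <= Z)%N by lia.
    rewrite -(ler_nat R) natrD -natr1 => h'; have B0 : 0 <= B%:R :> R by []; rewrite ler0_norm; lra.
  move: h; rewrite -(ler_nat R) natrD -natr1 => h'.
  by apply: le_trans (ler_norm _); lra.
move=> /or4P h.
have [hx|hy] : ((x < Z - B) || (Z + B <= x.+1))%N \/ ((y < Z - B) || (Z + B <= y.+1))%N.
  by case: h => ->; [left|left; rewrite orbT|right|right; rewrite orbT].
- apply: le_trans (key x hx) (le_trans _ (Re_le_normc _)).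
  by rewrite ReB /= [complex.Re w + _]addrC addrK.
- apply: le_trans (key y hy) (le_trans _ (Im_le_normc _)).
  by rewrite ImB /= [complex.Im w + _]addrC addrK.
Qed.

Lemma cell_in_box (B : nat) u : (B <= Z)%N -> normc (u - w) <= (B%:R - 1) * s ->
  [/\ (Z - B <= cellx u)%N, (cellx u < Z + B)%N,
      (Z - B <= celly u)%N & (celly u < Z + B)%N].
Proof.
move=> BZ h; have h1 := le_trans (Re_le_normc _) h.
have h2 := le_trans (Im_le_normc _) h.
rewrite ReB gridxE addrAC subrr add0r normrM (gtr0_norm s0) ler_pM2r// ler_norml in h1.
rewrite ImB gridyE addrAC subrr add0r normrM (gtr0_norm s0) ler_pM2r// ler_norml in h2.
move: (BZ); rewrite -(ler_nat R) => BZ'.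
have B0 : 0 <= B%:R :> R by rewrite ler0n.
have gx : 0 <= gridx u by lra.
have gy : 0 <= gridy u by lra.
have /andP[a1 a2] := cellx_itv gx; have /andP[b1 b2] := celly_itv gy.
split.
- have : (Z < (cellx u).+1 + B)%N by rewrite -(ltr_nat R) natrD -natr1; lra.
  by rewrite addSn ltnS leq_subLR addnC.
- by rewrite -(ltr_nat R) natrD; lra.
- have : (Z < (celly u).+1 + B)%N by rewrite -(ltr_nat R) natrD -natr1; lra.
  by rewrite addSn ltnS leq_subLR addnC.
- by rewrite -(ltr_nat R) natrD; lra.
Qed.

End Grid.

(** * The component of the good cells of a box *)

Section Component.
Variables (R : realType) (D : set R[i]^o) (w : R[i]^o) (s : R) (Z B : nat).
Hypotheses (D0 : D !=set0) (oD : open D) (bD : bounded_set D).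
Hypotheses (s0 : 0 < s) (B0 : (0 < B)%N) (BZ : (B < Z)%N).

Local Notation ctr := (center w s Z).

(** The cells whose center is in D, at distance at least 4 s from the boundary. *)
Definition good_cell (x y : nat) : bool :=
  `[< D (ctr x y) /\ 4 * s <= delta D (ctr x y) >].

(** The cells of the square box of half-width B around w. *)
Definition in_box (x y : nat) : bool :=
  [&& (Z - B <= x)%N, (x < Z + B)%N, (Z - B <= y)%N & (y < Z + B)%N].

Let T : finType := ('I_(B + B) * 'I_(B + B))%type.
Let px (p : T) : nat := (Z - B + p.1)%N.
Let py (p : T) : nat := (Z - B + p.2)%N.

(** The two cells share a side. *)
Definition cell_adjacent (x y x' y' : nat) : bool :=
  ((x == x') && ((y' == y.+1) || (y == y'.+1))) ||
  ((y == y') && ((x' == x.+1) || (x == x'.+1))).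

Let e : rel T := fun p q => [&& good_cell (px p) (py p), good_cell (px q) (py q) &
  cell_adjacent (px p) (py p) (px q) (py q)].

Let Bord : (B < B + B)%N. Proof. by rewrite -[X in (X < _)%N]addn0 ltn_add2l. Qed.

Let c0 : T := (Ordinal Bord, Ordinal Bord).

(** The cells of the box that are joined to the cell of w by a path of good cells
in the box. *)
Definition base_component (x y : nat) : bool :=
  [exists p : T, [&& connect e c0 p, px p == x & py p == y]].

Let px_c0 : px c0 = Z.
Proof. by rewrite /px /= subnK// ltnW. Qed.

Let py_c0 : py c0 = Z.
Proof. by rewrite /py /= subnK// ltnW. Qed.

Lemma base_component0 : base_component Z Z.
Proof. by apply/existsP; exists c0; rewrite connect0 px_c0 py_c0 !eqxx. Qed.

Let ord_of (x : nat) : (Z - B <= x)%N -> (x < Z + B)%N ->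
  exists i : 'I_(B + B), (Z - B + i)%N = x.
Proof.
move=> h1 h2; have lt : (x - (Z - B) < B + B)%N.
  by rewrite ltn_subLR// addnA subnK// ltnW.
by exists (Ordinal lt); rewrite /= addnC subnK.
Qed.

Lemma base_component_step x y x' y' : base_component x y -> in_box x' y' ->
  good_cell x y -> good_cell x' y' -> cell_adjacent x y x' y' ->
  base_component x' y'.
Proof.
move=> /existsP[p /and3P[cp /eqP px_ /eqP py_]] /and4P[h1 h2 h3 h4] g g' a.
have [i iE] := ord_of h1 h2; have [j jE] := ord_of h3 h4.
apply/existsP; exists (i, j); rewrite /px /py /= iE jE !eqxx !andbT.
apply: (connect_trans cp); apply: connect1.
by rewrite /e /px /py /= iE jE; rewrite -/(px p) -/(py p) px_ py_ g g' a.
Qed.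

Let adjacent_dist x y x' y' : cell_adjacent x y x' y' ->
  normc (ctr x y - ctr x' y') = s.
Proof.
case/orP => /andP[/eqP-> /orP[]/eqP->].
- exact: center_stepy.
- by rewrite normcC; exact: center_stepy.
- exact: center_stepx.
- by rewrite normcC; exact: center_stepx.
Qed.

(** A path of cells without repetition has at most as many steps as the box has
cells, and each of them is a chain step. *)
Lemma base_component_qle x y : D (ctr Z Z) -> base_component x y ->
  qle D (ctr Z Z) (ctr x y) (((B + B) * (B + B))%:R / 4).
Proof.
move=> DZ /existsP[p /and3P[/connectP[q pq ->] /eqP <- /eqP <-]].
have -> : ctr Z Z = ctr (px c0) (py c0) by rewrite px_c0 py_c0.
case/shortenP: pq => q' pq' uq' _.
apply: (@qle_mono _ _ ((size q')%:R / 4)).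
  rewrite ler_pM2r ?invr_gt0// ler_nat.
  have /card_uniqP := uq'; rewrite /= => E.
  have := max_card (mem (c0 :: q')); rewrite E card_prod !card_ord; exact: ltnW.
have : D (ctr (px c0) (py c0)) by rewrite px_c0 py_c0.
elim: q' c0 pq' {uq'} => [|b q' IH] a /=; first by rewrite mul0r => _ Da; exact: qle_refl.
move=> /andP[/and3P[/asboolP[Da da] /asboolP[Db db] ab] pq'] _.
rewrite -natr1 mulrDl addrC; apply: qle_trans (IH b pq' Db).
have w_le : qweight D (ctr (px a) (py a)) (ctr (px b) (py b)) <= 1 / 4.
  have m0 := qmin_gt0 D0 oD bD Da Db.
  rewrite /qweight (adjacent_dist ab) ler_pdivrMr//.
  have : 4 * s <= Num.min (delta D (ctr (px a) (py a))) (delta D (ctr (px b) (py b))).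
    by rewrite le_min da db.
  lra.
exact: qle_mono w_le (qle_weight Da Db w_le).
Qed.

Local Notation curl := (jump_curl base_component in_box).

(** A curl of the component sits on the rim of the box, because inside the box the
jumps are the coboundary of the indicator function of the component. *)
Lemma curl_on_rim x y : curl x y ->
  [|| (x < Z - B)%N, (Z + B <= x.+1)%N, (y < Z - B)%N | (Z + B <= y.+1)%N].
Proof.
move=> c; apply/contraT => N.
have [h1 h2 h3 h4] : [/\ (Z - B <= x)%N, (x.+1 < Z + B)%N, (Z - B <= y)%N & (y.+1 < Z + B)%N].
  by move: N; rewrite !negb_or -!leqNgt -!ltnNge => /and4P[].
have hQ a b : (x <= a <= x.+1)%N -> (y <= b <= y.+1)%N -> in_box a b.
  move=> /andP[a1 a2] /andP[b1 b2]; apply/and4P; split.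
  - exact: leq_trans a1.
  - exact: leq_ltn_trans h2.
  - exact: leq_trans b1.
  - exact: leq_ltn_trans h4.
move: c; rewrite /jump_curl /jumpV /jumpH !hQ ?leqnn ?leqnSn//=.
by case: (base_component x y); case: (base_component x.+1 y);
  case: (base_component x y.+1); case: (base_component x.+1 y.+1).
Qed.

(** A curl of the component is a corner of a cell that is not good, as the
component absorbs the good neighbours of its good cells. *)
Lemma curl_bad_cell x y : curl x y -> exists a b,
  [/\ (x <= a <= x.+1)%N, (y <= b <= y.+1)%N & ~~ good_cell a b].
Proof.
have jump a b a' b' : in_box a b -> in_box a' b' -> cell_adjacent a b a' b' ->
    base_component a b (+) base_component a' b' ->
    ~~ good_cell a b \/ ~~ good_cell a' b'.
  move=> q q' ad; have [g|] := boolP (good_cell a b); last by left.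
  have [g'|] := boolP (good_cell a' b'); last by right.
  have ad' : cell_adjacent a' b' a b.
    by move: ad; rewrite /cell_adjacent ![_ == a']eq_sym ![_ == b']eq_sym orbC;
      case/orP => /andP[/eqP-> /orP[]->]; rewrite ?eqxx ?orbT.
  have [v|v] := boolP (base_component a b); have [v'|v'] := boolP (base_component a' b') => //.
    by move: v'; rewrite (base_component_step v q' g g' ad).
  by move: v; rewrite (base_component_step v' q g' g ad').
rewrite /jump_curl => c.
have [j|[j|[j|j]]] : jumpV base_component in_box x y y.+1 \/
    jumpV base_component in_box x.+1 y y.+1 \/
    jumpH base_component in_box x x.+1 y \/ jumpH base_component in_box x x.+1 y.+1.
  move: c; case: (jumpV _ _ x y y.+1); first by left.
  case: (jumpV _ _ x.+1 y y.+1); first by right; left.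
  case: (jumpH _ _ x x.+1 y); first by right; right; left.
  by case: (jumpH _ _ x x.+1 y.+1) => // _; right; right; right.
- case/and3P: j => q q' v; have [|h|h] := jump _ _ _ _ q q' _ v.
  + by rewrite /cell_adjacent !eqxx.
  + by exists x, y; rewrite !leqnn !leqnSn.
  + by exists x, y.+1; rewrite !leqnn !leqnSn.
- case/and3P: j => q q' v; have [|h|h] := jump _ _ _ _ q q' _ v.
  + by rewrite /cell_adjacent !eqxx.
  + by exists x.+1, y; rewrite !leqnn !leqnSn.
  + by exists x.+1, y.+1; rewrite !leqnn !leqnSn.
- case/and3P: j => q q' v; have [|h|h] := jump _ _ _ _ q q' _ v.
  + by rewrite /cell_adjacent !eqxx orbT.
  + by exists x, y; rewrite !leqnn !leqnSn.
  + by exists x.+1, y; rewrite !leqnn !leqnSn.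
- case/and3P: j => q q' v; have [|h|h] := jump _ _ _ _ q q' _ v.
  + by rewrite /cell_adjacent !eqxx orbT.
  + by exists x, y.+1; rewrite !leqnn !leqnSn.
  + by exists x.+1, y.+1; rewrite !leqnn !leqnSn.
Qed.

Lemma curl_near_out x y : curl x y ->
  exists2 q, ~ D q & normc (corner w s Z x y - q) <= 5 * s.
Proof.
move=> /curl_bad_cell[a [b [ha hb /asboolPn N]]].
have cc := center_corner w Z s0 ha hb; rewrite normcC in cc.
have [Dc|nDc] := pselect (D (ctr a b)); last first.
  by exists (ctr a b) => //; apply: (le_trans cc); have := s0; lra.
have dl : delta D (ctr a b) < 4 * s.
  by rewrite ltNge; apply/negP => h; apply: N.
have [q nDq hq] := delta_near_out D0 oD bD dl.
exists q => //; apply: le_trans (normc_triangle (ctr a b) _ _) _; lra.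
Qed.

End Component.

(** * Shortcuts in a simply connected domain *)

Section Loop.
Variables (R : realType) (D : set R[i]^o).
Hypotheses (D0 : D !=set0) (oD : open D) (bD : bounded_set D).

Lemma good_cell_near (w : R[i]^o) (s : R) (Z : nat) u : 0 < s -> D u ->
  6 * s <= delta D u -> 0 <= gridx w s Z u -> 0 <= gridy w s Z u ->
  good_cell D w s Z (cellx w s Z u) (celly w s Z u).
Proof.
move=> s0 Du du gx gy; have h := center_near s0 gx gy.
apply/asboolP; split.
  by apply: (delta_ball D0 oD bD Du); lra.
have := delta_lip D0 oD bD u (center w s Z (cellx w s Z u) (celly w s Z u)); lra.
Qed.

Lemma component_const (w : R[i]^o) (s : R) (Z B : nat) (B0 : (0 < B)%N)
    x y x' y' : (B < Z)%N ->
  in_box Z B x y -> in_box Z B x' y' ->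
  good_cell D w s Z x y -> good_cell D w s Z x' y' ->
  (x, y) = (x', y') \/ cell_adjacent x y x' y' ->
  base_component D w s Z B0 x y = base_component D w s Z B0 x' y'.
Proof.
move=> BZ q q' g g' [[-> ->]//|ad].
have ad' : cell_adjacent x' y' x y.
  by move: ad; rewrite /cell_adjacent ![_ == x']eq_sym ![_ == y']eq_sym orbC;
    case/orP => /andP[/eqP-> /orP[]->]; rewrite ?eqxx ?orbT.
apply/idP/idP => v; first exact: base_component_step v q' g g' ad.
exact: base_component_step v q g' g ad'.
Qed.

Lemma near_nat (a b : nat) : (a <= b.+1)%N -> (b <= a.+1)%N ->
  a = b \/ (b == a.+1) || (a == b.+1).
Proof.
move=> h1 h2; have [ab|ba|->] := ltngtP a b; last by left.
  by right; rewrite eqn_leq h2 ab.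
by right; rewrite [a == _]eqn_leq h1 ba orbT.
Qed.

Lemma addb_big_telescope (v : nat -> bool) (m n : nat) : (m <= n)%N ->
  \big[addb/false]_(m <= i < n) (v i (+) v i.+1) = v m (+) v n.
Proof.
elim: n => [|n IH]; first by rewrite leqn0 => /eqP ->; rewrite big_geq// addbb.
rewrite leq_eqVlt => /predU1P[->|mn]; first by rewrite big_geq// addbb.
rewrite big_nat_recr//= IH//; by case: (v m); case: (v n); case: (v n.+1).
Qed.

Lemma close_translates (r : R) (u v p q : R[i]^o) : normc (u - v) < r ->
  normc (p - q) <= 5 * r -> close (6 * r) (u - p) (v - q).
Proof.
move=> uv pq; apply: normc_close.
have -> : u - p - (v - q) = (u - v) - (p - q).
  by rewrite !opprB (addrACA u (- p) q) (addrACA u (- v) q) [- p - v]addrC.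
by apply: le_lt_trans (le_normcD _ _) _; rewrite normcN; lra.
Qed.

(** The first part of the loop f, up to time T1, stays away from the boundary but
can be arbitrarily long; the second part is only known to stay in a box around
f 0.  The cost of joining the ends of the first part depends on the size of
the box only. *)
Lemma loop_bottleneck (f : R -> R[i]^o) (T T1 s : R) (B : nat) :
  simply_connected D -> lip_curve D T f -> 0 <= T1 <= T -> f 0 = f T -> 0 < s ->
  (forall t, 0 <= t <= T1 -> 20 * s <= delta D (f t)) ->
  (forall t, T1 <= t <= T -> normc (f t - f 0) <= (B%:R - 20) * s) ->
  qle D (f 0) (f T1) (((B + B) * (B + B))%:R / 4 + 2).
Proof.
move=> scD cf /andP[T10 T1T] f0T s0 Hgam Halp.
have [T0 fD fl] := cf.
(* Z is large enough for the box and the loop to have positive grid coordinates *)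
pose w := f 0; pose Z := (B + Num.truncn (T / s)).+2.
have Ts0 : 0 <= T / s by rewrite divr_ge0// ltW.
have TsZ : T / s <= Z%:R.
  apply: le_trans (ltW (truncnS_gt _)) _; rewrite ler_nat /Z ltnS.
  exact: leq_trans (leq_addl _ _) (leqnSn _).
have BZ : (B < Z)%N by rewrite /Z ltnS (leq_trans (leq_addr _ _) (leqnSn _)).
have B20 : 20 <= B%:R :> R.
  have := Halp T; rewrite T1T lexx -f0T normcxx => /(_ isT).
  by rewrite pmulr_lge0// subr_ge0.
have B0 : (0 < B)%N by rewrite -(ltr_nat R); lra.
have TsE : T = T / s * s by rewrite divfK// gt_eqF.
have grid0 t : 0 <= t <= T -> 0 <= gridx w s Z (f t) /\ 0 <= gridy w s Z (f t).
  move=> tT; have := fl t 0 tT; rewrite lexx T0 subr0 => /(_ isT) h.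
  have [t0 tT'] := andP tT; rewrite ger0_norm// in h.
  have h1 := le_trans (Re_le_normc _) h; have h2 := le_trans (Im_le_normc _) h.
  rewrite ReB ler_norml in h1; rewrite ImB ler_norml in h2.
  have [{}h1 _] := andP h1; have [{}h2 _] := andP h2.
  rewrite /gridx /gridy; split.
    rewrite -lerBlDr sub0r ler_pdivlMr// mulNr.
    have : T / s * s <= Z%:R * s by rewrite ler_pM2r.
    by rewrite -TsE /w; lra.
  rewrite -lerBlDr sub0r ler_pdivlMr// mulNr.
  have : T / s * s <= Z%:R * s by rewrite ler_pM2r.
  by rewrite -TsE /w; lra.
pose g (t : R) := f (t * T).
have gin t : t \in `[0, 1] -> 0 <= t * T <= T.
  by rewrite in_itv /= => /andP[t0 t1]; rewrite mulr_ge0//= ler_piMl.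
have nh : null_homotopic D g.
  apply: scD.
  - apply/within_contP => t tI ep ep0.
    exists (ep / (T + 1)); first by rewrite divr_gt0//; lra.
    move=> u uI tu; apply: le_lt_trans (fl _ _ (gin _ tI) (gin _ uI)) _.
    rewrite -mulrBl normrM (ger0_norm T0).
    move: tu; rewrite ltr_pdivlMr; last by lra.
    by rewrite mulrDr mulr1; have := normr_ge0 (t - u); lra.
  - by move=> _ [t /= tI <-]; apply: fD; exact: gin.
  - by rewrite /g mul0r mul1r.
have [N HN] := null_homotopic_parity oD nh.
pose n := maxn N (Num.truncn (T / s)).+1.
have n0 : (0 < n)%N by rewrite /n leq_max ltn0Sn orbT.
have Nn : (N <= n)%N by rewrite /n leq_max leqnn.
have n0' : 0 < n%:R :> R by rewrite ltr0n.
have Tn : T / n%:R < s.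
  rewrite ltr_pdivrMr// mulrC -ltr_pdivrMr//.
  apply: (lt_le_trans (truncnS_gt _)); rewrite ler_nat /n leq_max leqnn orbT//.
pose t_ (i : nat) : R := i%:R / n%:R * T.
pose u i := f (t_ i).
have t_in i : (i <= n)%N -> 0 <= t_ i <= T.
  move=> i_n; apply: gin; rewrite in_itv /= divr_ge0//= ler_pdivrMr// mul1r ler_nat//.
have uD i : (i <= n)%N -> D (u i) by move=> i_n; apply: fD; exact: t_in.
have u0 : u 0%N = w by rewrite /u /t_ !mul0r.
have t_n : t_ n = T by rewrite /t_ divff ?gt_eqF// mul1r.
have un : u n = w by rewrite /u t_n -f0T.
have ustep i : (i < n)%N -> normc (u i - u i.+1) < s.
  move=> i_n; apply: le_lt_trans (fl _ _ (t_in _ (ltnW i_n)) (t_in _ i_n)) _.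
  have -> : t_ i - t_ i.+1 = - (T / n%:R).
    by rewrite /t_ -[i.+1%:R]natr1; field; rewrite gt_eqF.
  by rewrite normrN ger0_norm// divr_ge0// ltW.
have ug i : (i <= n)%N -> 0 <= gridx w s Z (u i) /\ 0 <= gridy w s Z (u i).
  by move=> i_n; apply: grid0; exact: t_in.
pose xs i := cellx w s Z (u i); pose ys i := celly w s Z (u i).
(* v i makes the step from u i to u i.+1 horizontal, then vertical *)
pose v i : R[i]^o := Complex (complex.Re (u i.+1)) (complex.Im (u i)).
have vu i : (i < n)%N -> normc (v i - u i) < s.
  move=> i_n; apply: le_lt_trans (ustep i i_n).
  have := Re_le_normc (u i - u i.+1).
  rewrite /v ReB distrC; apply: le_trans.
  apply: le_trans (normc_le_ReIm _) _.
  by rewrite ReB ImB /= subrr normr0 addr0.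
have vg i : (i < n)%N -> 0 <= gridx w s Z (v i) /\ 0 <= gridy w s Z (v i).
  by move=> i_n; split; [case: (ug i.+1 i_n)|case: (ug i (ltnW i_n))].
have steps i : (i < n)%N -> [/\ (xs i <= (xs i.+1).+1)%N, (xs i.+1 <= (xs i).+1)%N,
     (ys i <= (ys i.+1).+1)%N & (ys i.+1 <= (ys i).+1)%N].
  move=> i_n; have [g1 g2] := ug i (ltnW i_n); have [g3 g4] := ug i.+1 i_n.
  have h := ustep i i_n; have h' := h; rewrite normcC in h'.
  have [a1 a2] := cell_step s0 h g1 g2 g3 g4.
  by have [a3 a4] := cell_step s0 h' g3 g4 g1 g2.
pose V := base_component D w s Z B0.
pose Q := in_box Z B.
have Q0 x : Q x 0%N = false.
  by apply/negP => /and4P[_ _ h _]; move: h; rewrite leqn0 subn_eq0 leqNgt BZ.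
(* the loop has winding parity 0 around each curl: the curl k is within 5 s of a
   point q outside D, and both are at distance at least 12 s from the loop *)
have no_wind x j : jump_curl V Q x j ->
    \big[addb/false]_(0 <= i < n)
        (((xs i <= x)%N (+) (xs i.+1 <= x)%N) && (j < ys i)%N) = false.
  move=> c; have [q nDq kq] := curl_near_out D0 oD bD s0 BZ c.
  have kfar := corner_far w s0 (ltnW BZ) (curl_on_rim c).
  set k := corner w s Z x j in kq kfar.
  transitivity (\big[addb/false]_(0 <= i < n) crossing (u i - k) (u i.+1 - k)).
    rewrite big_nat_cond [RHS]big_nat_cond; apply: eq_bigr => i /andP[/andP[_ i_n] _].
    have [g1 g2] := ug i (ltnW i_n); have [g3 _] := ug i.+1 i_n.
    by rewrite /crossing /xs /ys (cellx_corner s0 x j g1) (cellx_corner s0 x j g3)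
      (celly_corner s0 x j g2).
  have far_q i : (i <= n)%N -> 12 * s <= normc (u i - k) /\ 12 * s <= normc (u i - q).
    move=> i_n; have tin := t_in i i_n; have [t0 tT] := andP tin.
    have tri := normc_triangle k (u i) q; have tri' := normc_triangle q (u i) k.
    rewrite (normcC q k) in tri'.
    have [tg|/ltW ta] := leP (t_ i) T1.
      have h1 := Hgam (t_ i); rewrite t0 tg in h1; have {}h1 := h1 isT.
      by have := delta_le_out D0 oD bD (uD i i_n) nDq; rewrite -/(u i) in h1; lra.
    have h1 := Halp (t_ i); rewrite ta tT -/w -/(u i) in h1; have {}h1 := h1 isT.
    have := normc_triangle (u i) k w; rewrite (normcC k (u i)) => h2.
    have E : (B%:R - 20) * s = B%:R * s - 20 * s by ring.
    by rewrite E in h1; lra.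
  have par_q : \big[addb/false]_(0 <= i < n) crossing (u i - q) (u i.+1 - q) = false.
    exact: HN n q Nn n0 nDq.
  have row := @crossing_row _ (6 * s) (fun i => u i - k) (fun i => u i - q) n.
  rewrite /= par_q u0 un addbb addbF in row; apply: row.
    move=> i z i_n zin; apply: normc_far.
    have [a1 a2] := far_q i (ltnW i_n); have [a3 a4] := far_q i.+1 i_n.
    by case: zin => [[[]|]|] ->; lra.
  move=> i z z' i_n zin zin'.
  have st := ustep i i_n; have st' := st; rewrite normcC in st'.
  have ii : normc (u i - u i) < s by rewrite normcxx.
  have jj : normc (u i.+1 - u i.+1) < s by rewrite normcxx.
  have kk : normc (k - k) <= 5 * s by rewrite normcxx mulr_ge0// ltW.
  have qq : normc (q - q) <= 5 * s by rewrite normcxx mulr_ge0// ltW.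
  have qk : normc (q - k) <= 5 * s by rewrite normcC.
  by case: zin => [[[]|]|] ->; case: zin' => [[[]|]|] ->; apply: close_translates.
have Om := closed_grid_path_parity Q0 (xs := xs) (ys := ys) (n := n).
have x0n : xs 0%N = xs n by rewrite /xs u0 un.
have y0n : ys 0%N = ys n by rewrite /ys u0 un.
have {Om} Om := Om V x0n y0n steps no_wind.
(* m is the first sample on the second part of the loop *)
have hm : exists i, (i <= n)%N && (T1 <= t_ i) by exists n; rewrite leqnn t_n.
case: (ex_minnP hm) => m /andP[mn tm] mmin.
have gam_delta i : (i < m)%N -> 20 * s <= delta D (u i).
  move=> im; apply: Hgam.
  have i_n : (i <= n)%N := leq_trans (ltnW im) mn.
  have [-> _] := andP (t_in i i_n); rewrite /= leNgt; apply/negP => /ltW h.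
  have : (m <= i)%N by apply: mmin; rewrite i_n h.
  by rewrite leqNgt im.
(* on the first part all cells are good, so no jump occurs *)
have before i : (i < m)%N -> jumpH V Q (xs i) (xs i.+1) (ys i) (+)
      jumpV V Q (xs i.+1) (ys i) (ys i.+1) = false.
  move=> im; have i_n : (i < n)%N := leq_trans im mn.
  have du := gam_delta i im; have Du := uD i (ltnW i_n).
  have [g1 g2] := ug i (ltnW i_n); have [g3 g4] := ug i.+1 i_n.
  have [g5 g6] := vg i i_n.
  have st := ustep i i_n; have sv := vu i i_n; rewrite normcC in sv.
  have du' := delta_lip D0 oD bD (u i) (u i.+1).
  have dv := delta_lip D0 oD bD (u i) (v i).
  have Dv : D (v i) by apply: (delta_ball D0 oD bD Du); lra.
  have G1 : good_cell D w s Z (xs i) (ys i) by apply: good_cell_near => //; lra.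
  have G2 : good_cell D w s Z (xs i.+1) (ys i.+1).
    by apply: good_cell_near => //; [exact: uD|lra].
  have G3 : good_cell D w s Z (xs i.+1) (ys i).
    by apply: (@good_cell_near w s Z (v i)) => //; lra.
  have [s1 s2 s3 s4] := steps i i_n.
  have -> : jumpH V Q (xs i) (xs i.+1) (ys i) = false.
    apply/negP => /and3P[q q']; rewrite /V (component_const _ BZ q q' G1 G3) ?addbb//.
    case: (near_nat s1 s2) => [->|h]; [by left|right].
    by rewrite /cell_adjacent eqxx h /= orbT.
  apply/negP => /and3P[q q']; rewrite /V (component_const _ BZ q q' G3 G2) ?addbb//.
  case: (near_nat s3 s4) => [->|h]; [by left|right].
  by rewrite /cell_adjacent eqxx h.
have boxed p : normc (p - w) <= (B%:R - 1) * s -> Q (cellx w s Z p) (celly w s Z p).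
  by move=> /(cell_in_box s0 (ltnW BZ))[h1 h2 h3 h4]; apply/and4P.
(* on the second part all cells are in the box, so the jumps telescope *)
have after i : (m <= i)%N -> (i < n)%N -> jumpH V Q (xs i) (xs i.+1) (ys i) (+)
      jumpV V Q (xs i.+1) (ys i) (ys i.+1) = V (xs i) (ys i) (+) V (xs i.+1) (ys i.+1).
  move=> mi i_n.
  have tmono j : (m <= j)%N -> (j <= n)%N -> T1 <= t_ j <= T.
    move=> mj jn; have [_ ->] := andP (t_in j jn); rewrite andbT; apply: (le_trans tm).
    by rewrite /t_ ler_wpM2r// ler_pM2r ?invr_gt0// ler_nat.
  have E1 : (B%:R - 20) * s = B%:R * s - 20 * s by ring.
  have E2 : (B%:R - 1) * s = B%:R * s - s by ring.
  have hu := Halp _ (tmono i mi (ltnW i_n)); rewrite -/w -/(u i) in hu.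
  have hu' := Halp _ (tmono i.+1 (leq_trans mi (leqnSn i)) i_n).
  rewrite -/w -/(u i.+1) in hu'.
  have sv := vu i i_n.
  have q1 : Q (xs i) (ys i) by apply: boxed; lra.
  have q2 : Q (xs i.+1) (ys i.+1) by apply: boxed; lra.
  have q3 : Q (xs i.+1) (ys i).
    by apply: (boxed (v i)); have := normc_triangle (u i) (v i) w; lra.
  rewrite /jumpH /jumpV q1 q2 q3 /=.
  by case: (V (xs i) (ys i)); case: (V (xs i.+1) (ys i)); case: (V (xs i.+1) (ys i.+1)).
have Vn : V (xs n) (ys n).
  have cz : Num.truncn ((Z%:R : R)) = Z by exact: natrK.
  rewrite /xs /ys un /cellx /celly /gridx /gridy !subrr !mul0r !add0r cz.
  exact: base_component0.
have Vm : V (xs m) (ys m).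
  move: Om; rewrite (big_cat_nat (n := m))//= [X in X (+) _]big_nat_cond big1; last first.
    by move=> i /andP[/andP[_ im] _]; exact: before.
  rewrite addFb big_nat_cond (eq_bigr (fun i => V (xs i) (ys i) (+) V (xs i.+1) (ys i.+1))).
    rewrite -big_nat_cond (addb_big_telescope (fun i => V (xs i) (ys i)) mn) Vn.
    by case: (V _ _).
  by move=> i /andP[/andP[mi i_n] _]; exact: after.
have T1in : 0 <= T1 <= T by rewrite T10.
have D1 := fD _ T1in.
have d1 : 20 * s <= delta D (f T1) by apply: Hgam; rewrite T10 lexx.
have dw : 20 * s <= delta D w by apply: Hgam; rewrite lexx.
have Dw : D w by rewrite -u0; exact: uD.
have mT : normc (f T1 - u m) <= s.
  case: m tm mmin mn Vm {gam_delta before after} => [|m] tm mmin mn Vm.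
    have t0 : T1 = 0 by apply/eqP; rewrite eq_le T10 andbT; move: tm; rewrite /t_ !mul0r.
    by rewrite t0 /u /t_ !mul0r normcxx ltW.
  have tm' : t_ m < T1.
    rewrite ltNge; apply/negP => h; have : (m.+1 <= m)%N by apply: mmin; rewrite h ltnW.
    by rewrite ltnn.
  apply: le_trans (fl _ _ T1in (t_in _ mn)) _.
  rewrite ler0_norm; last by lra.
  have : t_ m.+1 = t_ m + T / n%:R by rewrite /t_ -[m.+1%:R]natr1; field; rewrite gt_eqF.
  lra.
have [gm1 gm2] := ug m mn.
have cm := center_near s0 gm1 gm2; rewrite -/(xs m) -/(ys m) in cm.
have [gw1 gw2] := ug n (leqnn n); rewrite un in gw1 gw2.
have cw := center_near s0 gw1 gw2.
have cellw : cellx w s Z w = Z /\ celly w s Z w = Z.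
  by rewrite /cellx /celly /gridx /gridy !subrr !mul0r !add0r natrK.
rewrite cellw.1 cellw.2 in cw.
have h1 : qle D w (center w s Z Z Z) 1.
  apply: qle_mono (qle_near D0 oD bD Dw _); last by lra.
  have d0 := delta_gt0 D0 oD bD Dw.
  by rewrite mulrA ler_pdivrMr//; lra.
have DZ : D (center w s Z Z Z) by apply: (delta_ball D0 oD bD Dw); lra.
have h2 := base_component_qle D0 oD bD s0 BZ DZ Vm.
have cT : normc (f T1 - center w s Z (xs m) (ys m)) <= 2 * s.
  by have := normc_triangle (u m) (f T1) (center w s Z (xs m) (ys m)); lra.
have h3 : qle D (center w s Z (xs m) (ys m)) (f T1) 1.
  apply: qle_sym => //.
  apply: qle_mono (qle_near D0 oD bD D1 _); last by lra.
  have d0 := delta_gt0 D0 oD bD D1.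
  by rewrite mulrA ler_pdivrMr//; lra.
apply: qle_mono (qle_trans (qle_trans h1 h2) h3); lra.
Qed.

End Loop.

(** * The John condition implies the metric inequality *)

Section MetricBoundFromJohn.
Variables (R : realType) (D : set R[i]^o).
Implicit Types (f g : R -> R[i]^o) (L : R).

(** The curve f1 on [0, L1], followed by f2. *)
Definition concat_curve L1 f1 f2 : R -> R[i]^o :=
  fun t => if t <= L1 then f1 t else f2 (t - L1).

Lemma concat_curve_lip L1 L2 f1 f2 : lip_curve D L1 f1 -> lip_curve D L2 f2 ->
  f1 L1 = f2 0 -> lip_curve D (L1 + L2) (concat_curve L1 f1 f2).
Proof.
move=> [L10 D1 l1] [L20 D2 l2] E; split; first by rewrite addr_ge0.
  move=> t /andP[t0 tL]; rewrite /concat_curve; case: leP => h.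
    by apply: D1; rewrite t0.
  by apply: D2; apply/andP; split; lra.
move=> s u; wlog su : s u / s <= u.
  move=> H sL uL; have [su|/ltW us] := leP s u; first exact: H.
  by rewrite normcC distrC; exact: H.
move=> /andP[s0 sL] /andP[u0 uL]; rewrite /concat_curve.
case: (leP u L1) => hu; case: (leP s L1) => hs; try lra.
- by apply: l1; rewrite ?s0 ?u0.
- apply: le_trans (normc_triangle (f1 L1) _ _) _.
  have := l1 s L1; rewrite s0 hs L10 lexx => /(_ isT isT) h1.
  have := l2 0 (u - L1); rewrite lexx L20 -E => /(_ isT) h2.
  have {}h2 := h2 (ltac:(apply/andP; split; lra)).
  rewrite ler0_norm in h1; last lra.
  rewrite sub0r normrN ger0_norm in h2; last lra.
  by rewrite ler0_norm; lra.
- have -> : s - u = s - L1 - (u - L1) by ring.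
  by apply: l2; apply/andP; split; lra.
Qed.

Lemma concat_curve_start L1 f1 f2 : 0 <= L1 -> concat_curve L1 f1 f2 0 = f1 0.
Proof. by rewrite /concat_curve => ->. Qed.

Lemma concat_curve_end L1 L2 f1 f2 : 0 <= L2 -> f1 L1 = f2 0 ->
  concat_curve L1 f1 f2 (L1 + L2) = f2 L2.
Proof.
move=> L20 E; rewrite /concat_curve gerDl; case: leP => h.
  have -> : L2 = 0 by lra.
  by rewrite addr0.
by rewrite addrAC subrr add0r.
Qed.

Lemma sub_curve L f (a b : R) : lip_curve D L f -> 0 <= a -> a <= b -> b <= L ->
  lip_curve D (b - a) (fun t => f (a + t)).
Proof.
move=> [L0 fD fl] a0 ab bL; split; first lra.
  by move=> t /andP[t0 tb]; apply: fD; apply/andP; split; lra.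
move=> s u /andP[s0 sb] /andP[u0 ub].
have -> : s - u = a + s - (a + u) by ring.
by apply: fl; apply/andP; split; lra.
Qed.

Lemma rev_curve L f : lip_curve D L f -> lip_curve D L (fun t => f (L - t)).
Proof.
move=> [L0 fD fl]; split => //.
  by move=> t /andP[t0 tb]; apply: fD; apply/andP; split; lra.
move=> s u /andP[s0 sb] /andP[u0 ub].
have -> : `|s - u| = `|L - s - (L - u)| by rewrite distrC; congr `|_|; ring.
by apply: fl; apply/andP; split; lra.
Qed.

Hypotheses (D0 : D !=set0) (oD : open D) (bD : bounded_set D).

Lemma ln_lower (x : R) : 0 <= x -> x <= 1 -> x / 2 <= ln (1 + x).
Proof.
move=> x0 x1; have p : 0 < 1 + x by lra.
have := @le_ln1Dx _ ((1 + x)^-1 - 1).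
rewrite addrCA subrr addr0 lnV ?posrE// => h.
have q : (1 + x)^-1 * (1 + x) = 1 by rewrite mulVf// gt_eqF.
have i0 : 0 < (1 + x)^-1 by rewrite invr_gt0.
have {}h : - ln (1 + x) <= (1 + x)^-1 - 1 by apply: h; lra.
have : (1 + x)^-1 <= 1 - x / 2.
  rewrite -(ler_pM2r p) q; have : 0 <= x * (1 - x) by rewrite mulr_ge0//; lra.
  lra.
lra.
Qed.

(** The ratio of the geometric steps in [carrot_chain]. *)
Definition step_ratio (c : R) : R := 1 + 1 / (15 * c).

(** The steps grow geometrically, so that their number is logarithmic in sigma. *)
Lemma carrot_chain (c : R) L f (sigma : R) : 1 <= c -> lip_curve D L f ->
  0 <= sigma <= L -> (forall s, 0 <= s <= sigma -> s <= c * delta D (f s)) ->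
  qle D (f 0) (f sigma)
    ((ln (step_ratio c))^-1 / 4 * ln (1 + sigma / delta D (f 0)) + 1 / 4).
Proof.
move=> c1 [L0 fD fl] /andP[sig0 sigL] H.
have D_0 : D (f 0) by apply: fD; rewrite lexx.
have d0 := delta_gt0 D0 oD bD D_0; set d := delta D (f 0) in d0 *.
have c15 : 0 < 15 * c by lra.
have q1 : 1 < step_ratio c by rewrite /step_ratio ltrDl divr_gt0.
have q0 : 0 < step_ratio c by lra.
(* near f 0 use that delta is 1-Lipschitz, further away the hypothesis *)
have thick s : 0 <= s <= sigma -> d + s <= 3 * c * delta D (f s).
  move=> sI; have [s0 ss] := andP sI.
  have h := H s sI.
  have sL : 0 <= s <= L by rewrite s0 (le_trans ss).
  have := delta_lip D0 oD bD (f 0) (f s); rewrite -/d => h2.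
  have := fl 0 s; rewrite lexx L0 sL sub0r normrN ger0_norm// => /(_ isT isT) h3.
  have ds := delta_gt0 D0 oD bD (fD s sL).
  have dc : delta D (f s) <= c * delta D (f s) by rewrite ler_peMl// ltW.
  lra.
have main N s : 0 <= s <= sigma -> d + s <= d * step_ratio c ^+ N ->
    qle D (f 0) (f s) (N%:R / 4).
  elim: N s => [|N IH] s sI hN.
    have -> : s = 0 by move: hN (andP sI) => /[swap] -[? ?]; rewrite expr0 mulr1; lra.
    by rewrite mul0r; exact: qle_refl.
  have [s0 ss] := andP sI.
  (* s' is the previous point of the geometric progression *)
  pose s' := Num.max 0 ((d + s) / step_ratio c - d).
  have s'0 : 0 <= s' by rewrite /s' le_max lexx.
  have ge : (d + s) / step_ratio c - d <= s' by rewrite /s' le_max lexx orbT.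
  have ds0 : 0 <= d + s by rewrite addr_ge0// ltW.
  have s's : s' <= s.
    rewrite /s' ge_max s0 /= lerBlDr addrC ler_pdivrMr// ler_peMr//; lra.
  have s'I : 0 <= s' <= sigma by rewrite s'0 (le_trans s's).
  have IHs : qle D (f 0) (f s') (N%:R / 4).
    apply: IH => //; rewrite /s'; case: (leP 0 ((d + s) / step_ratio c - d)) => h.
      rewrite addrC subrK ler_pdivrMr//.
      by rewrite -mulrA -exprSr.
    rewrite addr0 ler_peMr ?(ltW d0)// exprn_ege1// ltW//.
  have Ds' : D (f s') by apply: fD; rewrite s'0 (le_trans _ sigL)// (le_trans s's).
  have gap : s - s' <= (d + s') / (15 * c).
    move: ge; rewrite lerBlDr ler_pdivrMr// /step_ratio mulrDr mulr1 mulrA mulr1; lra.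
  have gap5 : (d + s') / (15 * c) <= delta D (f s') / 5.
    rewrite ler_pdivrMr//; have := thick s' s'I; lra.
  have fs : normc (f s' - f s) <= delta D (f s') / 5.
    apply: le_trans (fl s' s _ _) _.
    - by rewrite s'0 (le_trans _ sigL)// (le_trans s's).
    - by rewrite s0 (le_trans ss).
    by rewrite ler0_norm; lra.
  rewrite -natr1 mulrDl; apply: (qle_trans IHs).
  apply: qle_mono (qle_near D0 oD bD Ds' fs).
  have dd := delta_gt0 D0 oD bD Ds'.
  have : normc (f s' - f s) / delta D (f s') <= 1 / 5 by rewrite ler_pdivrMr//; lra.
  lra.
have l0 : 0 < ln (step_ratio c) by rewrite ln_gt0.
have p0 : 0 < 1 + sigma / d by rewrite ltr_pwDl// divr_ge0// ltW.
pose X := ln (1 + sigma / d).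
have X0 : 0 <= X by rewrite ln_ge0// lerDl divr_ge0// ltW.
pose N := (Num.truncn (X / ln (step_ratio c))).+1.
apply: (@qle_mono _ _ (N%:R / 4)).
  have : (Num.truncn (X / ln (step_ratio c)))%:R <= X / ln (step_ratio c).
    by rewrite truncn_le divr_ge0// ltW.
  by rewrite /N -natr1 -/X; lra.
apply: main; first by rewrite sig0 lexx.
have -> : d + sigma = d * (1 + sigma / d) by field; rewrite gt_eqF.
rewrite ler_pM2l// -ler_ln ?posrE ?exprn_gt0// lnXn// -mulr_natr [_ * N%:R]mulrC -ler_pdivrMr//.
exact: ltW (truncnS_gt _).
Qed.

(** The John condition in terms of a 1-Lipschitz parametrization. *)
Lemma john_curve (c : R) z1 z2 a b g : rectifiable_arc D z1 z2 a b g ->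
  {in `[a, b], forall t, (Order.min (arc_length a t g) (arc_length t b g)
     <= (c * delta D (g t))%:E)%E} ->
  exists L f, [/\ lip_curve D L f, f 0 = z1, f L = z2 &
    forall s, 0 <= s <= L -> s <= c * delta D (f s) \/ L - s <= c * delta D (f s)].
Proof.
move=> [pg _] H; exists (fine (arc_length a b g)), (arc_length_param a b g).
split; [exact: path_param_curve pg|exact: path_param0 pg|exact: path_paramL pg|].
move=> s sL; have [t [tab tE ->]] := path_paramE pg sL.
have := H t; rewrite in_itv /= => /(_ tab); rewrite ge_min tE lee_fin => /orP[->|]; first by left.
case: (pg) => _ _ _ _ fin; have [at_ tb] := andP tab => h; right.
move: h; have := arc_lengthD at_ tb fin; rewrite tE.
have := arc_length_fin at_ tb (lexx _) fin => /fineK <-.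
move=> ->; rewrite -EFinD /= lee_fin; lra.
Qed.

Lemma inner_dist_ge x y : ((normc (x - y))%:E <= inner_dist D x y)%E.
Proof.
apply: le_ereal_inf_tmp => _ [a [b [g [[ab _ _ [<- <-] _] ->]]]].
by rewrite normcC; exact: arc_length_ge.
Qed.

Lemma j'_distE x y : D x -> D y -> j'_dist D x y =
  (ln (1 + fine (inner_dist D x y) / delta D x) +
   ln (1 + fine (inner_dist D x y) / delta D y)) / 2.
Proof.
move=> Dx Dy; have dx := delta_gt0 D0 oD bD Dx; have dy := delta_gt0 D0 oD bD Dy.
have fi0 : 0 <= fine (inner_dist D x y) by apply: fine_ge0; exact: inner_dist_ge0.
rewrite /j'_dist lnM ?posrE ?ltr_pwDl ?divr_ge0 ?(ltW dx) ?(ltW dy)//.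
by rewrite mulrC.
Qed.

Hypothesis scD : simply_connected D.
Variable c : R.
Hypotheses (c1 : 1 <= c) (john : forall z1 z2, D z1 -> D z2 ->
  exists a b g, rectifiable_arc D z1 z2 a b g /\
    {in `[a, b], forall t, (Order.min (arc_length a t g) (arc_length t b g)
       <= (c * delta D (g t))%:E)%E}).

(** The half-width, in cells, of the box used to join the two middle points. *)
Definition box_size : nat := (Num.truncn (80 * c)).+1 + 20.
(** The cost of joining the two middle points, from [loop_bottleneck]. *)
Definition middle_cst : R := ((box_size + box_size) * (box_size + box_size))%:R / 4 + 2.

(** The loop runs along the middle part of f, then along f to its end, back to the
beginning of f by a short path, and along f again to its starting point. *)
Lemma middle_chain L f (lam : R) : lip_curve D L f -> 0 < lam -> 2 * lam <= L ->
  (forall s, 0 <= s <= L -> s <= c * delta D (f s) \/ L - s <= c * delta D (f s)) ->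
  (inner_dist D (f 0%R) (f L) < (2 * lam)%:E)%E ->
  qle D (f lam) (f (L - lam)) middle_cst.
Proof.
move=> cf lam0 lamL H il; have c1' := c1.
have [L0 _ _] := cf.
have [_ [a [b [h [ph ->]]]] hl] := ereal_inf_lt il.
have ch := path_param_curve ph.
have hE := path_lengthE ph; rewrite hE lte_fin in hl.
have h0 := path_param0 ph; have hL := path_paramL ph.
set l := fine (arc_length a b h) in ch hE hl hL.
set hh := arc_length_param a b h in ch h0 hL.
have l0 : 0 <= l by case: ch.
have rh := rev_curve ch.
have c2 := sub_curve (a := L - lam) (b := L) cf.
have {}c2 : lip_curve D (L - (L - lam)) (fun t => f (L - lam + t)) by apply: c2; lra.
have c3 := sub_curve (a := 0) (b := lam) cf.
have {}c3 : lip_curve D (lam - 0) (fun t => f (0 + t)) by apply: c3; lra.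
have cg := sub_curve (a := lam) (b := L - lam) cf.
have {}cg : lip_curve D (L - lam - lam) (fun t => f (lam + t)) by apply: cg; lra.
have E1 : f (L - lam + (L - (L - lam))) = hh (l - 0).
  by rewrite subr0 hL; congr f; ring.
have c23 := concat_curve_lip c2 rh E1.
set f23 := concat_curve _ _ _ in c23.
have E2 : f23 (L - (L - lam) + l) = f (0 + 0).
  by rewrite /f23 concat_curve_end// subrr h0 addr0.
have c234 := concat_curve_lip c23 c3 E2.
set fa := concat_curve _ _ _ in c234; set la := _ + (lam - 0) in c234.
have fa0 : fa 0 = f (L - lam).
  by rewrite /fa concat_curve_start /f23 ?concat_curve_start ?addr0//; lra.
have fal : fa la = f lam.
  by rewrite /fa /la concat_curve_end// ?subr0 ?add0r//; lra.
have E3 : f (lam + (L - lam - lam)) = fa 0 by rewrite fa0; congr f; ring.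
have cloop := concat_curve_lip cg c234 E3.
pose T1 := L - lam - lam; pose s := lam / (20 * c).
have T10 : 0 <= T1 by rewrite /T1; lra.
have s0 : 0 < s by rewrite /s divr_gt0//; lra.
have la0 : 0 <= la by rewrite /la; lra.
have lab : la <= 4 * lam by rewrite /la; lra.
have := loop_bottleneck (T1 := T1) (s := s) (B := box_size) D0 oD bD scD cloop.
set fl := concat_curve _ _ _.
have fl0 : fl 0 = f lam by rewrite /fl concat_curve_start// addr0.
have flT1 : fl T1 = f (L - lam).
  by rewrite /fl /concat_curve lexx /T1; congr f; ring.
have flend : fl (T1 + la) = f lam by rewrite /fl concat_curve_end.
rewrite fl0 flT1; apply => //.
- by rewrite T10 lerDl.
- move=> t /andP[t0 tT]; rewrite /fl /concat_curve tT.
  have -> : 20 * s = lam / c by rewrite /s; field; rewrite gt_eqF//; lra.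
  rewrite ler_pdivrMr; last lra.
  have [||] := H (lam + t).
  + by rewrite /T1 in tT; apply/andP; split; lra.
  + by rewrite mulrC; lra.
  + by rewrite /T1 in tT; rewrite mulrC; lra.
- move=> t /andP[tT tL].
  have [_ _ lip] := cloop.
  have := lip t (T1 + la); rewrite -/fl flend => hlip.
  apply: le_trans (hlip _ _) _.
  + by rewrite tL (le_trans T10).
  + by rewrite lexx addr_ge0.
  rewrite ler0_norm; last by rewrite subr_le0.
  have : 80 * c * s <= (box_size%:R - 20) * s.
    rewrite ler_pM2r// /box_size natrD addrK; exact: ltW (truncnS_gt _).
  have -> : 80 * c * s = 4 * lam by rewrite /s; field; rewrite gt_eqF//; lra.
  lra.
Qed.

(** The constant of the cost bound of [john_chain]. *)
Definition john_cst : R := (ln (step_ratio c))^-1 / 4 + 5 * (1 / 2 + middle_cst).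

Lemma middle_cst_ge0 : 0 <= middle_cst.
Proof. by rewrite /middle_cst addr_ge0// divr_ge0. Qed.

Lemma john_chain z1 z2 : D z1 -> D z2 -> 
  let lam := fine (inner_dist D z1 z2) in
  delta D z1 / 5 < lam -> delta D z2 / 5 < lam ->
  qle D z1 z2 (john_cst * (ln (1 + lam / delta D z1) + ln (1 + lam / delta D z2))).
Proof.
move=> Dz1 Dz2 lam hl1 hl2; have c1' := c1.
have [a [b [g [arcg jg]]]] := john Dz1 Dz2.
have [L [f [cf f0 fL jf]]] := john_curve arcg jg.
have [L0 fD fl] := cf.
have d1 := delta_gt0 D0 oD bD Dz1; have d2 := delta_gt0 D0 oD bD Dz2.
have lam0 : 0 < lam by apply: lt_trans hl1; rewrite divr_gt0.
have ilam : inner_dist D z1 z2 = lam%:E.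
  rewrite fineK// ge0_fin_numE ?inner_dist_ge0//.
  have [pg _] := arcg; case: (pg) => _ _ _ _ fin; apply: le_lt_trans fin.
  by apply: ereal_inf_lbound; exists a, b, g.
set X1 := ln _; set X2 := ln _.
pose A := (ln (step_ratio c))^-1 / 4.
have A0 : 0 <= A.
  rewrite /A divr_ge0// invr_ge0 ln_ge0// /step_ratio lerDl divr_ge0//; lra.
(* both logarithms are bounded below, so that constants are absorbed *)
have lnl d : 0 < d -> d / 5 < lam -> 1 / 10 <= ln (1 + lam / d).
  move=> dp dl; apply: (@le_trans _ _ (ln (1 + 1 / 5 : R))).
    have := @ln_lower (1 / 5); lra.
  have : 1 / 5 <= lam / d by rewrite ler_pdivlMr//; lra.
  by move=> h; rewrite ler_ln ?posrE; lra.
have X1l : 1 / 10 <= X1 by exact: lnl.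
have X2l : 1 / 10 <= X2 by exact: lnl.
have M0 := middle_cst_ge0.
have fin : A * X1 + 1 / 4 + middle_cst + (A * X2 + 1 / 4) <= john_cst * (X1 + X2).
  have -> : john_cst * (X1 + X2) =
     A * X1 + A * X2 + 5 * (1 / 2 + middle_cst) * (X1 + X2).
    by rewrite /john_cst -/A; ring.
  have : 5 * (1 / 2 + middle_cst) * (1 / 5) <= 5 * (1 / 2 + middle_cst) * (X1 + X2).
    by apply: ler_wpM2l; lra.
  lra.
have rf := rev_curve cf.
have ends (sig : R) : 0 <= sig -> sig <= lam -> 2 * sig <= L ->
    qle D z1 (f sig) (A * X1 + 1 / 4) /\ qle D z2 (f (L - sig)) (A * X2 + 1 / 4).
  move=> s0 sl sL.
  have mono d : 0 < d -> ln (1 + sig / d) <= ln (1 + lam / d).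
    move=> dp; have h1 : sig / d <= lam / d by rewrite ler_pM2r// invr_gt0.
    have h2 : 0 <= sig / d by rewrite divr_ge0// ltW.
    by rewrite ler_ln ?posrE; lra.
  split.
    have := @carrot_chain c L f sig c1 cf; rewrite f0 => h.
    apply: qle_mono (h _ _).
    - by rewrite lerD2r; apply: ler_wpM2l => //; exact: mono.
    - by apply/andP; split; lra.
    - move=> s /andP[t0 ts]; have [||] := jf s => //; first by apply/andP; split; lra.
      lra.
  have := @carrot_chain c L _ sig c1 rf; rewrite subr0 fL => h.
  apply: qle_mono (h _ _).
  - by rewrite lerD2r; apply: ler_wpM2l => //; exact: mono.
  - by apply/andP; split; lra.
  - move=> s /andP[t0 ts]; have [||] := jf (L - s) => //; first by apply/andP; split; lra.
      lra.
    lra.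
(* a short John arc is cut in its middle *)
have [Lle|Lgt] := leP L (2 * lam).
  have [||| h1 h2] := ends (L / 2); [lra|lra|lra|].
  have E : L - L / 2 = L / 2 by field.
  rewrite E in h2.
  apply: qle_mono (qle_trans h1 (qle_sym h2)).
  by move: fin M0; rewrite /A; lra.
have [||| h1 h2] := ends lam; [lra|lra|lra|].
have h3 : qle D (f lam) (f (L - lam)) middle_cst.
  apply: middle_chain => //; first exact: ltW.
  by rewrite f0 fL ilam lte_fin; lra.
exact: qle_mono fin (qle_trans (qle_trans h1 h3) (qle_sym h2)).
Qed.

Lemma metric_bound_of_john : exists2 c2 : R, 1 <= c2 & forall z1 z2,
  D z1 -> D z2 -> (m_dist D z1 z2 <= (c2 * j'_dist D z1 z2)%:E)%E.
Proof.
exists (Num.max 20 (8 * john_cst)).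
  by rewrite le_max; apply/orP; left; lra.
move=> z1 z2 Dz1 Dz2.
have d1 := delta_gt0 D0 oD bD Dz1; have d2 := delta_gt0 D0 oD bD Dz2.
have i0 := inner_dist_ge0 D z1 z2.
have E := j'_distE Dz1 Dz2.
set lam := fine (inner_dist D z1 z2) in E.
have lam0 : 0 <= lam by apply: fine_ge0.
have X0 d : 0 < d -> 0 <= ln (1 + lam / d).
  by move=> dp; rewrite ln_ge0// lerDl divr_ge0// ltW.
have j0 : 0 <= j'_dist D z1 z2.
  by rewrite E divr_ge0// addr_ge0// X0.
have M1 : 20 * j'_dist D z1 z2 <= Num.max 20 (8 * john_cst) * j'_dist D z1 z2.
  by rewrite ler_wpM2r// le_max lexx.
have M2 : 8 * john_cst * j'_dist D z1 z2 <= Num.max 20 (8 * john_cst) * j'_dist D z1 z2.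
  by rewrite ler_wpM2r// le_max lexx orbT.
have dist : normc (z1 - z2) <= lam.
  have [a [b [g [[pg _] _]]]] := john Dz1 Dz2.
  rewrite -lee_fin fineK ?inner_dist_ge// ge0_fin_numE//.
  case: (pg) => _ _ _ _ fin; apply: le_lt_trans fin.
  by apply: ereal_inf_lbound; exists a, b, g.
have close x y : D x -> D y -> normc (x - y) <= lam -> lam <= delta D x / 5 ->
    0 <= ln (1 + lam / delta D y) ->
    j'_dist D z1 z2 = (ln (1 + lam / delta D x) + ln (1 + lam / delta D y)) / 2 ->
    qle D x y (5 * j'_dist D z1 z2).
  move=> Dx Dy xy h Y0 ->.
  have dx := delta_gt0 D0 oD bD Dx.
  have xy5 := le_trans xy h.
  apply: qle_mono (qle_near D0 oD bD Dx xy5).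
  have lx : lam / delta D x <= 1 by rewrite ler_pdivrMr//; lra.
  have := ln_lower (divr_ge0 lam0 (ltW dx)) lx.
  have : normc (x - y) / delta D x <= lam / delta D x by rewrite ler_pM2r ?invr_gt0.
  lra.
have [h1|h1] := leP lam (delta D z1 / 5).
  apply: le_trans (qle_m_dist D0 oD bD (close _ _ Dz1 Dz2 dist h1 (X0 _ d2) E)) _.
  by rewrite lee_fin; lra.
have [h2|h2] := leP lam (delta D z2 / 5).
  have E' := E; rewrite addrC in E'.
  rewrite normcC in dist.
  have := close _ _ Dz2 Dz1 dist h2 (X0 _ d1) E' => /(qle_sym) h.
  apply: le_trans (qle_m_dist D0 oD bD h) _.
  by rewrite lee_fin; lra.
apply: le_trans (qle_m_dist D0 oD bD (john_chain Dz1 Dz2 h1 h2)) _.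
rewrite -/lam lee_fin; apply: le_trans M2.
rewrite E; lra.
Qed.

End MetricBoundFromJohn.

Unset Implicit Arguments.

Theorem proposition3p7 (R : realType) (D : set R[i]^o)
    (domD : domain D) (bndD : bounded_set D) (scD : simply_connected D) :
  john_disk D <->
  exists2 c2 : R, 1 <= c2 & forall z1 z2 : R[i]^o, D z1 -> D z2 ->
    (m_dist D z1 z2 <= (c2 * j'_dist D z1 z2)%:E)%E.
Proof.
have [D0 oD _] := domD; split.
  by move=> [_ _ _ [c c1 john]]; exact: (metric_bound_of_john D0 oD bndD scD c1 john).
move=> [c2 c21 Hm]; split => //.
exact: (john_arc_of_metric_bound D0 oD bndD c21 Hm).
Qed.
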